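(* Let $X\subset\mathcal{H}(\mathbb{D})$ be a Banach space such that $H^\infty\subset X$. (i) If $X$ is separable, then $T(X,H^\infty)\subset A$. (ii) If $X$ is reflexive and admissible, then $T(X,H^\infty)=T(X,A)$.
   Context: $\mathbb{D}$ is the open unit disc, $\mathcal{H}(\mathbb{D})$ the space of analytic functions in $\mathbb{D}$, $H^\infty$ the bounded analytic functions with sup norm, $A$ the disc algebra (functions analytic in $\mathbb{D}$ and continuous on $\overline{\mathbb{D}}$, sup norm). For $g\in\mathcal{H}(\mathbb{D})$, $T_g(f)(z)=\int_0^z f(\zeta)g'(\zeta)\,d\zeta$. $T(X,H^\infty)$ (resp. $T(X,A)$) is the set of $g\in\mathcal{H}(\mathbb{D})$ such that $T_g:X\to H^\infty$ (resp. $T_g:X\to A$) is bounded. A Banach space $X\subset\mathcal{H}(\mathbb{D})$ is admissible if: (P1) $A\subset X$; (P2) if $f\in X$, then $f_r\in X$ for $0<r<1$, where $f_r(z)=f(rz)$, and $\sup_{0<r<1}\|f_r\|_X\le C\|f\|_X$ with $C$ independent of $f$; (P3) for every $z\in\mathbb{D}$ the point evaluation $f\mapsto f(z)$ belongs to $X^*$. *)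

(* Defs.v *)
From HB Require Import structures.
From mathcomp Require Import all_boot all_order all_algebra.
From mathcomp Require Import all_classical all_reals all_analysis.
From mathcomp Require Import complex.
Import Order.TTheory GRing.Theory Num.Theory.
Import numFieldNormedType.Exports.

Set Implicit Arguments.
Unset Strict Implicit.
Unset Printing Implicit Defensive.

Local Open Scope classical_set_scope.
Local Open Scope ring_scope.

(* The cast to [numFieldType] is what makes the topology and the norm of a
   [numFieldType] available on [R[i]]. *)
Definition Cplx (R : realType) : numFieldType := R[i].

(* Norms over [Cplx R] are [Cplx R]-valued; this is their real value. *)
Definition rnorm (R : realType) (V : normedModType (Cplx R)) (v : V) : R :=
  complex.Re (`|v| : R[i]).

Definition real_to_Cplx (R : realType) (t : R) : Cplx R := (t%:C)%C.

Section FunctionsOnTheDisc.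
Variable R : realType.
Local Notation C := (Cplx R).

Definition disc : set C := [set z | `|z| < 1].
Definition closed_disc : set C := [set z | `|z| <= 1].

(* A function on the disc is represented by any [f : C -> C] extending it:
   every notion below depends on the values of [f] on [disc] only. *)
Definition eq_on_disc (f h : C -> C) : Prop := forall z, disc z -> f z = h z.

Definition HD : set (C -> C) :=
  [set f | forall z, disc z -> derivable f z 1].

Definition Hinf : set (C -> C) :=
  [set f | HD f /\ exists M : R, forall z, disc z -> rnorm (f z) <= M].

Definition disc_algebra : set (C -> C) :=
  [set f | HD f /\ exists h : C -> C,
     {within closed_disc, continuous h} /\ eq_on_disc f h].

(* The norm of both [Hinf] and [disc_algebra]. *)
Definition sup_norm (f : C -> C) : R := sup [set rnorm (f z) | z in disc].

Definition integral01 (F : R -> C) : C :=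
  ((\int[lebesgue_measure]_(t in `[0, 1]) complex.Re (F t))%R
   +i* (\int[lebesgue_measure]_(t in `[0, 1]) complex.Im (F t))%R)%C.

(* The integral of [f * g'] from [0] to [z], along the segment
   parametrized by [t |-> t z], [0 <= t <= 1]. *)
Definition T_op (g f : C -> C) : C -> C := fun z =>
  integral01 (fun t : R =>
    f (real_to_Cplx t * z) * derive1 g (real_to_Cplx t * z) * z).

Definition dilation (r : R) (f : C -> C) : C -> C :=
  fun z => f (real_to_Cplx r * z).

End FunctionsOnTheDisc.

Section NormedSpaces.
Variables (R : realType) (X : normedModType (Cplx R)).
Local Notation C := (Cplx R).

Definition separable_space : Prop := exists S : set X, countable S /\ dense S.

Definition continuous_dual : set (X -> C) :=
  [set phi : X -> C | scalar phi /\ continuous phi].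

Definition dual_norm (phi : X -> C) : R :=
  sup [set rnorm (phi x) | x in [set x | rnorm x <= 1]].

(* Elements of the bidual are represented by functions on [X -> C], of which
   only the values on [continuous_dual] matter. *)
Definition bidual : set ((X -> C) -> C) :=
  [set Phi |
    (forall (a : C) (phi psi : X -> C),
       continuous_dual phi -> continuous_dual psi ->
       Phi (fun x => a * phi x + psi x) = a * Phi phi + Phi psi) /\
    exists M : R, forall phi, continuous_dual phi ->
      rnorm (Phi phi) <= M * dual_norm phi].

(* Surjectivity of the canonical map from [X] to its bidual. *)
Definition reflexive_space : Prop :=
  forall Phi, bidual Phi ->
    exists x, forall phi, continuous_dual phi -> Phi phi = phi x.

End NormedSpaces.

Section SpacesOfAnalyticFunctions.
Variables (R : realType) (X : normedModType (Cplx R)).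
Local Notation C := (Cplx R).

(* [X] is a linear subspace of [HD], with its own norm: [iota] sends an element
   of [X] to the corresponding function on the disc. *)
Record subspace_of_HD (iota : X -> C -> C) : Prop := SubspaceOfHD {
  iota_HD : forall x, HD (iota x);
  iota_linear : forall (a : C) (x y : X),
    eq_on_disc (iota (a *: x + y)) (fun z => a * iota x z + iota y z);
  iota_inj : forall x y : X, eq_on_disc (iota x) (iota y) -> x = y
}.

Variable iota : X -> C -> C.

Definition functions_of : set (C -> C) :=
  [set f | exists x, eq_on_disc (iota x) f].

Record admissible : Prop := Admissible {
  admissible_disc_algebra : @disc_algebra R `<=` functions_of;
  admissible_dilation : exists K : R, forall (x : X) (r : R), 0 < r < 1 ->
    exists xr : X,
      eq_on_disc (iota xr) (dilation r (iota x)) /\ rnorm xr <= K * rnorm x;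
  admissible_eval : forall z, disc z -> continuous_dual (fun x : X => iota x z)
}.

(* [T(X, Y)] for a space [Y] of functions normed by [sup_norm]. *)
Definition TXY (Y : set (C -> C)) : set (C -> C) :=
  [set g | HD g /\
    (forall x, Y (T_op g (iota x))) /\
    exists M : R, forall x, sup_norm (T_op g (iota x)) <= M * rnorm x].

End SpacesOfAnalyticFunctions.

(* Main.v *)
(**
  Part (i). Constants lie in [X], so [g - g 0 = T_g 1] is bounded. Suppose [g] is not
  uniformly continuous on the disc. Then the oscillation of [g] accumulates at a boundary
  point [zeta]. With [u z := 1 - z / zeta], the peak functions [q_s := s / (s + u)] satisfy
  [q_s -> 1] at [zeta] as [z -> zeta], [q_s -> 0] locally uniformly as [s -> 0], and
  [|q_s - q_t| <= 4 (s / (s + |u|) - t / (t + |u|))], which telescopes. Hence for a rapidly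
  decreasing sequence [s_k] every [h_eps := \sum_k eps_k (q_(s_k) - q_(s_(k+1)))] with
  [eps_k] in {0, 1} is bounded, and one can choose pairs [z_n, w_n] such that
  [T_g h_eps z_n - T_g h_eps w_n] is [eps_n (g z_n - g w_n)] up to a factor 1/4. If [X] is
  separable, a diagonal choice of [eps] keeps [T_g h_eps] away from the image under [T_g] of
  a countable dense set, a contradiction.

  Part (ii). The functionals [lam_n x := (T_g x z_n - T_g x w_n) / (g z_n - g w_n)] are
  bounded on [X]. If [X] is reflexive, Mazur's lemma in the dual gives convex blocks of the
  [lam_n] converging in norm to a limit along a free ultrafilter; evaluating alternate blocks
  at the [h_eps] that is 1 on even blocks and 0 on odd ones gives a contradiction, so [g] is
  in the disc algebra. The dilations of [x] converge weakly to [x] (reflexivity and point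
  evaluations), so [x] is a norm limit of their convex combinations, on which [T_g] takes
  values in the disc algebra by partial integration.

  Only differentiability is assumed of the functions, so Cauchy's formula is obtained from
  Goursat's bisection argument, applied in the parameter space of a homotopy of circles.
*)
Require Import Defs.
From mathcomp Require Import all_boot all_order all_algebra.
From mathcomp Require Import all_classical all_reals all_analysis.
From mathcomp Require Import complex ring lra.
Import Order.TTheory GRing.Theory Num.Theory.
Import numFieldNormedType.Exports.

Set Implicit Arguments.
Unset Strict Implicit.
Unset Printing Implicit Defensive.

Local Open Scope classical_set_scope.
Local Open Scope ring_scope.

(** * Real-valued norms *)

(** The inclusion of [Hinf] in [X] is an inclusion of sets and carries no norm estimate, so the
    functions h_eps have no uniform bound in [X]. Both contradictions therefore fix a single eps and
    work with the one element of [X] that it yields. A reflexive space may fail to be separable,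
    hence the separate argument in (ii). The humps work for every bounded g because of partial
    integration: g' may be huge near the boundary, but T_g p z - T_g p w differs from p(z) (g z - g
    w) by at most a multiple of sup |g| sup |p'| |z - w|. The scales are chosen alternately: s_n,
    then a pair z_n, w_n whose distance is small compared with s_n, then s_(n+1), negligible on a
    disc containing the pair. Nothing here depends on eps, so the same pairs serve all eps. Limits
    along one fixed free ultrafilter serve for series, boundary values, accumulation points and weak
    limits alike: they exist for all bounded sequences, are linear, and preserve uniform
    estimates. *)

Section RealNorm.
Variables (R : realType) (V : normedModType (Cplx R)).
Implicit Types v w : V.

Lemma rnormE v : `|v| = real_to_Cplx (rnorm v).
Proof.
by rewrite /rnorm /real_to_Cplx (RRe_real (ger0_real (normr_ge0 v))).
Qed.

Lemma real_to_Cplx_le (a b : R) : (real_to_Cplx a <= real_to_Cplx b) = (a <= b).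
Proof. exact: lecR. Qed.

Lemma real_to_Cplx_lt (a b : R) : (real_to_Cplx a < real_to_Cplx b) = (a < b).
Proof. exact: ltcR. Qed.

Lemma rnorm_ge0 v : 0 <= rnorm v.
Proof. by rewrite -real_to_Cplx_le -rnormE normr_ge0. Qed.

Lemma rnormD v w : rnorm (v + w) <= rnorm v + rnorm w.
Proof.
have -> : rnorm v + rnorm w = complex.Re (real_to_Cplx (rnorm v) + real_to_Cplx (rnorm w)) by [].
rewrite -!rnormE; have := ler_normD v w; rewrite lecE => /andP[_]; exact: le_trans.
Qed.

Lemma rnorm0 : rnorm (0 : V) = 0.
Proof. by rewrite /rnorm normr0. Qed.

Lemma rnorm0_eq0 v : rnorm v = 0 -> v = 0.
Proof. by move=> v0; apply/eqP; rewrite -normr_eq0 rnormE v0. Qed.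

Lemma rnorm_gt0 v : (0 < rnorm v) = (v != 0).
Proof.
rewrite lt_neqAle rnorm_ge0 andbT eq_sym; congr (~~ _).
by apply/eqP/eqP => [/rnorm0_eq0|->]; rewrite ?rnorm0.
Qed.

Lemma rnormN v : rnorm (- v) = rnorm v.
Proof. by rewrite /rnorm normrN. Qed.

Lemma rnormBC v w : rnorm (v - w) = rnorm (w - v).
Proof. by rewrite -rnormN opprB. Qed.

Lemma rnormB v w : rnorm (v - w) <= rnorm v + rnorm w.
Proof. by rewrite -(rnormN w) rnormD. Qed.

Lemma rnorm_le_sub v w : rnorm v <= rnorm w + rnorm (v - w).
Proof. by rewrite -{1}(subrK w v) addrC rnormD. Qed.

Lemma rnormZ (a : Cplx R) v : rnorm (a *: v) = rnorm a * rnorm v.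
Proof.
have := normrZ a v; rewrite !rnormE /real_to_Cplx -rmorphM.
by move/complexI.
Qed.

End RealNorm.

Section ComplexNorm.
Variable R : realType.
Local Notation C := (Cplx R).
Local Notation rC := (@real_to_Cplx R).
Implicit Types z w : C.

Lemma rC0 : rC 0 = 0. Proof. by []. Qed.
Lemma rC1 : rC 1 = 1. Proof. by []. Qed.
Lemma rCD a b : rC (a + b) = rC a + rC b.
Proof. exact: rmorphD. Qed.
Lemma rCB a b : rC (a - b) = rC a - rC b.
Proof. exact: rmorphB. Qed.
Lemma rCN a : rC (- a) = - rC a.
Proof. exact: rmorphN. Qed.
Lemma rCM a b : rC (a * b) = rC a * rC b.
Proof. exact: rmorphM. Qed.
Lemma rCV a : rC a^-1 = (rC a)^-1.
Proof. exact: fmorphV. Qed.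

Lemma rnormM z w : rnorm (z * w) = rnorm z * rnorm w.
Proof. exact: (rnormZ z w). Qed.

Lemma rnormV z : rnorm z^-1 = (rnorm z)^-1.
Proof.
have := normfV z; rewrite !rnormE -rCV.
by move/complexI.
Qed.

Lemma rnorm1 : rnorm (1 : C) = 1.
Proof. by rewrite /rnorm normr1. Qed.

Lemma rnormX z n : rnorm (z ^+ n) = rnorm z ^+ n.
Proof. by elim: n => [|n IH]; rewrite ?expr0 ?rnorm1// !exprS rnormM IH. Qed.

Lemma rnormC_sqrt z : rnorm z = Num.sqrt (complex.Re z ^+ 2 + complex.Im z ^+ 2).
Proof. by rewrite /rnorm -[`|_|]/(`|z : R[i]|) normc_def. Qed.

Lemma rnorm_real (t : R) : rnorm (rC t) = `|t|.
Proof. by rewrite rnormC_sqrt /= expr0n addr0 sqrtr_sqr. Qed.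

Lemma normRe_le z : `|complex.Re z| <= rnorm z.
Proof.
rewrite rnormC_sqrt -[leLHS]sqrtr_sqr ler_wsqrtr// lerDl sqr_ge0//.
Qed.

Lemma normIm_le z : `|complex.Im z| <= rnorm z.
Proof.
rewrite rnormC_sqrt -[leLHS]sqrtr_sqr ler_wsqrtr// lerDr sqr_ge0//.
Qed.

Lemma Re_le z : complex.Re z <= rnorm z.
Proof. exact: le_trans (ler_norm _) (normRe_le z). Qed.

Lemma complex_split z : z = rC (complex.Re z) + 'i%C * rC (complex.Im z).
Proof. exact: complexE. Qed.

Lemma rnormi : rnorm ('i%C : C) = 1.
Proof. by rewrite rnormC_sqrt /= expr0n expr1n add0r sqrtr1. Qed.

Lemma rnorm_le_ReIm z : rnorm z <= `|complex.Re z| + `|complex.Im z|.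
Proof.
rewrite {1}(complex_split z) (le_trans (rnormD _ _))// rnormM rnormi mul1r.
by rewrite !rnorm_real.
Qed.

Lemma cRe_rCM (t : R) z : complex.Re (rC t * z) = t * complex.Re z.
Proof. by case: z => a b /=; rewrite mul0r subr0. Qed.
Lemma cIm_rCM (t : R) z : complex.Im (rC t * z) = t * complex.Im z.
Proof. by case: z => a b /=; rewrite mul0r addr0. Qed.
Lemma cReD z w : complex.Re (z + w) = complex.Re z + complex.Re w.
Proof. by case: z w => [a b] [c d]. Qed.
Lemma cImD z w : complex.Im (z + w) = complex.Im z + complex.Im w.
Proof. by case: z w => [a b] [c d]. Qed.
Lemma cReN z : complex.Re (- z) = - complex.Re z.
Proof. by case: z. Qed.
Lemma cImN z : complex.Im (- z) = - complex.Im z.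
Proof. by case: z. Qed.
Lemma cReM z w : complex.Re (z * w) =
  complex.Re z * complex.Re w - complex.Im z * complex.Im w.
Proof. by case: z w => [a b] [c d]. Qed.
Lemma cImM z w : complex.Im (z * w) =
  complex.Re z * complex.Im w + complex.Im z * complex.Re w.
Proof. by case: z w => [a b] [c d]. Qed.

Lemma disc_rnorm z : disc z = (rnorm z < 1) :> Prop.
Proof. by rewrite /disc /= rnormE -[X in _ < X]rC1 real_to_Cplx_lt. Qed.

Lemma closed_disc_rnorm z : closed_disc z = (rnorm z <= 1) :> Prop.
Proof. by rewrite /closed_disc /= rnormE -[X in _ <= X]rC1 real_to_Cplx_le. Qed.

Lemma Cplx_gt0 (e : C) : 0 < e -> exists2 d : R, 0 < d & e = rC d.
Proof.
move=> e0; exists (complex.Re e); last first.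
  by rewrite /real_to_Cplx (RRe_real (gtr0_real e0)).
by move: e0; rewrite ltcE => /andP[].
Qed.

End ComplexNorm.

(** * Complex and real derivatives *)

Section Deriv.
Variable R : realType.
Local Notation C := (Cplx R).
Local Notation rC := (@real_to_Cplx R).

(** A remainder bound instead of a difference quotient: [k = 0] needs no exception, and the version
    for a real parameter has the same shape, so that the chain rule can mix the two. *)
Definition is_cderiv (f : C -> C) (z c : C) := forall e : R, 0 < e ->
  exists2 d : R, 0 < d & forall k : C, rnorm k < d ->
    rnorm (f (z + k) - f z - k * c) <= e * rnorm k.

Definition is_rderiv (f : R -> C) (t : R) (c : C) := forall e : R, 0 < e ->
  exists2 d : R, 0 < d & forall k : R, `|k| < d ->
    rnorm (f (t + k) - f t - rC k * c) <= e * `|k|.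

Lemma is_cderivP (f : C -> C) z c :
  is_cderiv f z c <-> h^-1 *: (f (h + z) - f z) @[h --> (0:C)^'] --> c.
Proof.
split=> [fz|/cvgrPdist_le fz e e0].
  apply/cvgrPdist_le => _ /Cplx_gt0[e e0 ->].
  have [d d0 dP] := fz e e0.
  apply/nbhs_ballP; exists (rC d) => /=; first by rewrite -rC0 real_to_Cplx_lt.
  move=> h; rewrite -ball_normE/= sub0r normrN rnormE real_to_Cplx_lt => hd h0.
  rewrite rnormE real_to_Cplx_le.
  have h0' : 0 < rnorm (h : C) by rewrite rnorm_gt0.
  rewrite rnormBC -(ler_pM2l h0') -rnormM mulrC (mulrC _ e).
  have := dP h hd; congr (_ <= _); congr rnorm.
  by rewrite mulrBl [_ *: _]mulrC mulfVK// (addrC h z) mulrC.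
have [|d /= d0 dP] := (@nbhs_ballP _ _ _ _).1 (fz (rC e) _).
  by rewrite -rC0 real_to_Cplx_lt.
have [d' d'0 dE] := Cplx_gt0 d0.
exists d' => // k kd; have [->|k0] := eqVneq k 0.
  by rewrite addr0 subrr mul0r subrr rnorm0 mulr0.
have := dP k; rewrite -ball_normE/= sub0r normrN rnormE dE real_to_Cplx_lt.
move=> /(_ kd k0); rewrite rnormE real_to_Cplx_le => h.
have h0' : 0 < rnorm (k : C) by rewrite rnorm_gt0.
move: h; rewrite rnormBC -(ler_pM2l h0') -rnormM (mulrC _ e); congr (_ <= _); congr rnorm.
by rewrite mulrBr [_ *: _]mulrC mulrCA mulfV// mulr1 (addrC k z).
Qed.

Lemma is_cderiv_derive1 f z c : is_cderiv f z c -> derive1 f z = c.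
Proof. by move=> /is_cderivP fz; apply: cvg_lim. Qed.

Lemma derivable_is_cderiv f (z : C) : derivable f z 1 <-> is_cderiv f z (derive1 f z).
Proof.
have E : (fun h => h^-1 *: ((f \o shift z) (h *: 1) - f z)) =
    (fun h : C => h^-1 *: (f (h + z) - f z)).
  by apply/funext => h /=; rewrite /GRing.scale/= mulr1.
rewrite is_cderivP; split; rewrite /derivable /derive1 E; first by [].
by move=> h; apply: cvgP h.
Qed.

Lemma is_cderiv_derivable f (z c : C) : is_cderiv f z c -> derivable f z 1.
Proof. by move=> fz; apply/derivable_is_cderiv; rewrite (is_cderiv_derive1 fz). Qed.

Lemma HD_is_cderiv f z : HD f -> disc z -> is_cderiv f z (derive1 f z).
Proof. by move=> fD zD; apply/derivable_is_cderiv/fD. Qed.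

Lemma is_deriveP (g : R -> R) (t l : R) : is_derive t 1 g l <->
  forall e : R, 0 < e -> exists2 d : R, 0 < d & forall k : R, `|k| < d ->
    `|g (t + k) - g t - k * l| <= e * `|k|.
Proof.
have E : (fun h => h^-1 *: ((g \o shift t) (h *: 1) - g t)) =
    (fun h : R => h^-1 * (g (h + t) - g t)).
  by apply/funext => h /=; rewrite /GRing.scale/= mulr1.
split=> [[gt <-] e e0|H].
  move: gt; rewrite /derivable E => gt.
  have /cvgrPdist_le/(_ e e0) : h^-1 * (g (h + t) - g t) @[h --> (0:R)^'] --> 'D_1 g t.
    by rewrite /derive E.
  move=> /nbhs_ballP[d /= d0 dP].
  exists d => // k kd; have [->|k0] := eqVneq k 0.
    by rewrite addr0 subrr mul0r subrr normr0 mulr0.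
  have := dP k; rewrite -ball_normE/= sub0r normrN => /(_ kd k0).
  have h0' : 0 < `|k| by rewrite normr_gt0.
  rewrite distrC -(ler_pM2l h0') -normrM (mulrC _ e) mulrBr mulrA mulfV// mul1r.
  by rewrite (addrC t k).
suff : h^-1 * (g (h + t) - g t) @[h --> (0:R)^'] --> l.
  move=> hl; split; first by rewrite /derivable E; apply: cvgP hl.
  by rewrite /derive E; apply: cvg_lim.
apply/cvgrPdist_le => e e0; have [d d0 dP] := H e e0.
apply/nbhs_ballP; exists d => //= h; rewrite -ball_normE/= sub0r normrN => hd h0.
have h0' : 0 < `|h| by rewrite normr_gt0.
rewrite distrC -(ler_pM2l h0') -normrM (mulrC _ e) mulrBr mulrA mulfV// mul1r.
by rewrite (addrC h t) dP.
Qed.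

(** Gives access, through real and imaginary parts, to the real product rule, the derivatives of cos
    and sin, and the fundamental theorem of calculus. *)
Lemma is_rderivP (f : R -> C) t c : is_rderiv f t c <->
  is_derive t (1:R) (fun x => complex.Re (f x)) (complex.Re c) /\
  is_derive t (1:R) (fun x => complex.Im (f x)) (complex.Im c).
Proof.
rewrite !is_deriveP; split=> [H|[H1 H2] e e0].
  split=> e e0; have [d d0 dP] := H e e0; exists d => // k /dP; apply: le_trans.
    apply: le_trans (normRe_le _).
    by rewrite !(cReD, cReN, cRe_rCM).
  apply: le_trans (normIm_le _).
  by rewrite !(cImD, cImN, cIm_rCM).
have e2 : 0 < e / 2 by rewrite divr_gt0.
have [d1 d10 d1P] := H1 _ e2; have [d2 d20 d2P] := H2 _ e2.
exists (Num.min d1 d2); first by rewrite lt_min d10.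
move=> k; rewrite lt_min => /andP[/d1P k1 /d2P k2].
apply: le_trans (rnorm_le_ReIm _) _.
rewrite !(cReD, cReN, cRe_rCM, cImD, cImN, cIm_rCM).
lra.
Qed.

Lemma is_cderivE (f : C -> C) z c : is_cderiv f z c <-> is_derive z (1:C) f c.
Proof.
split=> [H|[H <-]].
  by split; [exact: is_cderiv_derivable H|rewrite -derive1E (is_cderiv_derive1 H)].
by rewrite -derive1E; apply/derivable_is_cderiv.
Qed.

Lemma ccontP (f : C -> C) (z : C) : {for z, continuous f} <->
  forall e : R, 0 < e -> exists2 d : R, 0 < d &
    forall w : C, rnorm (w - z) < d -> rnorm (f w - f z) <= e.
Proof.
split=> [/cvgrPdist_le H e e0|H].
  have [|_ /= /Cplx_gt0[d d0 ->] dP] := (@nbhs_ballP _ _ _ _).1 (H (rC e) _).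
    by rewrite -rC0 real_to_Cplx_lt.
  exists d => // w wz; have := dP w.
  rewrite -ball_normE/= !rnormE real_to_Cplx_lt real_to_Cplx_le => h.
  by rewrite rnormBC h// rnormBC.
apply/(@cvgrPdist_le _ C _ (nbhs z)) => _ /Cplx_gt0[e e0 ->]; have [d d0 dP] := H e e0.
apply/nbhs_ballP; exists (rC d) => /=; first by rewrite -rC0 real_to_Cplx_lt.
move=> w /=; rewrite -ball_normE /= !rnormE real_to_Cplx_lt real_to_Cplx_le => wd.
by rewrite rnormBC dP// rnormBC.
Qed.

Lemma rcontP (f : R -> C) (t : R) : {for t, continuous f} <->
  forall e : R, 0 < e -> exists2 d : R, 0 < d &
    forall w : R, `|w - t| < d -> rnorm (f w - f t) <= e.
Proof.
split=> [/cvgrPdist_le H e e0|H].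
  have [|d /= d0 dP] := (@nbhs_ballP _ _ _ _).1 (H (rC e) _).
    by rewrite -rC0 real_to_Cplx_lt.
  exists d => // w wz; have := dP w.
  rewrite -ball_normE/= !rnormE real_to_Cplx_le => h.
  by rewrite rnormBC h// distrC.
apply/cvgrPdist_le => _ /Cplx_gt0[e e0 ->]; have [d d0 dP] := H e e0.
exists d => //= w /= wd; rewrite rnormE real_to_Cplx_le.
by rewrite rnormBC dP// distrC.
Qed.

Lemma rcont_comp (f : C -> C) (g : R -> C) (t : R) : {for t, continuous g} ->
  {for g t, continuous f} -> {for t, continuous (fun x => f (g x))}.
Proof.
move=> /rcontP Hg /ccontP Hf; apply/rcontP => e /Hf[d d0 dP].
have [d' d'0 d'P] := Hg (d / 2) (divr_gt0 d0 (ltr0Sn _ 1)).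
exists d' => // w /d'P h; apply: dP; lra.
Qed.

Lemma Re_continuous (f : R -> C) t : {for t, continuous f} ->
  {for t, continuous (fun x => complex.Re (f x))}.
Proof.
move=> /rcontP H; apply/cvgrPdist_le => e e0; have [d d0 dP] := H e e0.
exists d => //= w /= wd.
rewrite distrC -cReN -cReD (le_trans (normRe_le _))//.
by rewrite dP// distrC.
Qed.

Lemma Im_continuous (f : R -> C) t : {for t, continuous f} ->
  {for t, continuous (fun x => complex.Im (f x))}.
Proof.
move=> /rcontP H; apply/cvgrPdist_le => e e0; have [d d0 dP] := H e e0.
exists d => //= w /= wd.
rewrite distrC -cImN -cImD (le_trans (normIm_le _))//.
by rewrite dP// distrC.
Qed.

Lemma rC_continuous : continuous (rC : R -> C).
Proof.
move=> t; apply/rcontP => e e0; exists e => // w /ltW.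
by rewrite -rCB rnorm_real.
Qed.

Lemma is_cderiv_continuous (f : C -> C) z c : is_cderiv f z c -> {for z, continuous f}.
Proof.
move=> H; apply/ccontP => e e0; have [d d0 dP] := H 1 ltr01.
have c0 : 0 < 1 + rnorm c by rewrite ltr_pwDl// rnorm_ge0.
exists (Num.min d (e / (1 + rnorm c))); first by rewrite lt_min d0 divr_gt0.
move=> w; rewrite lt_min ltr_pdivlMr// => /andP[wd we].
have := dP _ wd; rewrite mul1r addrCA subrr addr0 => h.
have := rnorm_le_sub (f w - f z) ((w - z) * c); rewrite rnormM.
lra.
Qed.

Lemma is_rderiv_continuous (f : R -> C) t c : is_rderiv f t c -> {for t, continuous f}.
Proof.
move=> H; apply/rcontP => e e0; have [d d0 dP] := H 1 ltr01.
have c0 : 0 < 1 + rnorm c by rewrite ltr_pwDl// rnorm_ge0.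
exists (Num.min d (e / (1 + rnorm c))); first by rewrite lt_min d0 divr_gt0.
move=> w; rewrite lt_min ltr_pdivlMr// => /andP[wd we].
have := dP _ wd; rewrite mul1r addrCA subrr addr0 => h.
have := rnorm_le_sub (f w - f t) (rC (w - t) * c); rewrite rnormM rnorm_real.
lra.
Qed.

Lemma is_rderiv_comp (g : C -> C) (f : R -> C) t c c' :
  is_rderiv f t c -> is_cderiv g (f t) c' -> is_rderiv (g \o f) t (c' * c).
Proof.
move=> Hf Hg e e0.
have A0 : 0 < 1 + rnorm c by rewrite ltr_pwDl// rnorm_ge0.
have B0 : 0 < 1 + rnorm c' by rewrite ltr_pwDl// rnorm_ge0.
have [d1 d10 H1] := Hg (e / 2 / (1 + rnorm c)) (divr_gt0 (divr_gt0 e0 (ltr0Sn _ 1)) A0).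
have [d2 d20 H2] := Hf (e / 2 / (1 + rnorm c')) (divr_gt0 (divr_gt0 e0 (ltr0Sn _ 1)) B0).
(* With error 1 this bounds the increment [D] of [f] by (1 + |c|) |k|, which keeps [D] inside the
   radius [d1]. *)
have [d3 d30 H3] := Hf 1 ltr01.
exists (Num.min d2 (Num.min d3 (d1 / (1 + rnorm c)))).
  by rewrite !lt_min d20 d30 divr_gt0.
move=> k; rewrite !lt_min ltr_pdivlMr// => /and3P[/H2 k2 /H3 k3 kd1].
set D := f (t + k) - f t.
have De : rnorm D <= `|k| * (1 + rnorm c).
  have := rnorm_le_sub D (rC k * c); rewrite rnormM rnorm_real.
  move: k3; rewrite -/D; lra.
have /H1 h1 : rnorm D < d1 by apply: le_lt_trans De kd1.
have := rnorm_le_sub ((g \o f) (t + k) - (g \o f) t - rC k * (c' * c)) (c' * (D - rC k * c)).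
rewrite rnormM /=.
have -> : g (f (t + k)) - g (f t) - rC k * (c' * c) - c' * (D - rC k * c) =
  g (f t + D) - g (f t) - D * c'.
  rewrite /D (addrC (f t)) subrK; ring.
move=> h; apply: le_trans h _.
have : rnorm c' * rnorm (D - rC k * c) <= e / 2 * `|k|.
  apply: (@le_trans _ _ ((1 + rnorm c') * (e / 2 / (1 + rnorm c') * `|k|))).
    by apply: ler_pM => //; rewrite ?rnorm_ge0 ?lerDr.
  by rewrite mulrA mulrCA mulfV ?mulr1 ?gt_eqF.
have : e / 2 / (1 + rnorm c) * rnorm D <= e / 2 * `|k|.
  rewrite -mulrA ler_pM2l ?divr_gt0// mulrC ler_pdivrMr//.
lra.
Qed.

Lemma is_rderivD f g t c c' : is_rderiv f t c -> is_rderiv g t c' ->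
  is_rderiv (fun x => f x + g x) t (c + c').
Proof.
move=> /is_rderivP[f1 f2] /is_rderivP[g1 g2]; apply/is_rderivP.
by split; [under eq_fun do rewrite cReD; rewrite cReD
          |under eq_fun do rewrite cImD; rewrite cImD]; apply: is_deriveD.
Qed.

Lemma is_rderivM f g t c c' : is_rderiv f t c -> is_rderiv g t c' ->
  is_rderiv (fun x => f x * g x) t (c * g t + f t * c').
Proof.
move=> /is_rderivP[f1 f2] /is_rderivP[g1 g2]; apply/is_rderivP.
split.
- under eq_fun do rewrite cReM; rewrite cReD !cReM.
  have H := is_deriveB (is_deriveM f1 g1) (is_deriveM f2 g2).
  apply: (is_derive_eq H).
  rewrite /GRing.scale/=; ring.
- under eq_fun do rewrite cImM; rewrite cImD !cImM.
  have H := is_deriveD (is_deriveM f1 g2) (is_deriveM f2 g1).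
  apply: (is_derive_eq H).
  rewrite /GRing.scale/=; ring.
Qed.

Lemma is_rderiv_cst a t : is_rderiv (fun=> a) t 0.
Proof.
move=> e e0; exists 1 => // k _.
by rewrite subrr sub0r mulr0 oppr0 rnorm0 mulr_ge0// ltW.
Qed.

Lemma is_rderiv_rC t : is_rderiv rC t 1.
Proof.
move=> e e0; exists 1 => // k _.
by rewrite rCD mulr1 (addrC (rC t)) addrK subrr rnorm0 mulr_ge0// ltW.
Qed.

End Deriv.

(** * Integrals of complex-valued functions *)

Section ComplexIntegral.
Variable R : realType.
Local Notation C := (Cplx R).
Local Notation rC := (@real_to_Cplx R).
Local Notation mu := (@lebesgue_measure R).
Implicit Types (F G W : R -> C) (a b c : R).

(** Convertible to [integral01] when a = 0 and b = 1; general endpoints are needed for bisection. *)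
Definition cint F a b : C :=
  ((\int[mu]_(t in `[a, b]) complex.Re (F t))%R
   +i* (\int[mu]_(t in `[a, b]) complex.Im (F t))%R)%C.

(** Two-sided continuity even at the endpoints: the curves used below extend beyond the interval,
    which avoids subspace topologies. *)
Definition cont_on F a b := forall t, a <= t <= b -> {for t, continuous F}.

Lemma cont_within (f : R -> R) a b : (forall t, a <= t <= b -> {for t, continuous f}) ->
  {within `[a, b], continuous f}.
Proof.
by move=> H; apply: continuous_in_subspaceT => t /set_mem/=; rewrite in_itv/= => /H.
Qed.

Lemma integrable_cont (f : R -> R) a b :
  (forall t, a <= t <= b -> {for t, continuous f}) -> mu.-integrable `[a, b] (EFin \o f).
Proof.
move=> H; apply: continuous_compact_integrable; first exact: segment_compact.
exact: cont_within.
Qed.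

Lemma integrable_Re F a b : cont_on F a b ->
  mu.-integrable `[a, b] (EFin \o (fun x => complex.Re (F x))).
Proof. by move=> H; apply: integrable_cont => t /H/Re_continuous. Qed.

Lemma integrable_Im F a b : cont_on F a b ->
  mu.-integrable `[a, b] (EFin \o (fun x => complex.Im (F x))).
Proof. by move=> H; apply: integrable_cont => t /H/Im_continuous. Qed.

Lemma eq_cint F G a b : (forall t, a <= t <= b -> F t = G t) -> cint F a b = cint G a b.
Proof.
by move=> H; rewrite /cint; congr Complex; apply: eq_Rintegral => t;
  rewrite inE/= in_itv/= => /H ->.
Qed.

Lemma complex_eq (z w : C) : complex.Re z = complex.Re w -> complex.Im z = complex.Im w -> z = w.
Proof. by case: z w => [? ?] [? ?] /= -> ->. Qed.

Lemma cintD F G a b : cont_on F a b -> cont_on G a b ->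
  cint (fun t => F t + G t) a b = cint F a b + cint G a b.
Proof.
move=> cF cG; apply: complex_eq; rewrite ?cReD ?cImD /=.
  rewrite -RintegralD//; [|exact: integrable_Re|exact: integrable_Re].
  by apply: eq_Rintegral => t _; rewrite cReD.
rewrite -RintegralD//; [|exact: integrable_Im|exact: integrable_Im].
by apply: eq_Rintegral => t _; rewrite cImD.
Qed.

Lemma cintZ F (k : C) a b : cont_on F a b -> cint (fun t => k * F t) a b = k * cint F a b.
Proof.
move=> cF; apply: complex_eq; rewrite ?cReM ?cImM /=.
  rewrite -!RintegralZl//; [|exact: integrable_Im|exact: integrable_Re].
  rewrite -RintegralB//; last 2 first.
  - have := integrable_Re cF => /(integrableZl _ (complex.Re k)). exact.
  - have := integrable_Im cF => /(integrableZl _ (complex.Im k)). exact.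
  by apply: eq_Rintegral => t _; rewrite cReM.
rewrite -!RintegralZl//; [|exact: integrable_Re|exact: integrable_Im].
rewrite -RintegralD//; last 2 first.
- have := integrable_Im cF => /(integrableZl _ (complex.Re k)). exact.
- have := integrable_Re cF => /(integrableZl _ (complex.Im k)). exact.
by apply: eq_Rintegral => t _; rewrite cImM.
Qed.

Lemma cont_onD F G a b : cont_on F a b -> cont_on G a b -> cont_on (fun t => F t + G t) a b.
Proof. move=> cF cG t tab; apply: (@cvgD _ _ _ (nbhs t)); [exact: cF|exact: cG]. Qed.

Lemma cont_onM F G a b : cont_on F a b -> cont_on G a b -> cont_on (fun t => F t * G t) a b.
Proof. move=> cF cG t tab; apply: (@cvgM _ _ (nbhs t)); [exact: cF|exact: cG]. Qed.

Lemma cont_on_cst (k : C) a b : cont_on (fun=> k) a b.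
Proof. by move=> t _; exact: cvg_cst. Qed.

Lemma cont_onZ F (k : C) a b : cont_on F a b -> cont_on (fun t => k * F t) a b.
Proof. by move=> cF; exact: (@cont_onM (fun=> k) F a b (@cont_on_cst k a b) cF). Qed.

Lemma cont_onB F G a b : cont_on F a b -> cont_on G a b -> cont_on (fun t => F t - G t) a b.
Proof. move=> cF cG t tab; apply: (@cvgB _ _ _ (nbhs t)); [exact: cF|exact: cG]. Qed.

Lemma cintB F G a b : cont_on F a b -> cont_on G a b ->
  cint (fun t => F t - G t) a b = cint F a b - cint G a b.
Proof.
move=> cF cG; have cNG := @cont_onZ _ (-1) _ _ cG.
have <- : cint F a b + cint (fun t => -1 * G t) a b = cint F a b - cint G a b.
  by rewrite (@cintZ _ (-1) _ _ cG) mulN1r.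
rewrite -(cintD cF cNG).
by apply: eq_cint => t _; rewrite mulN1r.
Qed.

Lemma rint_norm (f : R -> R) a b M : a <= b ->
  (forall t, a <= t <= b -> {for t, continuous f}) ->
  (forall t, a <= t <= b -> `|f t| <= M) -> `|\int[mu]_(t in `[a, b]) f t| <= M * (b - a).
Proof.
move=> ab cf fM; apply: le_trans (le_normr_Rintegral _ _) _ => //.
  exact: integrable_cont.
apply: (@le_trans _ _ (\int[mu]_(t in `[a, b]) M)).
  apply: le_Rintegral => [||| t /=]; [exact: measurable_itv| | |by rewrite in_itv/= => /fM].
    by apply: integrable_cont => t /cf ft; apply: (@cvg_norm _ _ _ (nbhs t)); exact: ft.
  by apply: integrable_cont => t _; exact: cvg_cst.
rewrite Rintegral_cst//= lebesgue_measure_itv/= lte_fin.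
by have [_|ba]//= := ltP a b; rewrite (@le_anti _ _ a b) ?ab// subrr.
Qed.

(* The factor 2 comes from bounding real and imaginary parts separately. *)
Lemma cint_norm F a b M : a <= b -> cont_on F a b ->
  (forall t, a <= t <= b -> rnorm (F t) <= M) -> rnorm (cint F a b) <= 2 * M * (b - a).
Proof.
move=> ab cF FM; apply: le_trans (rnorm_le_ReIm _) _ => /=.
have h1 : `|\int[mu]_(t in `[a, b]) complex.Re (F t)| <= M * (b - a).
  apply: rint_norm => // t h; first exact/Re_continuous/cF.
  exact: le_trans (normRe_le _) (FM _ h).
have h2 : `|\int[mu]_(t in `[a, b]) complex.Im (F t)| <= M * (b - a).
  apply: rint_norm => // t h; first exact/Im_continuous/cF.
  exact: le_trans (normIm_le _) (FM _ h).
lra.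
Qed.

Lemma rint_FTC (f F : R -> R) a b : a < b ->
  (forall t, a <= t <= b -> {for t, continuous f}) ->
  (forall t, a <= t <= b -> is_derive t 1 F (f t)) ->
  \int[mu]_(t in `[a, b]) f t = F b - F a.
Proof.
move=> ab cf dF.
have cF t : a <= t <= b -> {for t, continuous F}.
  by move=> /dF [h _]; apply: differentiable_continuous; exact/derivable1_diffP.
rewrite /Rintegral (@continuous_FTC2 _ f F)//.
- exact: cont_within.
- split.
  + move=> t; rewrite in_itv/= => /andP[h1 h2]; by have [] := dF t _; rewrite ?(ltW h1) ?(ltW h2).
  + by apply: cvg_at_right_filter; apply: cF; rewrite lexx ltW.
  + by apply: cvg_at_left_filter; apply: cF; rewrite lexx ltW.
- move=> t; rewrite in_itv/= => /andP[h1 h2]; rewrite derive1E.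
  have tab : a <= t <= b by rewrite !ltW.
  by have [_ ->] := dF t tab.
Qed.

Lemma cint_FTC w W a b : a < b -> cont_on w a b ->
  (forall t, a <= t <= b -> is_rderiv W t (w t)) -> cint w a b = W b - W a.
Proof.
move=> ab cw dW; apply: complex_eq; rewrite ?(cReD, cReN, cImD, cImN) /=.
  apply: (@rint_FTC _ (fun t => complex.Re (W t))) => // t h; first exact/Re_continuous/cw.
  by have /is_rderivP[] := dW t h.
apply: (@rint_FTC _ (fun t => complex.Im (W t))) => // t h; first exact/Im_continuous/cw.
by have /is_rderivP[] := dW t h.
Qed.

Lemma rint_split (f : R -> R) a c b : a <= c <= b ->
  mu.-integrable `[a, b] (EFin \o f) ->
  \int[mu]_(t in `[a, b]) f t = \int[mu]_(t in `[a, c]) f t + \int[mu]_(t in `[c, b]) f t.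
Proof.
move=> /andP[ac cb] fi; apply/eqP; rewrite addrC -subr_eq; apply/eqP.
rewrite Rintegral_itvB// ?bnd_simp//.
rewrite Rintegral_itv_obnd_cbnd//; apply: integrableS fi => //.
by apply: subset_itvr; rewrite bnd_simp.
Qed.

Lemma cint_split F a c b : a <= c <= b -> cont_on F a b ->
  cint F a b = cint F a c + cint F c b.
Proof.
move=> acb cF; apply: complex_eq; rewrite ?cReD ?cImD/=; apply: rint_split => //.
  exact: integrable_Re.
exact: integrable_Im.
Qed.

Lemma cint_cst (k : C) a b : a < b -> cint (fun=> k) a b = rC (b - a) * k.
Proof.
move=> ab; rewrite (@cint_FTC _ (fun t => rC t * k))//; first by rewrite -mulrBl -rCB.
  by move=> t _; exact: cvg_cst.
move=> t _; have := is_rderivM (is_rderiv_rC t) (is_rderiv_cst k t).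
by rewrite mul1r mulr0 addr0.
Qed.

End ComplexIntegral.

(** * Goursat's theorem *)

Section Goursat.
Variable R : realType.
Local Notation C := (Cplx R).
Local Notation rC := (@real_to_Cplx R).

(** Remainders below are quadratic with a uniform constant, because such bounds, unlike a pointwise
    o(|k|), pass through integrals, sums and ultralimits. *)
Lemma is_cderiv_quad (f : C -> C) (z c : C) (M d : R) : 0 < d ->
  (forall k, rnorm k < d -> rnorm (f (z + k) - f z - k * c) <= M * rnorm k ^+ 2) ->
  is_cderiv f z c.
Proof.
move=> d0 H e e0.
have M0 : 0 < 1 + `|M| by rewrite ltr_pwDl.
exists (Num.min d (e / (1 + `|M|))); first by rewrite lt_min d0 divr_gt0.
move=> k; rewrite lt_min ltr_pdivlMr// => /andP[/H k1 k2]; apply: le_trans k1 _.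
rewrite expr2 mulrA ler_wpM2r ?rnorm_ge0//; apply: le_trans (ltW k2).
by rewrite mulrC ler_wpM2l ?rnorm_ge0// (le_trans (ler_norm M))// lerDr.
Qed.

Lemma rnorm_sum4_le (p q r s : C) (B : R) :
  rnorm p <= B -> rnorm q <= B -> rnorm r <= B -> rnorm s <= B ->
  rnorm (p + q - r - s) <= 4 * B.
Proof.
have := rnormB (p + q - r) s; have := rnormB (p + q) r; have := rnormD p q; lra.
Qed.

Lemma expr_half_lt (d : R) : 0 < d -> exists n : nat, (2^-1 : R) ^+ n < d.
Proof.
move=> d0; have : (2^-1 : R) ^+ n @[n --> \oo] --> 0.
  by apply: cvg_expr; rewrite ger0_norm ?invr_ge0// invf_lt1// ltr1n.
move=> /cvgrPdist_lt /(_ _ d0) [n _ /(_ n (leqnn n))] /=.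
by rewrite sub0r normrN ger0_norm ?exprn_ge0 ?invr_ge0// => h; exists n.
Qed.

(** Think of [mu x y h] as the boundary integral over the square with corner (x, y) and side h.
    Among the four quarters one always keeps at least m h^2, where m = |mu 0 0 1|; the nested
    squares shrink to a point, where the second hypothesis forces m <= e for every e. *)
Lemma square_bisection (mu : R -> R -> R -> C) :
  (forall x y h, 0 <= x -> 0 <= y -> 0 < h -> x + h <= 1 -> y + h <= 1 ->
     mu x y h = mu x y (h / 2) + mu (x + h / 2) y (h / 2)
              + (mu x (y + h / 2) (h / 2) + mu (x + h / 2) (y + h / 2) (h / 2))) ->
  (forall x0 y0 e, 0 <= x0 <= 1 -> 0 <= y0 <= 1 -> 0 < e -> exists2 d : R, 0 < d &
     forall x y h, 0 <= x -> 0 <= y -> 0 < h < d -> x + h <= 1 -> y + h <= 1 ->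
       x <= x0 <= x + h -> y <= y0 <= y + h -> rnorm (mu x y h) <= e * h ^+ 2) ->
  mu 0 0 1 = 0.
Proof.
move=> add small; apply/rnorm0_eq0/eqP; rewrite eq_le rnorm_ge0 andbT.
set m := rnorm (mu 0 0 1).
pose H n : R := 2^-1 ^+ n.
have H0 n : 0 < H n by rewrite exprn_gt0// invr_gt0.
have HS n : H n.+1 = H n / 2 by rewrite /H exprSr.
pose P n (p : R * R) := [/\ 0 <= p.1, 0 <= p.2, p.1 + H n <= 1, p.2 + H n <= 1 &
  m * H n ^+ 2 <= rnorm (mu p.1 p.2 (H n))].
pose Q n (p q : R * R) := [/\ P n.+1 q, p.1 <= q.1 <= p.1 + H n.+1 &
   p.2 <= q.2 <= p.2 + H n.+1].
have step n p : P n p -> exists q, Q n p q.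
  case: p => x y [/= x0 y0 xh yh mh].
  have hS := HS n; have h0 := H0 n.
  have := add x y (H n) x0 y0 h0 xh yh; rewrite -HS => E.
  have h4 : H n.+1 ^+ 2 = H n ^+ 2 / 4 by rewrite HS; field.
  have [h|n1] := leP (m * H n.+1 ^+ 2) (rnorm (mu x y (H n.+1))).
    by exists (x, y); split; rewrite /P/=; [split=> //|..]; clear -x0 y0 xh yh h0 hS; lra.
  have [h|n2] := leP (m * H n.+1 ^+ 2) (rnorm (mu (x + H n.+1) y (H n.+1))).
    by exists (x + H n.+1, y); split; rewrite /P/=; [split=> //|..]; clear -x0 y0 xh yh h0 hS; lra.
  have [h|n3] := leP (m * H n.+1 ^+ 2) (rnorm (mu x (y + H n.+1) (H n.+1))).
    by exists (x, y + H n.+1); split; rewrite /P/=; [split=> //|..]; clear -x0 y0 xh yh h0 hS; lra.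
  have [h|n4] := leP (m * H n.+1 ^+ 2) (rnorm (mu (x + H n.+1) (y + H n.+1) (H n.+1))).
    by exists (x + H n.+1, y + H n.+1); split; rewrite /P/=; [split=> //|..];
      clear -x0 y0 xh yh h0 hS; lra.
  exfalso; move: mh; rewrite E leNgt => /negP; apply.
  set a := mu _ _ _ in n1 *; set b := mu _ _ _ in n2 *.
  set c := mu _ _ _ in n3 *; set d := mu _ _ _ in n4 *.
  have := rnormD (a + b) (c + d); have := rnormD a b; have := rnormD c d.
  by move: n1 n2 n3 n4; rewrite h4; lra.
have /choice[F FP] : forall np : nat * (R * R), exists q, P np.1 np.2 -> Q np.1 np.2 q.
  move=> [n p] /=; have [/step[q ?]|] := pselect (P n p); first by exists q.
  by exists p.
pose u := fix u n := if n is n'.+1 then F (n', u n') else (0, 0).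
have uP n : P n (u n).
  elim: n => [|n IH]; last by have [] := FP (n, u n) IH.
  by rewrite /P/= /H expr0 expr1n mulr1; split; lra.
have uQ n : Q n (u n) (u n.+1) by apply: (FP (n, u n)); exact: uP.
(* Nested intervals: the supremum of the left ends lies in all of them. *)
have lim (c : nat -> R) : (forall n, c n <= c n.+1 <= c n + H n.+1) ->
    exists z, forall n, c n <= z <= c n + H n.
  move=> cP.
  have inc n k : c n <= c (n + k)%N <= c n + (H n - H (n + k)%N).
    elim: k => [|k IH]; first by rewrite addn0; lra.
    rewrite addnS; have := cP (n + k)%N; have := HS (n + k)%N; lra.
  have cc n k : c n <= c k + H k.
    have [/subnKC E|/ltnW/subnKC E] := leqP n k.
      have := inc n (k - n)%N; rewrite E; have := H0 k; lra.
    have := inc k (n - k)%N; rewrite E; have := H0 n; lra.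
  exists (sup (range c)) => n; apply/andP; split.
    by apply: ub_le_sup; [exists (c 0%N + H 0%N) => _ [k _ <-]|exists n].
  by apply: ge_sup; [exists (c 0%N); exists 0%N|move=> _ [k _ <-]].
have [x0 x0P] : exists z, forall n, (u n).1 <= z <= (u n).1 + H n.
  by apply: lim => n; have [] := uQ n.
have [y0 y0P] : exists z, forall n, (u n).2 <= z <= (u n).2 + H n.
  by apply: lim => n; have [] := uQ n.
apply/ler_addgt0Pl => e e0; rewrite addr0.
have x01 : 0 <= x0 <= 1 by have := x0P 0%N; rewrite /= /H expr0; lra.
have y01 : 0 <= y0 <= 1 by have := y0P 0%N; rewrite /= /H expr0; lra.
have [d d0 dP] := small x0 y0 e x01 y01 e0.
have [n nd] := expr_half_lt d0.
have [u1 u2 u3 u4 u5] := uP n.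
have /le_trans /(_ (dP _ _ _ u1 u2 _ u3 u4 (x0P n) (y0P n))) := u5.
by rewrite -/(H n) in nd *; rewrite H0 nd => /(_ isT); rewrite ler_pM2r// exprn_gt0.
Qed.

(** [P] is a primitive of the affine part f0 + c (w - z0), so the only part left to estimate is the
    remainder, of size [eta]. *)
Lemma curve_integral_affine (f : C -> C) (g g' : R -> C) (f0 c z0 : C) (a b L eta : R)
    (P : C -> C) : (forall w, P w = f0 * w + c / 2 * (w - z0) ^+ 2) -> a < b ->
  (forall t, a <= t <= b -> is_rderiv g t (g' t)) -> cont_on g' a b ->
  cont_on (f \o g) a b -> (forall t, a <= t <= b -> rnorm (g' t) <= L) ->
  (forall t, a <= t <= b -> rnorm (f (g t) - f0 - c * (g t - z0)) <= eta) ->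
  rnorm (cint (fun t => f (g t) * g' t) a b - (P (g b) - P (g a))) <= 2 * (eta * L) * (b - a).
Proof.
move=> PE ab gd cg' cf gL fe.
have dP w : is_cderiv P w (f0 + c * (w - z0)).
  apply: (is_cderiv_quad (M := rnorm (c / 2)) (d := 1)) => // k _; rewrite !PE.
  rewrite -rnormX -rnormM le_eqVlt; apply/orP; left; apply/eqP; congr rnorm.
  by field.
have cg : cont_on g a b by move=> t /gd; exact: is_rderiv_continuous.
have cg1 : cont_on (fun t => g t - z0) a b.
  exact: (@cont_onD _ g (fun=> - z0) a b cg (@cont_on_cst _ (- z0) a b)).
have cg2 : cont_on (fun t => c * (g t - z0)) a b.
  exact: (@cont_onZ _ (fun t => g t - z0) c a b cg1).
have cg3 : cont_on (fun t => f0 + c * (g t - z0)) a b.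
  exact: (@cont_onD _ (fun=> f0) (fun t => c * (g t - z0)) a b (@cont_on_cst _ f0 a b) cg2).
have cA : cont_on (fun t => (f0 + c * (g t - z0)) * g' t) a b.
  exact: (@cont_onM _ (fun t => f0 + c * (g t - z0)) g' a b cg3 cg').
have cB : cont_on (fun t => f (g t) * g' t) a b.
  exact: (@cont_onM _ (f \o g) g' a b cf cg').
have <- : cint (fun t => (f0 + c * (g t - z0)) * g' t) a b = P (g b) - P (g a).
  apply: (@cint_FTC _ _ (P \o g) a b ab cA) => t tab.
  exact: is_rderiv_comp (gd t tab) (dP (g t)).
rewrite -(cintB cB cA).
have cN : cont_on (fun t => -1 * ((f0 + c * (g t - z0)) * g' t)) a b by exact: cont_onZ cA.
apply: cint_norm; first exact: ltW.
  have := cont_onD cB cN; congr (cont_on _ a b); apply/funext => t; by rewrite mulN1r.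
move=> t tab; rewrite -mulrBl rnormM ler_pM ?rnorm_ge0//; last exact: gL.
by rewrite opprD addrA fe.
Qed.

(* Bisecting the parameter square, one only needs [f] to be differentiable along [G]: near a
   point the affine part of [f] has a primitive and contributes nothing to the boundary. *)
Lemma goursat_square (f : C -> C) (G G1 G2 : R -> R -> C) (L : R) :
  (forall x y, 0 <= x <= 1 -> 0 <= y <= 1 ->
    [/\ is_rderiv (G^~ y) x (G1 x y), is_rderiv (G x) y (G2 x y),
        {for x, continuous (G1^~ y)}, {for y, continuous (G2 x)} &
        (rnorm (G1 x y) <= L /\ rnorm (G2 x y) <= L) /\
        exists c, is_cderiv f (G x y) c]) ->
  (forall x y x' y', 0 <= x <= 1 -> 0 <= y <= 1 -> 0 <= x' <= 1 -> 0 <= y' <= 1 ->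
     rnorm (G x y - G x' y') <= L * (`|x - x'| + `|y - y'|)) ->
  cint (fun x => f (G x 0) * G1 x 0) 0 1 + cint (fun y => f (G 1 y) * G2 1 y) 0 1 =
  cint (fun x => f (G x 1) * G1 x 1) 0 1 + cint (fun y => f (G 0 y) * G2 0 y) 0 1.
Proof.
move=> HG Lip.
pose V y a b := cint (fun x => f (G x y) * G1 x y) a b.
pose H x a b := cint (fun y => f (G x y) * G2 x y) a b.
pose mu x y h := V y x (x + h) + H (x + h) y (y + h) - V (y + h) x (x + h) - H x y (y + h).
suff : mu 0 0 1 = 0.
  rewrite /mu !add0r => /eqP; rewrite -addrA -opprD subr_eq0 => /eqP; exact.
have cf x y : 0 <= x <= 1 -> 0 <= y <= 1 -> {for G x y, continuous f}.
  by move=> x01 y01; have [_ _ _ _ [_ [c /is_cderiv_continuous]]] := HG x y x01 y01.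
have cfG1 y a b : 0 <= y <= 1 -> 0 <= a -> b <= 1 -> cont_on (fun x => f (G x y)) a b.
  move=> y01 a0 b1 x xab; have x01 : 0 <= x <= 1 by lra.
  have [/is_rderiv_continuous Gc _ _ _ _] := HG x y x01 y01.
  exact: (@rcont_comp _ f (G^~ y) x Gc (cf x y x01 y01)).
have cfG2 x a b : 0 <= x <= 1 -> 0 <= a -> b <= 1 -> cont_on (fun y => f (G x y)) a b.
  move=> x01 a0 b1 y yab; have y01 : 0 <= y <= 1 by lra.
  have [_ /is_rderiv_continuous Gc _ _ _] := HG x y x01 y01.
  exact: (@rcont_comp _ f (G x) y Gc (cf x y x01 y01)).
have cG1 y a b : 0 <= y <= 1 -> 0 <= a -> b <= 1 -> cont_on (G1^~ y) a b.
  by move=> y01 a0 b1 x xab; have [|_ _ ? _ _] := HG x y _ y01; first lra.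
have cG2 x a b : 0 <= x <= 1 -> 0 <= a -> b <= 1 -> cont_on (G2 x) a b.
  by move=> x01 a0 b1 y yab; have [|_ _ _ ? _] := HG x y x01; first lra.
have Vadd y a h : 0 <= y <= 1 -> 0 <= a -> 0 < h -> a + h <= 1 ->
    V y a (a + h) = V y a (a + h / 2) + V y (a + h / 2) (a + h).
  move=> y01 a0 h0 ah; apply: cint_split; first lra.
  exact: (@cont_onM _ (fun x => f (G x y)) (G1^~ y) a (a + h)
    (cfG1 _ _ _ y01 a0 ah) (cG1 _ _ _ y01 a0 ah)).
have Hadd y a h : 0 <= y <= 1 -> 0 <= a -> 0 < h -> a + h <= 1 ->
    H y a (a + h) = H y a (a + h / 2) + H y (a + h / 2) (a + h).
  move=> y01 a0 h0 ah; apply: cint_split; first lra.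
  exact: (@cont_onM _ (fun x => f (G y x)) (G2 y) a (a + h)
    (cfG2 _ _ _ y01 a0 ah) (cG2 _ _ _ y01 a0 ah)).
apply: square_bisection => [x y h x0 y0 h0 xh yh|x0 y0 e x01 y01 e0].
  rewrite /mu; have E (a : R) : a + h / 2 + h / 2 = a + h by field.
  rewrite !E (Vadd y x)//; last lra.
  rewrite (Vadd (y + h) x)//; last lra.
  rewrite (Hadd x y)//; last lra.
  rewrite (Hadd (x + h) y)//; last lra.
  by ring.
have [_ _ _ _ [[L0 _] [c fd]]] := HG x0 y0 x01 y01.
set z0 := G x0 y0 in fd.
have {}L0 : 0 <= L by apply: le_trans L0; exact: rnorm_ge0.
have L1 : 0 < 1 + L by lra.
(* Each side contributes at most 2 eta L h with eta = 2 e' (1 + L) h, so four sides give 16 e' (1 +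
   L) L h^2 <= e h^2. *)
pose e' := e / (16 * (1 + L) ^+ 2).
have e'0 : 0 < e' by rewrite divr_gt0// mulr_gt0// exprn_gt0.
have [d d0 dP] := fd e' e'0.
exists (d / (2 * (1 + L))) => [|x y h xge0 yge0 /andP[h0 hd] xh yh xx0 yy0].
  by rewrite divr_gt0// mulr_gt0.
move: hd; rewrite ltr_pdivlMr ?mulr_gt0// mulrC => hd.
have near p q : x <= p <= x + h -> y <= q <= y + h ->
    rnorm (f (G p q) - f z0 - c * (G p q - z0)) <= e' * (2 * (1 + L) * h).
  move=> pP qP; have Gz : rnorm (G p q - z0) <= 2 * (1 + L) * h.
    have p01 : 0 <= p <= 1 by clear -pP xge0 xh; lra.
    have q01 : 0 <= q <= 1 by clear -qP yge0 yh; lra.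
    apply: le_trans (Lip p q x0 y0 p01 q01 x01 y01) _.
    have h1 : `|p - x0| <= h by clear -pP xx0; rewrite ler_norml; lra.
    have h2 : `|q - y0| <= h by clear -qP yy0; rewrite ler_norml; lra.
    apply: (@le_trans _ _ (L * (h + h))); last by clear -h0; nra.
    by rewrite ler_wpM2l// lerD.
  have E : z0 + (G p q - z0) = G p q by rewrite addrC subrK.
  have := dP (G p q - z0); rewrite E (mulrC _ c) => h1.
  apply: le_trans (h1 _) _; first exact: le_lt_trans Gz _.
  by rewrite ler_pM2l.
pose eta := e' * (2 * (1 + L) * h).
pose P w := f z0 * w + c / 2 * (w - z0) ^+ 2.
have VE q : y <= q <= y + h ->
    rnorm (V q x (x + h) - (P (G (x + h) q) - P (G x q))) <= 2 * (eta * L) * h.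
  move=> qP; have q01 : 0 <= q <= 1 by clear -qP yge0 yh; lra.
  have t01 t : x <= t <= x + h -> 0 <= t <= 1 by clear -xge0 xh; lra.
  have -> : 2 * (eta * L) * h = 2 * (eta * L) * (x + h - x) by rewrite (addrC x) addrK.
  apply: (@curve_integral_affine f (G^~ q) (G1^~ q) (f z0) c z0).
  - by [].
  - by rewrite ltrDl.
  - by move=> t tP; have [] := HG t q (t01 t tP) q01.
  - exact: cG1.
  - exact: cfG1.
  - by move=> t tP; have [_ _ _ _ [[]]] := HG t q (t01 t tP) q01.
  - by move=> t tP; exact: near.
have HE p : x <= p <= x + h ->
    rnorm (H p y (y + h) - (P (G p (y + h)) - P (G p y))) <= 2 * (eta * L) * h.
  move=> pP; have p01 : 0 <= p <= 1 by clear -pP xge0 xh; lra.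
  have t01 t : y <= t <= y + h -> 0 <= t <= 1 by clear -yge0 yh; lra.
  have -> : 2 * (eta * L) * h = 2 * (eta * L) * (y + h - y) by rewrite (addrC y) addrK.
  apply: (@curve_integral_affine f (G p) (G2 p) (f z0) c z0).
  - by [].
  - by rewrite ltrDl.
  - by move=> t tP; have [] := HG p t p01 (t01 t tP).
  - exact: cG2.
  - exact: cfG2.
  - by move=> t tP; have [_ _ _ _ [[]]] := HG p t p01 (t01 t tP).
  - by move=> t tP; exact: near.
(* The values of [P] at the four corners cancel around the square. *)
have -> : mu x y h =
    (V y x (x + h) - (P (G (x + h) y) - P (G x y)))
  + (H (x + h) y (y + h) - (P (G (x + h) (y + h)) - P (G (x + h) y)))
  - (V (y + h) x (x + h) - (P (G (x + h) (y + h)) - P (G x (y + h))))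
  - (H x y (y + h) - (P (G x (y + h)) - P (G x y))) by rewrite /mu; ring.
have xl : x <= x <= x + h by rewrite lexx lerDl ltW.
have xr : x <= x + h <= x + h by rewrite lexx lerDl ltW.
have yl : y <= y <= y + h by rewrite lexx lerDl ltW.
have yr : y <= y + h <= y + h by rewrite lexx lerDl ltW.
apply: (@le_trans _ _ (4 * (2 * (eta * L) * h))).
  exact: rnorm_sum4_le (VE _ yl) (HE _ xr) (VE _ yr) (HE _ xl).
have -> : 4 * (2 * (eta * L) * h) = (16 * e' * ((1 + L) * L)) * h ^+ 2.
  by rewrite /eta; ring.
rewrite ler_wpM2r ?sqr_ge0//.
have -> : e = 16 * e' * (1 + L) ^+ 2.
  by rewrite /e'; field; rewrite ?gt_eqF//.
by apply: ler_wpM2l; [rewrite mulr_ge0// ltW|rewrite expr2 ler_wpM2l ?lerDr// ltW].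
Qed.
End Goursat.

(** * Cauchy's formula *)

Section Cauchy.
Variable R : realType.
Local Notation C := (Cplx R).
Local Notation rC := (@real_to_Cplx R).

Lemma rderiv_bound (W w : R -> C) (a b M : R) : a <= b ->
  (forall t, a <= t <= b -> is_rderiv W t (w t)) -> cont_on w a b ->
  (forall t, a <= t <= b -> rnorm (w t) <= M) -> rnorm (W b - W a) <= 2 * M * (b - a).
Proof.
rewrite le_eqVlt => /predU1P[->|ab] dW cw wM; first by rewrite !subrr rnorm0 mulr0.
rewrite -(cint_FTC ab cw dW); exact: cint_norm (ltW ab) cw wM.
Qed.

Lemma rnorm_continuous (F : R -> C) t : {for t, continuous F} ->
  {for t, continuous (fun x => rnorm (F x))}.
Proof.
move=> /rcontP H; apply/cvgrPdist_le => e e0; have [d d0 dP] := H e e0.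
exists d => //= w /= wd; rewrite distrC in wd; have := dP w wd.
have := rnorm_le_sub (F t) (F w); have := rnorm_le_sub (F w) (F t).
by rewrite (rnormBC (F t) (F w)) ler_norml; lra.
Qed.

Lemma cont_on_bounded (F : R -> C) : cont_on F 0 1 ->
  exists2 M : R, 0 <= M & forall t, 0 <= t <= 1 -> rnorm (F t) <= M.
Proof.
move=> cF; have := @EVT_max R (fun t => rnorm (F t)) 0 1 ler01.
case=> [|c c01 cP].
  by apply: cont_within => t t01; exact/rnorm_continuous/cF.
exists (rnorm (F c)); first exact: rnorm_ge0.
by move=> t t01; apply: cP; rewrite in_itv.
Qed.

Definition unit_circle (t : R) : C := (cos (2 * pi * t) +i* sin (2 * pi * t))%C.
Local Notation E := unit_circle.

Lemma unit_circle_norm t : rnorm (E t) = 1.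
Proof. by rewrite rnormC_sqrt /= cos2Dsin2 sqrtr1. Qed.

Lemma unit_circle_0 : E 0 = 1.
Proof. by rewrite /E mulr0 cos0 sin0. Qed.

Lemma unit_circle_1 : E 1 = 1.
Proof. by rewrite /E mulr1 mulrC mulr_natr cos2pi sin2pi. Qed.

Lemma unit_circle_deriv t : is_rderiv E t (rC (2 * pi) * 'i%C * E t).
Proof.
have L : is_derive t (1:R) (fun x : R => 2 * pi * x) (2 * pi).
  by apply: is_derive_eq; rewrite /GRing.scale/= mulr1.
apply/is_rderivP; rewrite -mulrA cRe_rCM cIm_rCM /= !mul0r !mul1r sub0r add0r; split.
- have := @is_derive1_comp R cos (fun x => 2 * pi * x) t _ _ (is_derive_cos _) L.
  by move=> H; apply: (is_derive_eq H); rewrite mulrC.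
- have := @is_derive1_comp R sin (fun x => 2 * pi * x) t _ _ (is_derive_sin _) L.
  by move=> H; apply: (is_derive_eq H); rewrite mulrC.
Qed.

Lemma unit_circle_continuous t : {for t, continuous E}.
Proof. exact: is_rderiv_continuous (unit_circle_deriv t). Qed.

Lemma cont_on_E (k : C) a b : cont_on (fun t => k * E t) a b.
Proof.
by apply: (@cont_onZ _ E k a b) => t _; exact: unit_circle_continuous.
Qed.

Lemma unit_circle_lip t t' : rnorm (E t - E t') <= 4 * pi * `|t - t'|.
Proof.
have pi0 : 0 <= pi :> R by exact: pi_ge0.
wlog tt : t t' / t' <= t => [H|].
  by have [/H//|/ltW/H] := leP t' t; rewrite rnormBC distrC.
have -> : 4 * pi * `|t - t'| = 2 * (2 * pi) * (t - t').
  by rewrite ger0_norm ?subr_ge0//; ring.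
apply: (rderiv_bound tt (fun t _ => unit_circle_deriv t)); first exact: cont_on_E.
move=> x _; rewrite !rnormM rnorm_real rnormi unit_circle_norm !mulr1 ger0_norm//.
by rewrite mulr_ge0.
Qed.

Lemma cderiv_div (f : C -> C) (z w : C) : w != z -> (exists c, is_cderiv f w c) ->
  exists c, is_cderiv (fun x => f x * (x - z)^-1) w c.
Proof.
move=> wz [c fc]; exists (derive1 (fun x : C => f x * (x - z)^-1) w).
apply/derivable_is_cderiv.
apply: derivableM; first exact: is_cderiv_derivable fc.
apply: derivableV; first by rewrite subr_eq0.
by apply: derivableB; [exact: derivable_id|exact: derivable_cst].
Qed.

Lemma HD_cont_circle (f : C -> C) (w : C) (s : R) : HD f -> 0 <= s -> rnorm w + s < 1 ->
  cont_on (fun t => f (w + rC s * E t)) 0 1.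
Proof.
move=> fD s0 ws t _; apply: (@rcont_comp _ f (fun t => w + rC s * E t)).
  apply: (@cont_onD _ (fun=> w) _ t t (@cont_on_cst _ w t t) (@cont_on_E (rC s) t t)).
  by rewrite lexx.
apply: (is_cderiv_continuous (c := derive1 f (w + rC s * E t))).
apply: HD_is_cderiv => //; rewrite disc_rnorm; apply: le_lt_trans ws.
by apply: le_trans (rnormD _ _) _; rewrite rnormM unit_circle_norm rnorm_real ger0_norm// mulr1.
Qed.

Lemma HD_cont_circle0 (f : C -> C) (r : R) : HD f -> 0 <= r < 1 ->
  cont_on (fun t => f (rC r * E t)) 0 1.
Proof.
move=> fD /andP[r0 r1]; have := @HD_cont_circle f 0 r fD r0.
rewrite rnorm0 add0r => /(_ r1); congr (cont_on _ 0 1).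
by apply/funext => t; rewrite add0r.
Qed.

Lemma cont_circle_inv (z : C) (r : R) : rnorm z < r ->
  cont_on (fun t => (rC r * E t - z)^-1) 0 1.
Proof.
move=> zr t t01; apply: (@rcont_comp _ (fun w => w^-1) (fun t => rC r * E t - z)).
  apply: (@cont_onB _ _ (fun=> z) t t (@cont_on_E (rC r) t t) (@cont_on_cst _ z t t)).
  by rewrite lexx.
apply: (is_cderiv_continuous (c := derive1 (fun w : C => w^-1) (rC r * E t - z))).
apply/derivable_is_cderiv; apply: derivableV; last exact: derivable_id.
rewrite -rnorm_gt0; have := rnorm_le_sub (rC r * E t) z.
rewrite rnormM unit_circle_norm rnorm_real mulr1; have := ler_norm r; lra.
Qed.

(** [goursat_square] for f(w) / (w - z) along circles of centre (1 - s) z and radius [rho s], from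
    the small circle about [z] at s = 0 to the circle of radius [r] about 0 at s = 1. All of them
    stay in the disc and avoid [z]; the sides t = 0 and t = 1 coincide and cancel. *)
Lemma circle_homotopy (f : C -> C) (z : C) (r eps : R) : HD f -> 0 < eps ->
  rnorm z + eps < r -> r < 1 ->
  cint (fun t => f (rC r * E t) * (rC r * E t) * (rC r * E t - z)^-1) 0 1 =
  cint (fun t => f (z + rC eps * E t)) 0 1.
Proof.
move=> fD e0 zr r1.
have z0 := rnorm_ge0 z; have pi0 : 0 < pi :> R by exact: pi_gt0.
pose rho (s : R) := (1 - s) * eps + s * r.
pose G (s t : R) : C := rC (1 - s) * z + rC (rho s) * E t.
pose G1 (s t : R) : C := - z + rC (r - eps) * E t.
pose G2 (s t : R) : C := rC (rho s) * (rC (2 * pi) * 'i%C * E t).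
pose phi (w : C) := f w * (w - z)^-1.
have rho_ge s : 0 <= s <= 1 -> 0 <= rho s <= 1 by rewrite /rho; nra.
have GD s t : 0 <= s <= 1 -> rnorm (G s t) < 1.
  move=> s01; apply: le_lt_trans (rnormD _ _) _.
  rewrite !rnormM unit_circle_norm !rnorm_real mulr1 !ger0_norm; last 2 first.
  - by have := rho_ge s s01; lra.
  - by lra.
  by rewrite /rho; nra.
have Gz s t : 0 <= s <= 1 -> G s t != z.
  move=> s01; rewrite -subr_eq0 -rnorm_gt0.
  have -> : G s t - z = rC (rho s) * E t - rC s * z.
    by rewrite /G rCB rC1; ring.
  have := rnorm_le_sub (rC (rho s) * E t) (rC s * z).
  rewrite !rnormM unit_circle_norm !rnorm_real mulr1 !ger0_norm; last 2 first.
  - by lra.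
  - by have := rho_ge s s01; lra.
  rewrite /rho; nra.
have : cint (fun x => phi (G x 0) * G1 x 0) 0 1 + cint (fun y => phi (G 1 y) * G2 1 y) 0 1 =
    cint (fun x => phi (G x 1) * G1 x 1) 0 1 + cint (fun y => phi (G 0 y) * G2 0 y) 0 1.
  (* |G1| <= 2 and |G2| <= 2 pi, while the Lipschitz estimate in t costs 4 pi by
     [unit_circle_lip]. *)
  apply: (@goursat_square R phi G G1 G2 (2 + 4 * pi)).
- move=> s t s01 t01; split.
  + rewrite /G /G1.
    have d1 : is_rderiv (fun x : R => rC (1 - x)) s (-1).
      move=> e ege0; exists 1 => // k _.
      have -> : rC (1 - (s + k)) - rC (1 - s) - rC k * -1 = 0 by rewrite !rCB !rCD; ring.
      by rewrite rnorm0 mulr_ge0// ltW.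
    have d2 : is_rderiv (fun x : R => rC (rho x)) s (rC (r - eps)).
      move=> e ege0; exists 1 => // k _.
      have -> : rC (rho (s + k)) - rC (rho s) - rC k * rC (r - eps) = 0.
        by rewrite /rho !(rCD, rCB, rCM); ring.
      by rewrite rnorm0 mulr_ge0// ltW.
    have := is_rderivD (is_rderivM d1 (is_rderiv_cst z s)) (is_rderivM d2 (is_rderiv_cst (E t) s)).
    by rewrite !mulr0 !addr0 mulN1r.
  + have := is_rderivD (is_rderiv_cst (rC (1 - s) * z) t)
      (is_rderivM (is_rderiv_cst (rC (rho s)) t) (unit_circle_deriv t)).
    by rewrite mul0r !add0r.
  + exact: cvg_cst.
  + by have := @cont_on_E (rC (rho s) * (rC (2 * pi) * 'i%C)) t t t; rewrite lexx => /(_ isT);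
      rewrite /G2; under [X in _ -> {for _, continuous X}]eq_fun do rewrite mulrA.
  + split; last by apply: cderiv_div; [exact: Gz|exists (derive1 f (G s t));
      apply: HD_is_cderiv => //; rewrite disc_rnorm; exact: GD].
    split.
      apply: le_trans (rnormD _ _) _.
      by rewrite rnormN rnormM unit_circle_norm rnorm_real ger0_norm; lra.
    rewrite /G2 !rnormM rnormi unit_circle_norm !rnorm_real !ger0_norm.
    * by have := rho_ge s s01; nra.
    * by rewrite mulr_ge0// ltW.
    * by have := rho_ge s s01; lra.
- move=> s t s' t' s01 t01 s01' t01'.
  have -> : G s t - G s' t' = rC (s' - s) * z + rC (rho s - rho s') * E t
      + rC (rho s') * (E t - E t') by rewrite /G !rCB !rC1; ring.
  have h1 := rnormD (rC (s' - s) * z + rC (rho s - rho s') * E t) (rC (rho s') * (E t - E t')).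
  have h2 := rnormD (rC (s' - s) * z) (rC (rho s - rho s') * E t).
  move: h1 h2; rewrite !rnormM unit_circle_norm !rnorm_real mulr1.
  have -> : rho s - rho s' = (s - s') * (r - eps) by rewrite /rho; ring.
  rewrite normrM (distrC s' s) [`|r - eps|]ger0_norm; last lra.
  rewrite [`|rho s'|]ger0_norm; last by have := rho_ge s' s01'; lra.
  have := unit_circle_lip t t'; have := rho_ge s' s01'.
  have := normr_ge0 (s - s'); have := normr_ge0 (t - t'); have := rnorm_ge0 (E t - E t').
  set a := `|s - s'|; set b := `|t - t'|; set c := rnorm (E t - E t').
  move=> c0 b0 a0 rh cb h1 h2.
  have : a * rnorm z <= a by nra.
  have : a * (r - eps) <= a by nra.
  have : rho s' * c <= c by nra.
  have : 0 <= pi * a by rewrite mulr_ge0// ltW.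
  by lra.
have -> : (fun x => phi (G x 1) * G1 x 1) = (fun x => phi (G x 0) * G1 x 0).
  by apply/funext => x; rewrite /G /G1 unit_circle_0 unit_circle_1.
move=> /addrI.
pose k := rC (2 * pi) * 'i%C.
have k0 : k != 0.
  by rewrite -rnorm_gt0 rnormM rnormi mulr1 rnorm_real normr_gt0 mulf_neq0// gt_eqF.
have crE : cont_on (fun t => f (rC r * E t)) 0 1 by apply: HD_cont_circle0 => //; lra.
have crz : cont_on (fun t => (rC r * E t - z)^-1) 0 1 by apply: cont_circle_inv; lra.
have -> : cint (fun y => phi (G 1 y) * G2 1 y) 0 1 =
    k * cint (fun t => f (rC r * E t) * (rC r * E t) * (rC r * E t - z)^-1) 0 1.
  rewrite -cintZ; last first.
    apply: (@cont_onM _ (fun t => f (rC r * E t) * (rC r * E t)) _ _ _ _ crz).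
    exact: (@cont_onM _ (fun t => f (rC r * E t)) _ _ _ crE (@cont_on_E (rC r) 0 1)).
  apply: eq_cint => t _; rewrite /phi /G /G2 /rho /k subrr rC0 !mul0r !add0r !mul1r; ring.
have -> : cint (fun y => phi (G 0 y) * G2 0 y) 0 1 =
    k * cint (fun t => f (z + rC eps * E t)) 0 1.
  rewrite -cintZ; last by apply: HD_cont_circle => //; [exact: ltW|lra].
  apply: eq_cint => t _; rewrite /phi /G /G2 /rho /k subr0 rC1 !mul0r !addr0 !mul1r.
  have : rC eps * E t != 0.
    by rewrite -rnorm_gt0 rnormM unit_circle_norm mulr1 rnorm_real normr_gt0 gt_eqF.
  have -> : rC eps * (rC (2 * pi) * 'i%C * E t) = rC (2 * pi) * 'i%C * (rC eps * E t) by ring.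
  set a := rC eps * E t => a0.
  have -> : z + a - z = a by rewrite addrAC subrr add0r.
  by rewrite mulrCA mulfVK.
by move=> /(mulfI k0).
Qed.

(** The mean of [f] over the small circle tends to f z by continuity. Since the circle is
    parametrized by [0, 1], the factor 2 pi i of dw cancels that of Cauchy's formula and leaves the
    extra factor r E t. *)
Lemma cauchy_formula (f : C -> C) (z : C) (r : R) : HD f -> rnorm z < r -> r < 1 ->
  f z = cint (fun t => f (rC r * E t) * (rC r * E t) * (rC r * E t - z)^-1) 0 1.
Proof.
move=> fD zr r1; have z0 := rnorm_ge0 z.
apply/esym/eqP; rewrite -subr_eq0; apply/eqP/rnorm0_eq0/eqP; rewrite eq_le rnorm_ge0 andbT.
set I := cint _ _ _; apply/ler_addgt0Pl => e e0; rewrite addr0.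
have fz : {for z, continuous f}.
  apply: (is_cderiv_continuous (c := derive1 f z)).
  by apply: HD_is_cderiv => //; rewrite disc_rnorm; lra.
have [d d0 dP] := (ccontP f z).1 fz (e / 2) (divr_gt0 e0 (ltr0Sn _ 1)).
pose eps := Num.min (d / 2) ((r - rnorm z) / 2).
have eps0 : 0 < eps by rewrite lt_min; lra.
have [ed er] : eps < d /\ rnorm z + eps < r.
  have : eps <= d / 2 by rewrite ge_min lexx.
  have : eps <= (r - rnorm z) / 2 by rewrite ge_min lexx orbT.
  by lra.
rewrite /I (@circle_homotopy f z r eps)//.
have cf : cont_on (fun t => f (z + rC eps * E t)) 0 1.
  by apply: HD_cont_circle => //; [exact: ltW|lra].
have -> : cint (fun t => f (z + rC eps * E t)) 0 1 - f z =
    cint (fun t => f (z + rC eps * E t)) 0 1 - cint (fun=> f z) 0 1.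
  by rewrite cint_cst ?ltr01// subr0 rC1 mul1r.
rewrite -(cintB cf (@cont_on_cst _ (f z) 0 1)).
have -> : e = 2 * (e / 2) * (1 - 0) by field.
apply: cint_norm; [exact: ler01|exact: (cont_onB cf (@cont_on_cst _ (f z) 0 1))|].
move=> t t01; apply: dP; rewrite addrAC subrr add0r rnormM unit_circle_norm rnorm_real.
by rewrite ger0_norm ?(ltW eps0)// mulr1.
Qed.

End Cauchy.

(** * Differentiation under Cauchy's integral and uniform Taylor bounds *)

Section Taylor.
Variable R : realType.
Local Notation C := (Cplx R).
Local Notation rC := (@real_to_Cplx R).
Local Notation E := (@unit_circle R).

Lemma cint_diff (Psi Psi' : R -> C -> C) (z w : C) (M : R) :
  cont_on (Psi^~ z) 0 1 -> cont_on (Psi^~ w) 0 1 -> cont_on (Psi'^~ z) 0 1 ->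
  (forall t, 0 <= t <= 1 ->
     rnorm (Psi t w - Psi t z - (w - z) * Psi' t z) <= M * rnorm (w - z) ^+ 2) ->
  rnorm (cint (Psi^~ w) 0 1 - cint (Psi^~ z) 0 1 - (w - z) * cint (Psi'^~ z) 0 1)
    <= 2 * M * rnorm (w - z) ^+ 2.
Proof.
move=> cz cw cz' H.
have cZ := @cont_onZ _ _ (w - z) _ _ cz'.
rewrite -(cintB cw cz) -(cintZ (w - z) cz') -(cintB (cont_onB cw cz) cZ).
have -> : 2 * M * rnorm (w - z) ^+ 2 = 2 * (M * rnorm (w - z) ^+ 2) * (1 - 0) by ring.
apply: cint_norm; [exact: ler01|exact: (cont_onB (cont_onB cw cz) cZ)|exact: H].
Qed.

Lemma inv_taylor1 (a k : C) : a != 0 -> a - k != 0 ->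
  (a - k)^-1 - a^-1 - k * a^-1 ^+ 2 = k ^+ 2 * ((a - k)^-1 * a^-1 ^+ 2).
Proof. by move=> a0 ak; field; rewrite a0 ak. Qed.

Lemma inv_taylor2 (a k : C) : a != 0 -> a - k != 0 ->
  (a - k)^-1 ^+ 2 - a^-1 ^+ 2 - k * (2 * a^-1 ^+ 3) =
  k ^+ 2 * ((a - k)^-1 * a^-1 ^+ 3 * (2 + a * (a - k)^-1)).
Proof. by move=> a0 ak; field; rewrite a0 ak. Qed.

Lemma rnorm_mul3_le (a b c : C) (A D : R) : rnorm a <= A -> rnorm c <= D ->
  rnorm (a * (b ^+ 2 * c)) <= A * D * rnorm b ^+ 2.
Proof.
move=> aA cD; rewrite rnormM (rnormM (b ^+ 2)) rnormX mulrCA mulrC.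
by rewrite ler_wpM2r ?sqr_ge0// ler_pM ?rnorm_ge0.
Qed.

Section CauchyKernels.
Variables (f : C -> C) (r : R).
Hypotheses (fD : HD f) (r01 : 0 < r < 1).

Let k (t : R) : C := f (rC r * E t) * (rC r * E t).
(** For n = 1, 2, 3 the integrals over t are f, f' and f''/2. *)
Definition cauchy_kernel (t : R) (n : nat) (w : C) : C := k t * (rC r * E t - w)^-1 ^+ n.

Lemma cauchy_density_cont : cont_on k 0 1.
Proof.
have cf : cont_on (fun t => f (rC r * E t)) 0 1.
  by apply: HD_cont_circle0 => //; case/andP: r01 => /ltW -> ->.
exact: (cont_onM cf (@cont_on_E _ (rC r) 0 1)).
Qed.

Lemma cauchy_kernel_cont n w : rnorm w < r -> cont_on ((cauchy_kernel^~ n)^~ w) 0 1.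
Proof.
move=> wr; apply: (cont_onM cauchy_density_cont).
elim: n => [|n IH].
  have -> : (fun t : R => (rC r * E t - w)^-1 ^+ 0) = (fun=> 1).
    by apply/funext => t; rewrite expr0.
  exact: cont_on_cst.
have -> : (fun t : R => (rC r * E t - w)^-1 ^+ n.+1) =
    (fun t => (rC r * E t - w)^-1 * (rC r * E t - w)^-1 ^+ n).
  by apply/funext => t; rewrite exprS.
exact: (cont_onM (cont_circle_inv wr) IH).
Qed.

Lemma circle_dist (rho : R) (w : C) t : rnorm w <= rho -> r - rho <= rnorm (rC r * E t - w).
Proof.
case/andP: r01 => r0 r1 wr; have := rnorm_le_sub (rC r * E t) w.
rewrite rnormM unit_circle_norm rnorm_real mulr1 ger0_norm; lra.
Qed.

Lemma cauchy_kernel_taylor (rho : R) : 0 <= rho < r -> exists2 M : R, 0 <= M &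
  forall w w', rnorm w <= rho -> rnorm w' <= rho ->
    rnorm (cint ((cauchy_kernel^~ 1%N)^~ w') 0 1 - cint ((cauchy_kernel^~ 1%N)^~ w) 0 1
      - (w' - w) * cint ((cauchy_kernel^~ 2%N)^~ w) 0 1) <= M * rnorm (w' - w) ^+ 2 /\
    rnorm (cint ((cauchy_kernel^~ 2%N)^~ w') 0 1 - cint ((cauchy_kernel^~ 2%N)^~ w) 0 1
      - (w' - w) * cint (fun t => 2 * cauchy_kernel t 3 w) 0 1) <= M * rnorm (w' - w) ^+ 2.
Proof.
move=> /andP[rho0 rhor]; case/andP: r01 => r0 r1.
have [B B0 BP] := cont_on_bounded cauchy_density_cont.
set s := (r - rho)^-1.
have s0 : 0 < s by rewrite invr_gt0 subr_gt0.
have sP w t : rnorm w <= rho -> rnorm (rC r * E t - w)^-1 <= s.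
  move=> wr; have := circle_dist t wr; rewrite rnormV => h.
  by rewrite lef_pV2 ?posrE//; lra.
have aP w t : rnorm w <= rho -> rnorm (rC r * E t - w) <= 2.
  move=> wr; apply: le_trans (rnormB _ _) _.
  by rewrite rnormM unit_circle_norm rnorm_real mulr1 ger0_norm; lra.
have nz w t : rnorm w <= rho -> rC r * E t - w != 0.
  by move=> wr; rewrite -rnorm_gt0; have := circle_dist t wr; lra.
(* Bounds for the exact remainders of [inv_taylor1] and [inv_taylor2], with density at most [B],
   inverses at most [s] and |r E t - w| <= 2. The factor 2 of the witness comes from [cint_diff]. *)
pose M1 := B * s ^+ 3; pose M2 := B * (s ^+ 4 * (2 + 2 * s)).
have M10 : 0 <= M1 by rewrite mulr_ge0// exprn_ge0// ltW.
have M20 : 0 <= M2 by rewrite !mulr_ge0// ?exprn_ge0 ?ltW//; lra.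
exists (2 * (M1 + M2)) => [|w w' wr wr']; first lra.
have sq0 := sqr_ge0 (rnorm (w' - w)).
have wrr : rnorm w < r by lra.
have wrr' : rnorm w' < r by lra.
have E2 t : rC r * E t - w' = (rC r * E t - w) - (w' - w) by ring.
split.
- apply: le_trans (@cint_diff (fun t x => cauchy_kernel t 1 x) (fun t x => cauchy_kernel t 2 x)
    w w' M1 (cauchy_kernel_cont wrr) (cauchy_kernel_cont wrr') (cauchy_kernel_cont wrr) _) _.
    move=> t t01; rewrite /cauchy_kernel.
    have -> : k t * (rC r * E t - w')^-1 ^+ 1 - k t * (rC r * E t - w)^-1 ^+ 1
       - (w' - w) * (k t * (rC r * E t - w)^-1 ^+ 2) =
       k t * ((w' - w) ^+ 2 * ((rC r * E t - w')^-1 * (rC r * E t - w)^-1 ^+ 2)).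
      rewrite !E2 -inv_taylor1; [ring|exact: nz|by rewrite -E2; exact: nz].
    apply: rnorm_mul3_le; first exact: BP.
    rewrite rnormM rnormX (exprS s) ler_pM ?rnorm_ge0 ?exprn_ge0 ?rnorm_ge0//; first exact: sP.
    by rewrite lerXn2r ?nnegrE ?rnorm_ge0 ?(ltW s0)//; exact: sP.
  by rewrite ler_wpM2r//; lra.
- apply: le_trans (@cint_diff (fun t x => cauchy_kernel t 2 x) (fun t x => 2 * cauchy_kernel t 3 x)
    w w' M2 (cauchy_kernel_cont wrr) (cauchy_kernel_cont wrr')
    (cont_onZ (cauchy_kernel_cont wrr)) _) _.
    move=> t t01; rewrite /cauchy_kernel.
    have -> : k t * (rC r * E t - w')^-1 ^+ 2 - k t * (rC r * E t - w)^-1 ^+ 2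
       - (w' - w) * (2 * (k t * (rC r * E t - w)^-1 ^+ 3)) =
       k t * ((w' - w) ^+ 2 * ((rC r * E t - w')^-1 * (rC r * E t - w)^-1 ^+ 3 *
         (2 + (rC r * E t - w) * (rC r * E t - w')^-1))).
      rewrite !E2 -inv_taylor2; [ring|exact: nz|by rewrite -E2; exact: nz].
    apply: rnorm_mul3_le; first exact: BP.
    rewrite rnormM ler_pM ?rnorm_ge0//.
      rewrite rnormM rnormX (exprS s) ler_pM ?rnorm_ge0 ?exprn_ge0 ?rnorm_ge0//; first exact: sP.
      by rewrite lerXn2r ?nnegrE ?rnorm_ge0 ?(ltW s0)//; exact: sP.
    apply: le_trans (rnormD _ _) _.
    have -> : rnorm (2 : C) = 2 by rewrite -[2]/(rC 1 + rC 1) -rCD rnorm_real ger0_norm.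
    by rewrite lerD2l rnormM ler_pM ?rnorm_ge0//; [exact: aP|exact: sP].
  by rewrite ler_wpM2r//; lra.
Qed.

End CauchyKernels.

Lemma HD_repr (f : C -> C) (rho : R) : HD f -> 0 <= rho < 1 -> exists (M : R) (f2 : C -> C),
  0 <= M /\ forall w w', rnorm w <= rho -> rnorm w' <= rho ->
    rnorm (f w' - f w - (w' - w) * derive1 f w) <= M * rnorm (w' - w) ^+ 2 /\
    rnorm (derive1 f w' - derive1 f w - (w' - w) * f2 w) <= M * rnorm (w' - w) ^+ 2.
Proof.
move=> fD /andP[rho0 rho1].
(* Cauchy's formula is used on the circle of radius [r]; the intermediate [rho'] leaves room for
   increments when the derivative is identified at points of norm at most [rho]. *)
pose r := (1 + rho) / 2; pose rho' := (r + rho) / 2.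
have r01 : 0 < r < 1 by rewrite /r; lra.
have rho'P : 0 <= rho' < r by rewrite /rho' /r; lra.
have [M M0 MP] := cauchy_kernel_taylor fD r01 rho'P.
have fE w : rnorm w < r -> f w = cint (fun t => cauchy_kernel f r t 1 w) 0 1.
  by move=> wr; apply: cauchy_formula => //; lra.
have dE w : rnorm w < rho' -> derive1 f w = cint (fun t => cauchy_kernel f r t 2 w) 0 1.
  move=> wr; apply: is_cderiv_derive1.
  apply: (is_cderiv_quad (M := M) (d := rho' - rnorm w)); first lra.
  move=> h hr; have wh : rnorm (w + h) <= rho' by have := rnormD w h; lra.
  have [H _] := MP w (w + h) (ltW wr) wh.
  have -> : h * cint (fun t => cauchy_kernel f r t 2 w) 0 1 =
    ((w + h) - w) * cint (fun t => cauchy_kernel f r t 2 w) 0 1 by ring.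
  have -> : rnorm h = rnorm (w + h - w) by congr rnorm; ring.
  rewrite !fE//; lra.
exists M, (fun w => cint (fun t => 2 * cauchy_kernel f r t 3 w) 0 1); split=> // w w' wr wr'.
have rr : rho < rho' by rewrite /rho' /r; lra.
have [H1 H2] := MP w w' (ltW (le_lt_trans wr rr)) (ltW (le_lt_trans wr' rr)).
have [wr1 wr1'] := (le_lt_trans wr rr, le_lt_trans wr' rr).
have rr' : rho' < r by case/andP: rho'P.
by rewrite (dE w wr1) (dE w' wr1') (fE w (lt_trans wr1 rr')) (fE w' (lt_trans wr1' rr')).
Qed.

(** In particular g' is continuous, without which the integral defining [T_op g f] could not be
    handled. *)
Lemma HD_derive1 (f : C -> C) : HD f -> HD (derive1 f).
Proof.
move=> fD z; rewrite disc_rnorm => z1; have z0 := rnorm_ge0 z.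
pose rho := (1 + rnorm z) / 2.
have rho01 : 0 <= rho < 1 by rewrite /rho; lra.
have [M [f2 [M0 MP]]] := HD_repr fD rho01.
apply: (@is_cderiv_derivable _ _ _ (f2 z)).
apply: (is_cderiv_quad (M := M) (d := rho - rnorm z)); first by rewrite /rho; lra.
move=> h hr; have wh : rnorm (z + h) <= rho by have := rnormD z h; lra.
have zr : rnorm z <= rho by rewrite /rho; lra.
have [_] := MP z (z + h) zr wh.
by have -> : z + h - z = h by ring.
Qed.

Lemma HD_taylor (f : C -> C) (rho : R) : HD f -> 0 <= rho < 1 -> exists2 M : R,
  0 <= M & forall w w', rnorm w <= rho -> rnorm w' <= rho ->
    rnorm (f w' - f w - (w' - w) * derive1 f w) <= M * rnorm (w' - w) ^+ 2.
Proof.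
move=> fD rho01; have [M [f2 [M0 MP]]] := HD_repr fD rho01.
by exists M => // w w' h h'; have [] := MP w w' h h'.
Qed.

End Taylor.

(** * The Volterra operator *)

Section VolterraOperator.
Variable R : realType.
Local Notation C := (Cplx R).
Local Notation rC := (@real_to_Cplx R).
Implicit Types (f g h : C -> C) (z w : C).

Lemma HD_cderiv f z : HD f -> rnorm z < 1 -> is_cderiv f z (derive1 f z).
Proof. by move=> fD z1; apply: HD_is_cderiv; rewrite ?disc_rnorm. Qed.

Lemma HD_cont f z : HD f -> rnorm z < 1 -> {for z, continuous f}.
Proof. by move=> fD z1; exact: is_cderiv_continuous (HD_cderiv fD z1). Qed.

Lemma HD_bounded f (rho : R) : HD f -> 0 <= rho < 1 ->
  exists2 M : R, 0 <= M & forall w, rnorm w <= rho -> rnorm (f w) <= M.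
Proof.
move=> fD rho01; have [M M0 MP] := HD_taylor fD rho01.
exists (rnorm (f 0) + rnorm (derive1 f 0) + M) => [|w wr].
  by rewrite !addr_ge0 ?rnorm_ge0.
have := MP 0 w; rewrite rnorm0 subr0 => /(_ _ wr) h.
have {}h := h ltac:(lra).
have := rnorm_le_sub (f w) (f 0 + w * derive1 f 0).
rewrite opprD addrA => h1.
have := rnormD (f 0) (w * derive1 f 0); rewrite rnormM => h2.
have w0 := rnorm_ge0 w; have d0 := rnorm_ge0 (derive1 f 0).
have : M * rnorm w ^+ 2 <= M by rewrite ler_piMr// exprn_ile1//; lra.
have : rnorm w * rnorm (derive1 f 0) <= rnorm (derive1 f 0) by rewrite ler_piMl//; lra.
lra.
Qed.

Lemma rnorm_ray (t : R) z : 0 <= t <= 1 -> rnorm (rC t * z) <= rnorm z.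
Proof.
by move=> /andP[t0 t1]; rewrite rnormM rnorm_real ger0_norm// ler_piMl// rnorm_ge0.
Qed.

Lemma HD_cont_ray f z : HD f -> rnorm z < 1 -> cont_on (fun t => f (rC t * z)) 0 1.
Proof.
move=> fD z1 t t01; apply: (@rcont_comp _ f (fun t => rC t * z)).
  have crC : cont_on rC t t by move=> s _; exact: rC_continuous.
  by apply: (cont_onM crC (@cont_on_cst _ z t t)); rewrite lexx.
by apply: HD_cont => //; apply: le_lt_trans z1; exact: rnorm_ray.
Qed.

Lemma HD_rderiv_ray f z t : HD f -> rnorm z < 1 -> 0 <= t <= 1 ->
  is_rderiv (fun t => f (rC t * z)) t (derive1 f (rC t * z) * z).
Proof.
move=> fD z1 t01.
have lin : is_rderiv (fun t => rC t * z) t z.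
  by have := is_rderivM (is_rderiv_rC t) (is_rderiv_cst z t); rewrite mul1r mulr0 addr0.
apply: (is_rderiv_comp lin); apply: HD_cderiv => //.
by apply: le_lt_trans z1; exact: rnorm_ray.
Qed.

(** Differentiation under the integral sign yields [Psi'], which is the t-derivative of t phi(t z)
    and hence integrates to phi z. *)
Lemma HD_primitive (phi : C -> C) z : HD phi -> rnorm z < 1 ->
  is_cderiv (fun w => cint (fun t => phi (rC t * w) * w) 0 1) z (phi z).
Proof.
move=> pD z1; have z0 := rnorm_ge0 z.
have pD' := HD_derive1 pD.
pose rho := (1 + rnorm z) / 2.
have rho01 : 0 <= rho < 1 by rewrite /rho; lra.
have [M M0 MP] := HD_taylor pD rho01.
have [B B0 BP] := HD_bounded pD' rho01.
pose Psi (t : R) w := phi (rC t * w) * w.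
pose Psi' (t : R) w := phi (rC t * w) + rC t * (derive1 phi (rC t * w) * w).
have cPsi w : rnorm w < 1 -> cont_on (Psi^~ w) 0 1.
  by move=> w1; exact: (cont_onM (HD_cont_ray pD w1) (@cont_on_cst _ w 0 1)).
have crC : cont_on rC 0 1 by move=> s _; exact: rC_continuous.
have cPsi' w : rnorm w < 1 -> cont_on (Psi'^~ w) 0 1.
  move=> w1; apply: (cont_onD (HD_cont_ray pD w1)).
  exact: (cont_onM crC (cont_onM (HD_cont_ray pD' w1) (@cont_on_cst _ w 0 1))).
have <- : cint (Psi'^~ z) 0 1 = phi z.
  rewrite (@cint_FTC _ _ (fun t => rC t * phi (rC t * z)) 0 1 ltr01 (cPsi' _ z1)).
    by rewrite rC1 rC0 !mul1r mul0r subr0.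
  move=> t t01; have := is_rderivM (is_rderiv_rC t) (HD_rderiv_ray pD z1 t01).
  by rewrite mul1r.
apply: (is_cderiv_quad (M := 2 * (M + B)) (d := rho - rnorm z)); first by rewrite /rho; lra.
move=> k kr; have zk : rnorm (z + k) <= rho by have := rnormD z k; lra.
have zr : rnorm z <= rho by rewrite /rho; lra.
have kE : z + k - z = k by rewrite addrAC subrr add0r.
have zk1 : rnorm (z + k) < 1 by lra.
have := @cint_diff R Psi Psi' z (z + k) (M + B) (cPsi _ z1) (cPsi _ zk1) (cPsi' _ z1).
rewrite kE; apply=> t t01.
have -> : Psi t (z + k) - Psi t z - k * Psi' t z =
  (phi (rC t * (z + k)) - phi (rC t * z)
     - (rC t * (z + k) - rC t * z) * derive1 phi (rC t * z)) * (z + k)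
  + k ^+ 2 * (rC t * derive1 phi (rC t * z)) by rewrite /Psi /Psi'; ring.
apply: le_trans (rnormD _ _) _; rewrite [leRHS]mulrDl; apply: lerD.
  rewrite rnormM; apply: (@le_trans _ _ (M * rnorm k ^+ 2 * 1)); last by rewrite mulr1.
  apply: ler_pM; rewrite ?rnorm_ge0//; last lra.
  apply: le_trans (MP _ _ (le_trans (rnorm_ray _ t01) _) (le_trans (rnorm_ray _ t01) _)) _ => //.
  rewrite ler_wpM2l// -mulrBr kE lerXn2r ?nnegrE ?rnorm_ge0//; exact: rnorm_ray.
rewrite rnormM rnormX mulrC ler_wpM2r ?sqr_ge0//.
apply: le_trans (rnorm_ray _ t01) _; apply: BP; exact: le_trans (rnorm_ray _ t01) _.
Qed.

Lemma HD_mul f g : HD f -> HD g -> HD (fun z => f z * g z).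
Proof. by move=> fD gD z zD; apply: derivableM; [exact: fD|exact: gD]. Qed.

Lemma derive1_mul f g z : HD f -> HD g -> rnorm z < 1 ->
  derive1 (fun z => f z * g z) z = f z * derive1 g z + derive1 f z * g z.
Proof.
move=> fD gD z1; apply: is_cderiv_derive1; apply/is_cderivE.
have /is_cderivE fz := HD_cderiv fD z1; have /is_cderivE gz := HD_cderiv gD z1.
have H := is_deriveM fz gz; apply: (is_derive_eq H).
by rewrite [in LHS]/GRing.scale /= (mulrC (g z)).
Qed.

Lemma T_opE g f z : T_op g f z = cint (fun t => f (rC t * z) * derive1 g (rC t * z) * z) 0 1.
Proof. by []. Qed.

Lemma T_op_cderiv g f z : HD g -> HD f -> rnorm z < 1 ->
  is_cderiv (T_op g f) z (f z * derive1 g z).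
Proof. by move=> gD fD z1; exact: (HD_primitive (HD_mul fD (HD_derive1 gD)) z1). Qed.

Lemma T_op_integrand_cont g f z : HD g -> HD f -> rnorm z < 1 ->
  cont_on (fun t => f (rC t * z) * derive1 g (rC t * z) * z) 0 1.
Proof.
move=> gD fD z1.
exact: (cont_onM (HD_cont_ray (HD_mul fD (HD_derive1 gD)) z1) (@cont_on_cst _ z 0 1)).
Qed.

Lemma eq_T_op g f h z : eq_on_disc f h -> rnorm z < 1 -> T_op g f z = T_op g h z.
Proof.
move=> fh z1; rewrite !T_opE; apply: eq_cint => t t01; rewrite fh// disc_rnorm.
by apply: le_lt_trans z1; exact: rnorm_ray.
Qed.

Lemma T_op_linear g f h (a : C) z : HD g -> HD f -> HD h -> rnorm z < 1 ->
  T_op g (fun x => a * f x + h x) z = a * T_op g f z + T_op g h z.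
Proof.
move=> gD fD hD z1; have cf := T_op_integrand_cont gD fD z1.
have ch := T_op_integrand_cont gD hD z1.
rewrite !T_opE -(cintZ a cf) -(cintD (cont_onZ cf) ch); apply: eq_cint => t _; ring.
Qed.

(** Trades g' for f' in the integral: the symbols of interest are bounded, their derivatives need
    not be. *)
Lemma T_op_parts g f z : HD g -> HD f -> rnorm z < 1 ->
  T_op g f z + T_op f g z = f z * g z - f 0 * g 0.
Proof.
move=> gD fD z1; have cf := T_op_integrand_cont gD fD z1.
have cg := T_op_integrand_cont fD gD z1; have fgD := HD_mul fD gD.
rewrite !T_opE -(cintD cf cg).
have := @cint_FTC _ _ (fun t => f (rC t * z) * g (rC t * z)) 0 1 ltr01
  (cont_onM (HD_cont_ray (HD_derive1 fgD) z1) (@cont_on_cst _ z 0 1)).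
rewrite rC1 rC0 mul1r mul0r => <-; last by move=> t t01; exact: (HD_rderiv_ray fgD z1 t01).
apply: eq_cint => t t01; rewrite derive1_mul//; last by apply: le_lt_trans z1; exact: rnorm_ray.
move: (f _) (derive1 g _) (g _) (derive1 f _) => a b c d; ring.
Qed.

Lemma cderiv_bound (F F' : C -> C) (rho M : R) z w : rho < 1 ->
  (forall x, rnorm x <= rho -> is_cderiv F x (F' x)) -> HD F' ->
  (forall x, rnorm x <= rho -> rnorm (F' x) <= M) ->
  rnorm z <= rho -> rnorm w <= rho -> rnorm (F z - F w) <= 2 * M * rnorm (z - w).
Proof.
move=> rho1 dF cF' MP zr wr.
pose ga (t : R) : C := w + rC t * (z - w).
have gar t : 0 <= t <= 1 -> rnorm (ga t) <= rho.
  move=> t01; have -> : ga t = rC (1 - t) * w + rC t * z by rewrite /ga rCB rC1; ring.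
  apply: le_trans (rnormD _ _) _; rewrite !rnormM !rnorm_real !ger0_norm; [nra|lra|lra].
have dga t : is_rderiv ga t (z - w).
  have := is_rderivD (is_rderiv_cst w t) (is_rderivM (is_rderiv_rC t) (is_rderiv_cst (z - w) t)).
  by rewrite mul1r mulr0 addr0 add0r.
have -> : F z - F w = (F \o ga) 1 - (F \o ga) 0.
  by rewrite /ga /= rC1 rC0 mul1r mul0r addr0 (addrC w) subrK.
have -> : 2 * M * rnorm (z - w) = 2 * (M * rnorm (z - w)) * (1 - 0) by ring.
apply: (@rderiv_bound _ _ (fun t => F' (ga t) * (z - w))) => [|t t01||t t01].
- exact: ler01.
- exact: (is_rderiv_comp (dga t) (dF _ (gar t t01))).
- have cga : cont_on (fun t => F' (ga t)) 0 1.
    move=> t t01; apply: (@rcont_comp _ F' ga); first exact: is_rderiv_continuous (dga t).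
    by apply: HD_cont => //; apply: le_lt_trans rho1; exact: gar.
  exact: (cont_onM cga (@cont_on_cst _ (z - w) 0 1)).
- rewrite rnormM ler_wpM2r ?rnorm_ge0//; exact: MP (gar t t01).
Qed.

Lemma T_op_lip g h (rho M : R) z w : HD g -> HD h -> rho < 1 ->
  (forall x, rnorm x <= rho -> rnorm (h x) * rnorm (derive1 g x) <= M) ->
  rnorm z <= rho -> rnorm w <= rho ->
  rnorm (T_op g h z - T_op g h w) <= 2 * M * rnorm (z - w).
Proof.
move=> gD hD rho1 MP zr wr.
apply: (@cderiv_bound _ _ _ M _ _ rho1 _ (HD_mul hD (HD_derive1 gD)) _ zr wr).
- by move=> x xr; apply: (T_op_cderiv gD hD); exact: le_lt_trans rho1.
- by move=> x xr; rewrite rnormM; exact: MP.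
Qed.

End VolterraOperator.

(** * Ultralimits and uniform continuity on the disc *)

Section UltraLimit.
Variable R : realType.
Local Notation C := (Cplx R).
Local Notation rC := (@real_to_Cplx R).

Lemma free_ultrafilter_ex : exists U : set_system nat, UltraFilter U /\ \oo `<=` U.
Proof. exact: ultraFilterLemma. Qed.

Definition free_ultrafilter : set_system nat := projT1 (cid free_ultrafilter_ex).
Local Notation U := free_ultrafilter.

Lemma free_ultrafilter_ultra : UltraFilter U.
Proof. by rewrite /U; case: cid => ? []. Qed.
Local Existing Instance free_ultrafilter_ultra.

Lemma free_ultrafilter_ge (N : nat) : U [set n | (N <= n)%N].
Proof.
rewrite /U; case: cid => V [? H] /=; apply: H; exact: nbhs_infty_ge.
Qed.

(** Compactness of [-M, M] provides a cluster point, and along an ultrafilter a cluster point is a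
    limit. *)
Lemma ulimR_ex (a : nat -> R) (M : R) : (forall n, `|a n| <= M) ->
  exists l, forall e, 0 < e -> U [set n | `|a n - l| < e].
Proof.
move=> aM; have cpt := @segment_compact R (- M) M.
have [|l [_ lP]] := cpt (a @ U) _.
  by apply: (@filterE _ U) => n; rewrite /= in_itv/= -ler_norml.
exists l => e e0; pose A := [set n | `|a n - l| < e].
have [//|UA] := @in_ultra_setVsetC _ U A _.
have [||x [/= xA xl]] := lP (~` [set x | `|x - l| < e]) (ball l e).
- by apply: filterS UA => n /=.
- exact: nbhsx_ballx.
by exfalso; apply: xA; rewrite distrC.
Qed.

Definition bounded_seq (a : nat -> C) := exists M : R, forall n, rnorm (a n) <= M.

(** The default 0 is harmless: by [ulimP] a limit exists for every bounded sequence. *)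
Definition ulim (a : nat -> C) : C :=
  xget 0 [set l | forall e : R, 0 < e -> U [set n | rnorm (a n - l) < e]].

Lemma ulimP a : bounded_seq a -> forall e : R, 0 < e -> U [set n | rnorm (a n - ulim a) < e].
Proof.
move=> [M aM]; rewrite /ulim; case: xgetP => [l _ //|/(_ _)H]; exfalso.
have [x xP] := @ulimR_ex (fun n => complex.Re (a n)) M (fun n => le_trans (normRe_le _) (aM n)).
have [y yP] := @ulimR_ex (fun n => complex.Im (a n)) M (fun n => le_trans (normIm_le _) (aM n)).
apply: (H (x +i* y)%C) => e e0.
have e2 : 0 < e / 2 by rewrite divr_gt0.
apply: filterS (filterI (xP _ e2) (yP _ e2)) => n [/= h1 h2].
apply: le_lt_trans (rnorm_le_ReIm _) _; rewrite !(cReD, cReN, cImD, cImN) /=; lra.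
Qed.

Lemma ulim_unique a (l l' : C) : (forall e : R, 0 < e -> U [set n | rnorm (a n - l) < e]) ->
  (forall e : R, 0 < e -> U [set n | rnorm (a n - l') < e]) -> l = l'.
Proof.
move=> H H'; apply/eqP; rewrite -subr_eq0; apply/eqP/rnorm0_eq0/eqP.
rewrite eq_le rnorm_ge0 andbT; apply/ler_addgt0Pl => e e0; rewrite addr0.
have e2 : 0 < e / 2 by rewrite divr_gt0.
have [n [/= h1 h2]] := filter_ex (filterI (H _ e2) (H' _ e2)).
have := rnormD (l - a n) (a n - l'); rewrite addrA subrK (rnormBC l (a n)); lra.
Qed.

Lemma ulim_eq a (l : C) : (forall e : R, 0 < e -> U [set n | rnorm (a n - l) < e]) -> ulim a = l.
Proof.
move=> H; apply: (ulim_unique (a := a)) => //.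
rewrite /ulim; case: xgetP => [//|/(_ l)]; by [].
Qed.

Lemma ulim_cvg a (l : C) : (forall e : R, 0 < e -> exists N, forall n, (N <= n)%N ->
  rnorm (a n - l) < e) -> ulim a = l.
Proof.
move=> H; apply: ulim_eq => e e0; have [N NP] := H e e0.
exact: filterS (free_ultrafilter_ge N).
Qed.

Lemma bounded_seq_linear a b (k : C) : bounded_seq a -> bounded_seq b ->
  bounded_seq (fun n => k * a n + b n).
Proof.
move=> [M aM] [M' bM]; exists (rnorm k * M + M') => n.
apply: le_trans (rnormD _ _) _; rewrite rnormM lerD//.
by rewrite ler_wpM2l ?rnorm_ge0.
Qed.

Lemma ulim_linear a b (k : C) : bounded_seq a -> bounded_seq b ->
  ulim (fun n => k * a n + b n) = k * ulim a + ulim b.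
Proof.
move=> ba bb; apply: ulim_eq => e e0.
have k0 : 0 < 1 + rnorm k by rewrite ltr_pwDl// rnorm_ge0.
have e1 : 0 < e / 2 / (1 + rnorm k) by rewrite !divr_gt0.
have e2 : 0 < e / 2 by rewrite divr_gt0.
apply: filterS (filterI (ulimP ba e1) (ulimP bb e2)) => n [/= h1 h2].
have -> : k * a n + b n - (k * ulim a + ulim b) = k * (a n - ulim a) + (b n - ulim b) by ring.
apply: le_lt_trans (rnormD _ _) _; rewrite rnormM.
move: h1; rewrite ltr_pdivlMr// => h1.
have := rnorm_ge0 (a n - ulim a); lra.
Qed.

Lemma ulim_le a (l : C) (M : R) N : bounded_seq a ->
  (forall n, (N <= n)%N -> rnorm (a n - l) <= M) -> rnorm (ulim a - l) <= M.
Proof.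
move=> ba aM; apply/ler_addgt0Pl => e e0.
have [n [/= h1 h2]] := filter_ex (filterI (ulimP ba e0) (free_ultrafilter_ge N)).
have := rnormD (ulim a - a n) (a n - l); rewrite addrA subrK (rnormBC _ (a n)).
have := aM n h2; lra.
Qed.

Lemma ulim_Re_ge a (d : R) N : bounded_seq a ->
  (forall n, (N <= n)%N -> d <= complex.Re (a n)) -> d <= complex.Re (ulim a).
Proof.
move=> ba aM; apply/ler_addgt0Pl => e e0.
have [n [/= h1 h2]] := filter_ex (filterI (ulimP ba e0) (free_ultrafilter_ge N)).
have := Re_le (a n - ulim a); have := aM n h2; rewrite cReD cReN; lra.
Qed.

Lemma ulim_frequently a (e : R) N : bounded_seq a -> 0 < e ->
  exists2 n, (N <= n)%N & rnorm (a n - ulim a) < e.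
Proof.
move=> ba e0.
have [n [/= h1 h2]] := filter_ex (filterI (ulimP ba e0) (free_ultrafilter_ge N)).
by exists n.
Qed.

End UltraLimit.

(** * Uniform continuity on the open disc and the disc algebra *)

Section UniformContinuity.
Variable R : realType.
Local Notation C := (Cplx R).
Local Notation rC := (@real_to_Cplx R).
Implicit Types (f g h : C -> C) (z w : C).

(** The working form of membership in the disc algebra: it involves no boundary values. *)
Definition uc_disc f := forall e : R, 0 < e -> exists2 d : R, 0 < d &
  forall z w, rnorm z < 1 -> rnorm w < 1 -> rnorm (z - w) < d -> rnorm (f z - f w) <= e.

Definition bounded_disc f := exists2 M : R, 0 <= M & forall z, rnorm z < 1 -> rnorm (f z) <= M.

(** Each z is within [d] of [rho z], which lies in a smaller closed disc where [HD_bounded] applies.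
    The maximum with 0 covers d > 2. *)
Lemma uc_bounded f : HD f -> uc_disc f -> bounded_disc f.
Proof.
move=> fD fu; have [d d0 dP] := fu 1 ltr01.
pose rho := Num.max 0 (1 - d / 2).
have rho0 : 0 <= rho by rewrite le_max lexx.
have rho1 : rho < 1 by rewrite gt_max ltr01/=; lra.
have rhod : 1 - rho < d.
  have : 1 - d / 2 <= rho by rewrite le_max lexx orbT.
  lra.
have [|M M0 MP] := @HD_bounded _ f rho fD; first by rewrite rho0.
exists (M + 1) => [|z z1]; first lra.
have z0 := rnorm_ge0 z.
have rz : rnorm (rC rho * z) = rho * rnorm z by rewrite rnormM rnorm_real ger0_norm.
have := dP z (rC rho * z) z1; rewrite rz.
have -> : z - rC rho * z = rC (1 - rho) * z by rewrite rCB rC1; ring.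
rewrite rnormM rnorm_real ger0_norm; last lra.
move=> h; have := MP (rC rho * z); rewrite rz => h'.
have := rnorm_le_sub (f z) (f (rC rho * z)).
have : rho * rnorm z <= rho by nra.
have : (1 - rho) * rnorm z <= 1 - rho by nra.
have : rho * rnorm z < 1 by nra.
move=> a1 a2 a3; have := h a1 (le_lt_trans a2 rhod); have := h' a3; lra.
Qed.

(** [n.+2] keeps the radius positive already at n = 0, as [admissible_dilation] demands. *)
Definition dilation_radius (n : nat) : R := 1 - n.+2%:R^-1.

Lemma dilation_radius01 n : 0 < dilation_radius n < 1.
Proof.
rewrite /dilation_radius subr_gt0 invf_lt1 ?ltr0n// ltr1n /=.
by rewrite ltrBlDr ltrDl invr_gt0 ltr0n.
Qed.

Lemma dilation_radius_near1 (d : R) : 0 < d ->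
  exists N, forall n, (N <= n)%N -> 1 - dilation_radius n < d.
Proof.
move=> d0; have [N _ NP] := (near_infty_natSinv_lt (PosNum d0)).
exists N => n /NP /=.
rewrite /dilation_radius opprB addrC subrK; apply: le_lt_trans.
by rewrite lef_pV2 ?posrE ?ltr0n// ler_nat.
Qed.

(** The extension to the closed disc is the ultralimit of f(r_n z). Dilations shrink distances, so
    it inherits the modulus of continuity of [f]. *)
Lemma uc_disc_algebra f : HD f -> uc_disc f -> disc_algebra f.
Proof.
move=> fD fu; split => //.
have [M M0 MP] := uc_bounded fD fu.
have radz n z : rnorm z <= 1 -> rnorm (rC (dilation_radius n) * z) < 1.
  move=> z1; rewrite rnormM rnorm_real; have := dilation_radius01 n => /andP[r0 r1].
  by rewrite ger0_norm ?(ltW r0)//; have := rnorm_ge0 z; nra.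
exists (fun z => ulim (fun n => f (rC (dilation_radius n) * z))).
have bd z : rnorm z <= 1 -> bounded_seq (fun n => f (rC (dilation_radius n) * z)).
  by move=> z1; exists M => n; exact/MP/radz.
split; last first.
  move=> z; rewrite disc_rnorm => z1; apply/esym/ulim_cvg => e e0.
  have e2 : 0 < e / 2 by rewrite divr_gt0.
  have [d d0 dP] := fu _ e2; have [N NP] := dilation_radius_near1 d0.
  exists N => n /NP nd; apply: (@le_lt_trans _ _ (e / 2)); last lra.
  apply: dP; [exact/radz/ltW|exact: z1|].
  rewrite rnormBC.
  have -> : z - rC (dilation_radius n) * z = rC (1 - dilation_radius n) * z.
    by rewrite (rCB 1 (dilation_radius n)) rC1; ring.
  have := dilation_radius01 n => /andP[r0 r1]; rewrite rnormM rnorm_real ger0_norm; last lra.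
  by have := rnorm_ge0 z; nra.
apply/subspace_continuousP => z; rewrite closed_disc_rnorm => z1.
apply/(@cvgrPdist_le _ C) => _ /Cplx_gt0[e e0 ->].
have [d d0 dP] := fu e e0.
apply/nbhs_ballP; exists (rC d) => /=; first by rewrite -rC0 real_to_Cplx_lt.
move=> w; rewrite -ball_normE /= rnormE real_to_Cplx_lt closed_disc_rnorm => zw w1.
rewrite rnormE real_to_Cplx_le.
have := ulim_linear (-1) (bd w w1) (bd z z1); rewrite mulN1r addrC => <-.
rewrite -[X in rnorm X]subr0; apply: (ulim_le (N := 0%N)).
  exact: bounded_seq_linear (bd w w1) (bd z z1).
move=> n _; rewrite subr0 mulN1r addrC; apply: dP; [exact: radz|exact: radz|].
rewrite -mulrBr rnormM rnorm_real; have := dilation_radius01 n => /andP[r0 r1].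
by rewrite ger0_norm ?(ltW r0)//; have := rnorm_ge0 (z - w); nra.
Qed.

(** Points [u n] with |f (u n)| > n would accumulate at their ultralimit in the closed disc, where
    the extension [h] is continuous and so locally bounded. *)
Lemma disc_algebra_bounded f : disc_algebra f -> bounded_disc f.
Proof.
move=> [fD [h [hc fh]]].
have [//|nb] := pselect (bounded_disc f).
have H n : exists z, rnorm z < 1 /\ n%:R < rnorm (f z).
  apply: contrapT => nz; apply: nb; exists n%:R => [|z z1]; first exact: ler0n.
  by rewrite leNgt; apply/negP => fz; apply: nz; exists z.
have [u uP] := choice H.
have bu : bounded_seq u by exists 1 => n; apply/ltW/(uP n).1.
pose l := ulim u.
have l1 : rnorm l <= 1.
  rewrite -[l]subr0; apply: (ulim_le (N := 0%N)) => // n _.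
  by rewrite subr0; apply/ltW/(uP n).1.
have lD : closed_disc l by rewrite closed_disc_rnorm.
have /subspace_continuousP /(_ l lD) := hc.
move=> /(@cvgrPdist_le _ C) /(_ 1 ltr01) /nbhs_ballP[_ /= /Cplx_gt0[d d0 ->] dP].
have [n nN nd] := ulim_frequently (Num.bound (rnorm (h l) + 1)) bu d0.
have := dP (u n); rewrite -ball_normE /= rnormE real_to_Cplx_lt rnormBC => /(_ nd).
rewrite closed_disc_rnorm => /(_ (ltW (uP n).1)).
rewrite rnormE -rC1 real_to_Cplx_le => hd.
have := (uP n).2; rewrite fh; last by rewrite disc_rnorm; exact: (uP n).1.
have h0 : 0 <= rnorm (h l) + 1 by rewrite addr_ge0 ?rnorm_ge0.
have := archi_boundP h0.
have : (Num.bound (rnorm (h l) + 1))%:R <= n%:R :> R by rewrite ler_nat.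
have := rnorm_le_sub (h (u n)) (h l); rewrite (rnormBC (h (u n))); lra.
Qed.

End UniformContinuity.

(** * Peak functions and the gliding hump *)

Section PeakFunctions.
Variable R : realType.
Local Notation C := (Cplx R).
Local Notation rC := (@real_to_Cplx R).

Lemma rnorm_sqr (z : C) : rnorm z ^+ 2 = complex.Re z ^+ 2 + complex.Im z ^+ 2.
Proof. by rewrite rnormC_sqrt sqr_sqrtr// addr_ge0 ?sqr_ge0. Qed.

Lemma telescope_sum (b : nat -> C) (psi : nat -> R) n N :
  (forall k, rnorm (b k) <= psi k - psi k.+1) -> (n <= N)%N ->
  rnorm (\sum_(k < N) b k - \sum_(k < n) b k) <= psi n - psi N.
Proof.
move=> bP /subnKC <-; elim: (N - n)%N => [|m IH].
  by rewrite addn0 !subrr rnorm0.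
rewrite addnS big_ord_recr /= addrAC; apply: le_trans (rnormD _ _) _.
have := bP (n + m)%N; lra.
Qed.

Variable a : C.
Hypothesis a1 : rnorm a = 1.
Implicit Types (s t : R) (z w : C).

(** Vanishes at the boundary point 1/a and has positive real part on the disc, so that |s + u| is at
    least both s and |u|. *)
Definition polar z : C := 1 - a * z.
Local Notation u := polar.

Definition peak s z : C := rC s * (rC s + u z)^-1.
Definition peak' s z : C := a * rC s * (rC s + u z)^-1 ^+ 2.

Lemma polar_Re z : rnorm z < 1 -> 0 < complex.Re (u z).
Proof.
move=> z1; rewrite /u cReD cReN /= subr_gt0; apply: le_lt_trans (Re_le _) _.
by rewrite rnormM a1 mul1r.
Qed.

Lemma polar_gt0 z : rnorm z < 1 -> 0 < rnorm (u z).
Proof. by move=> /polar_Re h; apply: lt_le_trans h (Re_le _). Qed.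

Lemma polar_ge z rho : rnorm z <= rho -> 1 - rho <= rnorm (u z).
Proof.
move=> zr; have := rnorm_le_sub (1 : C) (a * z); rewrite rnormM a1 mul1r rnorm1 -/(u z); lra.
Qed.

Lemma peak_den_ge s z : 0 <= s -> rnorm z < 1 ->
  s <= rnorm (rC s + u z) /\ rnorm (u z) <= rnorm (rC s + u z).
Proof.
move=> s0 /polar_Re u0; split.
  apply: le_trans (Re_le _); rewrite cReD; change (s <= s + complex.Re (u z)); lra.
rewrite -(@ler_pXn2r _ 2%N) ?nnegrE ?rnorm_ge0// !rnorm_sqr cReD cImD.
change (complex.Re (u z) ^+ 2 + complex.Im (u z) ^+ 2 <=
  (s + complex.Re (u z)) ^+ 2 + (0 + complex.Im (u z)) ^+ 2).
by rewrite add0r lerD2r; nra.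
Qed.

Lemma peak_den_neq0 s z : 0 <= s -> rnorm z < 1 -> rC s + u z != 0.
Proof.
move=> s0 z1; rewrite -rnorm_gt0; apply: lt_le_trans (polar_gt0 z1) _.
by have [] := peak_den_ge s0 z1.
Qed.

Lemma peak_le s z : 0 <= s -> rnorm z < 1 -> rnorm (peak s z) <= s / rnorm (u z).
Proof.
move=> s0 z1; have [_ h] := peak_den_ge s0 z1; have u0 := polar_gt0 z1.
rewrite /peak rnormM rnorm_real ger0_norm// rnormV ler_wpM2l// lef_pV2 ?posrE//; lra.
Qed.

Lemma peak_near1 s z : 0 < s -> rnorm z < 1 -> rnorm (peak s z - 1) <= rnorm (u z) / s.
Proof.
move=> s0 z1; have [h _] := peak_den_ge (ltW s0) z1; have n0 := peak_den_neq0 (ltW s0) z1.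
have -> : peak s z - 1 = - (u z * (rC s + u z)^-1) by rewrite /peak; field.
rewrite rnormN rnormM rnormV ler_wpM2l ?rnorm_ge0// lef_pV2 ?posrE//; lra.
Qed.

(** The difference is (s - t) u / ((s + u)(t + u)), and |s + u| >= (s + |u|) / 2. Each denominator
    costs a factor 2; what remains is the same difference with |u| in place of u. *)
Lemma peak_diff s t z : 0 < t <= s -> rnorm z < 1 ->
  rnorm (peak s z - peak t z) <=
    4 * (s / (s + rnorm (u z)) - t / (t + rnorm (u z))).
Proof.
move=> /andP[t0 ts] z1; have s0 : 0 < s by lra.
have [hs1 hs2] := peak_den_ge (ltW s0) z1; have [ht1 ht2] := peak_den_ge (ltW t0) z1.
have ns := peak_den_neq0 (ltW s0) z1; have nt := peak_den_neq0 (ltW t0) z1.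
have u0 := polar_gt0 z1.
have -> : peak s z - peak t z = rC (s - t) * (u z) * ((rC s + u z)^-1 * (rC t + u z)^-1).
  by rewrite /peak rCB; field; rewrite ns nt.
rewrite !rnormM !rnormV rnorm_real ger0_norm ?subr_ge0//.
set x := rnorm (u z) in u0 hs2 ht2 *.
have -> : 4 * (s / (s + x) - t / (t + x)) = (s - t) * x * ((2 * (s + x)^-1) * (2 * (t + x)^-1)).
  by field; apply/andP; split; apply: lt0r_neq0; lra.
have inv2 (p q : R) : 0 < p -> p <= 2 * q -> q^-1 <= 2 * p^-1.
  move=> p0 pq; have q0 : 0 < q by lra.
  by rewrite ler_pdivlMr// mulrC ler_pdivrMr.
rewrite ler_wpM2l ?mulr_ge0 ?subr_ge0//; first exact: ltW.
by rewrite ler_pM ?invr_ge0 ?rnorm_ge0//; apply: inv2; lra.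
Qed.

(** The factor [s] on the right makes these remainders summable along the sequence of scales. *)
Lemma peak_taylor s z k rho : 0 <= s -> rho < 1 -> rnorm z <= rho -> rnorm (z + k) <= rho ->
  rnorm (peak s (z + k) - peak s z - k * peak' s z) <= s * ((1 - rho)^-1 ^+ 3 * rnorm k ^+ 2).
Proof.
move=> s0 rho1 zr zkr.
have z1 : rnorm z < 1 by lra.
have zk1 : rnorm (z + k) < 1 by lra.
have n1 := peak_den_neq0 s0 z1; have n2 := peak_den_neq0 s0 zk1.
have E : rC s + u (z + k) = rC s + u z - a * k by rewrite /u; ring.
have -> : peak s (z + k) - peak s z - k * peak' s z =
   rC s * ((rC s + u (z + k))^-1 * (rC s + u z)^-1 ^+ 2 * (a * k) ^+ 2).
  rewrite /peak /peak' E; rewrite E in n2; move: n1 n2.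
  by set p := rC s + u z => n1 n2; field; rewrite n1 n2.
rewrite (rnormM (rC s)) rnorm_real ger0_norm// ler_wpM2l//.
rewrite rnormM (rnormX (a * k)) (rnormM a) a1 mul1r ler_wpM2r ?sqr_ge0// rnormM.
have den x : rnorm x <= rho -> rnorm (rC s + u x)^-1 <= (1 - rho)^-1.
  move=> xr; rewrite rnormV lef_pV2 ?posrE//; last lra.
    have x1 : rnorm x < 1 by lra.
    by have [_ h] := peak_den_ge s0 x1; have := polar_ge xr; lra.
  have x1 : rnorm x < 1 by lra.
  by rewrite rnorm_gt0; exact: peak_den_neq0.
rewrite [leRHS]exprS ler_pM ?rnorm_ge0 ?exprn_ge0 ?rnorm_ge0//; first exact: den.
rewrite rnormX lerXn2r ?nnegrE ?rnorm_ge0 ?invr_ge0//; [lra|exact: den].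
Qed.

Lemma peak'_le s z rho : 0 <= s -> rho < 1 -> rnorm z <= rho ->
  rnorm (peak' s z) <= s * (1 - rho)^-1 ^+ 2.
Proof.
move=> s0 rho1 zr; have z1 : rnorm z < 1 by lra.
rewrite /peak' rnormM rnormX (rnormM a) a1 mul1r rnorm_real ger0_norm// ler_wpM2l//.
rewrite lerXn2r ?nnegrE ?rnorm_ge0 ?invr_ge0//; first lra.
rewrite rnormV lef_pV2 ?posrE//; [|by rewrite rnorm_gt0; exact: peak_den_neq0|lra].
by have [_ h] := peak_den_ge s0 z1; have := polar_ge zr; lra.
Qed.

(** Complements [peak'_le]: valid up to the boundary at the price of blowing up as s tends to 0. It
    controls the heads, [peak'_le] the series of derivatives. *)
Lemma peak'_le_inv s z : 0 < s -> rnorm z < 1 -> rnorm (peak' s z) <= s^-1.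
Proof.
move=> s0 z1; rewrite /peak' rnormM rnormX (rnormM a) a1 mul1r rnorm_real ger0_norm ?(ltW s0)//.
have [h _] := peak_den_ge (ltW s0) z1.
rewrite rnormV; apply: (@le_trans _ _ (s * s^-1 ^+ 2)).
  rewrite ler_wpM2l ?(ltW s0)// lerXn2r ?nnegrE ?invr_ge0 ?rnorm_ge0 ?(ltW s0)//.
  by rewrite lef_pV2 ?posrE//; lra.
by rewrite expr2 mulrA mulfV ?mul1r// gt_eqF.
Qed.

Section Series.
Variables (s : nat -> R) (eps : nat -> bool).
Hypotheses (s_0 : s 0%N = 1) (s_gt0 : forall k, 0 < s k) (s_half : forall k, s k.+1 <= s k / 2).

Definition hump k z : C := (eps k)%:R * (peak (s k) z - peak (s k.+1) z).
Definition hump' k z : C := (eps k)%:R * (peak' (s k) z - peak' (s k.+1) z).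
Definition humps N z := \sum_(k < N) hump k z.
Definition humps' N z := \sum_(k < N) hump' k z.
(** As an ultralimit of partial sums, it receives every estimate that is uniform in N without a
    summability argument. *)
Definition hump_series z := ulim (fun N => humps N z).

Lemma rnorm_bool (b : bool) (z : C) : rnorm (b%:R * z) <= rnorm z.
Proof. by case: b; rewrite ?mul1r// mul0r rnorm0 rnorm_ge0. Qed.

Lemma humps_diff n N z : (n <= N)%N -> rnorm z < 1 ->
  rnorm (humps N z - humps n z) <=
    4 * (s n / (s n + rnorm (u z))) - 4 * (s N / (s N + rnorm (u z))).
Proof.
move=> nN z1.
apply: (@telescope_sum (hump^~ z) (fun k => 4 * (s k / (s k + rnorm (u z)))) n N _ nN) => k.
apply: le_trans (rnorm_bool _ _) _; rewrite -mulrBr; apply: peak_diff => //.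
by have := s_gt0 k.+1; have := s_half k; have := s_gt0 k; lra.
Qed.

(** The telescoping majorant is close to 0 when s k is small against |u| and close to 1 in the
    opposite case. *)
Lemma psi_bounds k z : rnorm z < 1 -> 0 <= s k / (s k + rnorm (u z)) /\
  s k / (s k + rnorm (u z)) <= 1 /\ s k / (s k + rnorm (u z)) <= s k / rnorm (u z) /\
  1 - s k / (s k + rnorm (u z)) <= rnorm (u z) / s k.
Proof.
move=> z1; have u0 := polar_gt0 z1; have s0 := s_gt0 k.
set x := rnorm _ in u0 *; have sx : 0 < s k + x by lra.
split; first by rewrite divr_ge0 ?ltW.
split; first by rewrite ler_pdivrMr//; lra.
split; first by rewrite ler_wpM2l ?(ltW s0)// lef_pV2 ?posrE//; lra.
have -> : 1 - s k / (s k + x) = x / (s k + x) by field; rewrite gt_eqF.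
by rewrite ler_wpM2l ?(ltW u0)// lef_pV2 ?posrE//; lra.
Qed.

Lemma humps_bounded z : rnorm z < 1 -> bounded_seq (fun N => humps N z).
Proof.
move=> z1; exists 4 => N; have := humps_diff (leq0n N) z1.
rewrite {2}/humps big_ord0 subr0.
by have [_ [h0 _]] := psi_bounds 0 z1; have [h _] := psi_bounds N z1; lra.
Qed.

Lemma hump_series_diff n z : rnorm z < 1 ->
  rnorm (hump_series z - humps n z) <= 4 * (s n / rnorm (u z)).
Proof.
move=> z1; apply: (ulim_le (N := n)); first exact: humps_bounded.
move=> N nN; apply: le_trans (humps_diff nN z1) _.
by have [h _] := psi_bounds N z1; have [_ [_ [h' _]]] := psi_bounds n z1; lra.
Qed.

Lemma hump_series_bounded z : rnorm z < 1 -> rnorm (hump_series z) <= 4.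
Proof.
move=> z1; rewrite -[hump_series z]subr0; apply: (ulim_le (N := 0%N)); first exact: humps_bounded.
move=> N _; rewrite subr0; have := humps_diff (leq0n N) z1.
rewrite {2}/humps big_ord0 subr0.
by have [_ [h0 _]] := psi_bounds 0 z1; have [h _] := psi_bounds N z1; lra.
Qed.

(** Halving turns a sum of two errors into a difference, the form that [telescope_sum] accepts. *)
Lemma s_sum k : s k + s k.+1 <= 4 * s k - 4 * s k.+1.
Proof. by have := s_half k; have := s_gt0 k; lra. Qed.

Lemma humps_taylor N z k rho : rho < 1 -> rnorm z <= rho -> rnorm (z + k) <= rho ->
  rnorm (humps N (z + k) - humps N z - k * humps' N z) <=
    4 * ((1 - rho)^-1 ^+ 3 * rnorm k ^+ 2).
Proof.
move=> rho1 zr zkr; set A := (X in 4 * X).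
have A0 : 0 <= A by rewrite /A mulr_ge0 ?sqr_ge0// exprn_ge0// invr_ge0; lra.
have := @telescope_sum (fun j => hump j (z + k) - hump j z - k * hump' j z)
  (fun j => 4 * s j * A) 0 N _ (leq0n N).
rewrite big_ord0 subr0 /humps /humps' mulr_sumr !big_split /= !sumrN s_0.
move=> H; apply: le_trans (H _) _; last first.
  have : 0 <= s N * A by apply: mulr_ge0 => //; exact: ltW.
  lra.
move=> j; have -> : hump j (z + k) - hump j z - k * hump' j z =
   (eps j)%:R * ((peak (s j) (z + k) - peak (s j) z - k * peak' (s j) z)
     - (peak (s j.+1) (z + k) - peak (s j.+1) z - k * peak' (s j.+1) z)).
  by rewrite /hump /hump'; ring.
apply: le_trans (rnorm_bool _ _) _; apply: le_trans (rnormB _ _) _.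
have h1 := peak_taylor (ltW (s_gt0 j)) rho1 zr zkr.
have h2 := peak_taylor (ltW (s_gt0 j.+1)) rho1 zr zkr.
apply: le_trans (lerD h1 h2) _; rewrite -/A -mulrDl -mulrBl ler_wpM2r//; exact: s_sum.
Qed.

Lemma humps'_bounded z : rnorm z < 1 -> bounded_seq (fun N => humps' N z).
Proof.
move=> z1; set A := (1 - rnorm z)^-1 ^+ 2.
have A0 : 0 <= A by rewrite /A exprn_ge0// invr_ge0; lra.
exists (4 * A) => N.
have := @telescope_sum (fun j => hump' j z) (fun j => 4 * s j * A) 0 N _ (leq0n N).
rewrite big_ord0 subr0 s_0 => H; apply: le_trans (H _) _; last first.
  have : 0 <= s N * A by apply: mulr_ge0 => //; exact: ltW.
  lra.
move=> j; apply: le_trans (rnorm_bool _ _) _; apply: le_trans (rnormB _ _) _.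
have h1 := peak'_le (ltW (s_gt0 j)) z1 (lexx _).
have h2 := peak'_le (ltW (s_gt0 j.+1)) z1 (lexx _).
apply: le_trans (lerD h1 h2) _; rewrite -/A -mulrDl -mulrBl ler_wpM2r//; exact: s_sum.
Qed.

Lemma cderiv_of_taylor (f f' : C -> C) : (forall rho, rho < 1 -> exists M : R,
    forall z k, rnorm z <= rho -> rnorm (z + k) <= rho ->
      rnorm (f (z + k) - f z - k * f' z) <= M * rnorm k ^+ 2) ->
  forall z, rnorm z < 1 -> is_cderiv f z (f' z).
Proof.
move=> H z z1; have z0 := rnorm_ge0 z.
pose rho := (1 + rnorm z) / 2.
have rho1 : rho < 1 by rewrite /rho; lra.
have [M MP] := H rho rho1.
apply: (is_cderiv_quad (M := M) (d := rho - rnorm z)); first by rewrite /rho; lra.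
move=> k kr; apply: MP; first by rewrite /rho; lra.
by have := rnormD z k; lra.
Qed.

(** The quadratic bound of [humps_taylor] does not depend on N and so survives the ultralimit; the
    derivative is the ultralimit of [humps']. *)
Lemma hump_series_HD : HD hump_series.
Proof.
move=> z; rewrite disc_rnorm => z1.
pose h' z := ulim (fun N => humps' N z).
apply: (@is_cderiv_derivable _ _ _ (h' z)).
apply: cderiv_of_taylor z1 => rho rho1.
exists (4 * (1 - rho)^-1 ^+ 3) => {}z k zr zkr.
have z1 : rnorm z < 1 by lra.
have zk1 : rnorm (z + k) < 1 by lra.
have b1 := humps_bounded z1; have b2 := humps_bounded zk1; have b3 := humps'_bounded z1.
have E1 := ulim_linear (-1) b1 b2.
have b4 := bounded_seq_linear (-1) b1 b2.
have E2 := ulim_linear (- k) b3 b4.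
have -> : hump_series (z + k) - hump_series z - k * h' z =
   ulim (fun n => - k * humps' n z + (-1 * humps n z + humps n (z + k))).
  by rewrite E2 E1 /hump_series /h'; ring.
rewrite -[ulim _]subr0; apply: (ulim_le (N := 0%N)).
  exact: (bounded_seq_linear (- k) b3 b4).
move=> n _; have := humps_taylor n rho1 zr zkr; rewrite mulrA.
by congr (rnorm _ <= _); ring.
Qed.

Lemma hump_series_Hinf : Hinf hump_series.
Proof.
split; first exact: hump_series_HD.
by exists 4 => z; rewrite disc_rnorm; exact: hump_series_bounded.
Qed.

(* [hump_series] is [hump_head n], which is nearly [eps n] at points close to the boundary
   point, plus a tail that is small on compact sets. *)
Definition hump_head n z : C := humps n z + (eps n)%:R * peak (s n) z.
Definition hump_head' n z : C := humps' n z + (eps n)%:R * peak' (s n) z.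

Lemma hump_head_cderiv n z : rnorm z < 1 -> is_cderiv (hump_head n) z (hump_head' n z).
Proof.
apply: cderiv_of_taylor => rho rho1.
exists ((4 + s n) * (1 - rho)^-1 ^+ 3) => {}z k zr zkr.
have h1 := humps_taylor n rho1 zr zkr.
have h2 := peak_taylor (ltW (s_gt0 n)) rho1 zr zkr.
have -> : hump_head n (z + k) - hump_head n z - k * hump_head' n z =
  (humps n (z + k) - humps n z - k * humps' n z)
  + (eps n)%:R * (peak (s n) (z + k) - peak (s n) z - k * peak' (s n) z).
  by rewrite /hump_head /hump_head'; ring.
apply: le_trans (rnormD _ _) _; rewrite -mulrA mulrDl lerD//.
exact: le_trans (rnorm_bool _ _) h2.
Qed.

Lemma hump_head_HD n : HD (hump_head n).
Proof.
by move=> z; rewrite disc_rnorm => z1; exact: is_cderiv_derivable (hump_head_cderiv n z1).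
Qed.

(** When |u| is small against s n, all peaks up to index n are near 1: their differences nearly
    cancel (factor 4) and the last peak, weighted by eps n, remains (factor 1). *)
Lemma hump_head_near n z : rnorm z < 1 ->
  rnorm (hump_head n z - (eps n)%:R) <= 5 * (rnorm (u z) / s n).
Proof.
move=> z1; have -> : hump_head n z - (eps n)%:R =
    humps n z + (eps n)%:R * (peak (s n) z - 1) by rewrite /hump_head; ring.
apply: le_trans (rnormD _ _) _.
have h1 := le_trans (rnorm_bool (eps n) _) (peak_near1 (s_gt0 n) z1).
have := humps_diff (leq0n n) z1; rewrite {2}/humps big_ord0 subr0.
by have [_ [h0 _]] := psi_bounds 0 z1; have [_ [_ [_ h]]] := psi_bounds n z1; lra.
Qed.

(** The bounds 1 / s k at least double at each step, so the sum is dominated by the telescoping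
    difference of 3 / s k; the final peak adds 1 / s n. *)
Lemma hump_head'_le n z : rnorm z < 1 -> rnorm (hump_head' n z) <= 4 / s n.
Proof.
move=> z1; apply: le_trans (rnormD _ _) _.
have h1 := le_trans (rnorm_bool (eps n) _) (peak'_le_inv (s_gt0 n) z1).
have := @telescope_sum (fun j => hump' j z) (fun j => - (3 * (s j)^-1)) 0 n _ (leq0n n).
rewrite big_ord0 subr0 s_0 => H; have {}H := H _.
suff : forall k, rnorm (hump' k z) <= - (3 * (s k)^-1) - - (3 * (s k.+1)^-1).
  by move=> /H; rewrite -/(humps' n z) invr1; lra.
move=> j; apply: le_trans (rnorm_bool _ _) _; apply: le_trans (rnormB _ _) _.
have k1 := peak'_le_inv (s_gt0 j) z1; have k2 := peak'_le_inv (s_gt0 j.+1) z1.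
have : 2 * (s j)^-1 <= (s j.+1)^-1.
  have sj := s_gt0 j; have sj1 := s_gt0 j.+1.
  rewrite -[leRHS]mul1r ler_pdivlMr// mulrAC ler_pdivrMr//; have := s_half j; lra.
lra.
Qed.

Lemma hump_tail n z : rnorm z < 1 ->
  rnorm (hump_series z - hump_head n z) <= 5 * (s n.+1 / rnorm (u z)).
Proof.
move=> z1; have -> : hump_series z - hump_head n z =
    (hump_series z - humps n.+1 z) - (eps n)%:R * peak (s n.+1) z.
  by rewrite /hump_head /humps big_ord_recr /= /hump; ring.
apply: le_trans (rnormB _ _) _.
have h1 := le_trans (rnorm_bool (eps n) _) (peak_le (ltW (s_gt0 n.+1)) z1).
have := hump_series_diff n.+1 z1; lra.
Qed.

End Series.
End PeakFunctions.

(** * Choice of the points and scales of the gliding hump *)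

Section GlidingHump.
Variable R : realType.
Local Notation C := (Cplx R).
Local Notation rC := (@real_to_Cplx R).

(** [zeta] is the ultralimit of points witnessing the failure of uniform continuity. It cannot lie
    inside the disc, where continuity of [g] at [zeta] would make the oscillation small. *)
Lemma not_uc_boundary (g : C -> C) : HD g -> ~ uc_disc g -> exists (delta : R) (zeta : C),
  [/\ 0 < delta, rnorm zeta = 1 & forall eta, 0 < eta -> exists z w,
    [/\ rnorm z < 1, rnorm w < 1, rnorm (z - zeta) < eta, rnorm (z - w) < eta &
      delta <= rnorm (g z - g w)]].
Proof.
move=> gD nuc.
have [e e0 eP] : exists2 e : R, 0 < e & forall d : R, 0 < d -> exists zw : C * C,
    [/\ rnorm zw.1 < 1, rnorm zw.2 < 1, rnorm (zw.1 - zw.2) < d & e < rnorm (g zw.1 - g zw.2)].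
  apply: contrapT => H; apply: nuc => e e0; apply: contrapT => H'; apply: H; exists e => // d d0.
  apply: contrapT => H; apply: H'; exists d => // z w z1 w1 zw.
  by rewrite leNgt; apply/negP => h; apply: H; exists (z, w).
have nat0 n : 0 < (n.+1%:R : R)^-1 by rewrite invr_gt0 ltr0n.
have /choice[zw zwP] := fun n : nat => eP _ (nat0 n).
pose z n := (zw n).1; pose w n := (zw n).2.
have bz : bounded_seq z by exists 1 => n; have [/ltW] := zwP n.
pose zeta := ulim z.
have near eta : 0 < eta -> exists n, rnorm (z n - zeta) < eta /\ rnorm (z n - w n) < eta.
  move=> eta0; have [N _ NP] := near_infty_natSinv_lt (PosNum eta0).
  have [n nN nz] := ulim_frequently N bz eta0.
  exists n; split=> //; have [_ _ h _] := zwP n; apply: lt_trans h _; exact: NP.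
have zeta1 : rnorm zeta <= 1.
  rewrite -[zeta]subr0; apply: (ulim_le (N := 0%N)) => // n _.
  by rewrite subr0; have [/ltW] := zwP n.
exists e, zeta; split=> //; last first.
  move=> eta /near[n [n1 n2]]; exists (z n), (w n); have [h1 h2 _ h3] := zwP n.
  by split=> //; exact: ltW.
apply/eqP; rewrite eq_le zeta1 /= leNgt; apply/negP => z1.
have e3 : 0 < e / 2 by rewrite divr_gt0.
have [d d0 dP] := (ccontP g zeta).1 (HD_cont gD z1) _ e3.
have [|n [n1 n2]] := near (d / 2); first by rewrite divr_gt0.
have k1 := dP (z n) ltac:(lra).
have k2 := dP (w n).
have := rnormD (w n - z n) (z n - zeta); rewrite addrA subrK (rnormBC (w n) (z n)) => k3.
have {}k2 := k2 ltac:(lra).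
have := rnormD (g (z n) - g zeta) (g zeta - g (w n)); rewrite addrA subrK.
rewrite (rnormBC (g zeta)); have [_ _ _] := zwP n; rewrite -/(z n) -/(w n); lra.
Qed.

(** By partial integration the left-hand side is (p z - p w) g w - (T_p g z - T_p g w), each term
    being at most 2 G D |z - w|. *)
Lemma T_op_near_const (g p : C -> C) (z w : C) (G D rho : R) : HD g -> HD p -> rho < 1 ->
  rnorm z <= rho -> rnorm w <= rho -> (forall x, rnorm x <= rho -> rnorm (g x) <= G) ->
  (forall x, rnorm x <= rho -> rnorm (derive1 p x) <= D) ->
  rnorm (T_op g p z - T_op g p w - p z * (g z - g w)) <= 4 * (G * D) * rnorm (z - w).
Proof.
move=> gD pD rho1 zr wr GP DP.
have z1 : rnorm z < 1 by lra.
have w1 : rnorm w < 1 by lra.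
have L2 : rnorm (T_op p g z - T_op p g w) <= 2 * (G * D) * rnorm (z - w).
  apply: (T_op_lip pD gD rho1 _ zr wr) => x xr.
  by apply: ler_pM; [exact: rnorm_ge0|exact: rnorm_ge0|exact: GP|exact: DP].
have L3 : rnorm (p z - p w) <= 2 * D * rnorm (z - w).
  apply: (@cderiv_bound _ p (derive1 p) rho D _ _ rho1 _ (HD_derive1 pD) DP zr wr) => x xr.
  by apply: (HD_cderiv pD); exact: le_lt_trans rho1.
have parts x : rnorm x < 1 -> T_op g p x = p x * g x - p 0 * g 0 - T_op p g x.
  by move=> x1; rewrite -(T_op_parts gD pD x1) addrK.
rewrite (parts z z1) (parts w w1).
have -> : p z * g z - p 0 * g 0 - T_op p g z - (p w * g w - p 0 * g 0 - T_op p g w)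
    - p z * (g z - g w) = (p z - p w) * g w - (T_op p g z - T_op p g w).
  move: (T_op p g z) (T_op p g w) (p z) (p w) (g z) (g w) (p 0) (g 0) => *; ring.
apply: le_trans (rnormB _ _) _; rewrite rnormM.
have : rnorm (p z - p w) * rnorm (g w) <= 2 * D * rnorm (z - w) * G.
  by apply: ler_pM => //; [exact: rnorm_ge0|exact: rnorm_ge0|exact: GP].
lra.
Qed.

Lemma gliding_hump (g : C -> C) : HD g -> bounded_disc g -> ~ uc_disc g ->
  exists (delta : R) (z w : nat -> C), [/\ 0 < delta,
    forall n, rnorm (z n) < 1 /\ rnorm (w n) < 1,
    forall n, delta <= rnorm (g (z n) - g (w n)) &
    forall eps : nat -> bool, exists2 h, Hinf h & forall n,
      rnorm (T_op g h (z n) - T_op g h (w n) - (eps n)%:R * (g (z n) - g (w n)))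
        <= rnorm (g (z n) - g (w n)) / 4].
Proof.
move=> gD [G G0 GP] nuc.
have [delta [zeta [delta0 zeta1 zetaP]]] := not_uc_boundary gD nuc.
have zeta_neq0 : zeta != 0 by rewrite -rnorm_gt0 zeta1.
pose a := zeta^-1.
have a1 : rnorm a = 1 by rewrite rnormV zeta1 invr1.
have uE z : rnorm (polar a z) = rnorm (z - zeta).
  have -> : polar a z = - (a * (z - zeta)) by rewrite /polar /a; field.
  by rewrite rnormN rnormM a1 mul1r.
have G1 : 0 < 1 + G by lra.
(* [p] packs a pair of points and the next scale. The errors from the head, the partial integration
   and the tail each get 1/16 of the oscillation, which totals less than 1/4. *)
pose P (s : R) (p : (C * C) * R) := [/\ rnorm p.1.1 < 1 /\ rnorm p.1.2 < 1,
  5 * (rnorm (polar a p.1.1) / s) <= 1 / 16,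
  4 * (4 / s) * (1 + G) * rnorm (p.1.1 - p.1.2) <= delta / 16,
  delta <= rnorm (g p.1.1 - g p.1.2) &
  0 < p.2 <= s / 2 /\ exists rho B : R, [/\ rho < 1 /\ 0 <= B, rnorm p.1.1 <= rho,
    rnorm p.1.2 <= rho, forall x, rnorm x <= rho -> rnorm (derive1 g x) <= B &
    4 * (5 * (p.2 / (1 - rho)) * B) <= delta / 16]].
have step s : 0 < s -> exists p, P s p.
  (* The first term makes 5 |u| / s at most 1/16; the second absorbs the head's derivative bound 4 /
     s in the partial integration error. *)
  move=> s0; pose eta := Num.min (s / 80) (s * delta / (16 * 16 * (1 + G))).
  have eta0 : 0 < eta by rewrite lt_min !divr_gt0 ?mulr_gt0.
  have [z [w [z1 w1 zz zw dP]]] := zetaP eta eta0.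
  pose rho := Num.max (rnorm z) (rnorm w).
  have rho1 : rho < 1 by rewrite gt_max z1.
  have rho0 : 0 <= rho by rewrite le_max rnorm_ge0.
  have [|B B0 BP] := @HD_bounded _ _ rho (HD_derive1 gD); first by rewrite rho0.
  have B1 : 0 < 1 + B by lra.
  (* On |x| <= rho one has |u| >= 1 - rho, so this next scale makes the tail's contribution 20 s' B
     / (1 - rho) at most delta / 16. *)
  pose s' := Num.min (s / 2) (delta * (1 - rho) / (16 * 20 * (1 + B))).
  exists ((z, w), s'); split => //=.
  - rewrite uE; have : rnorm (z - zeta) <= s / 80.
      by apply/ltW; apply: lt_le_trans zz _; rewrite ge_min lexx.
    by move=> h; rewrite mulrA ler_pdivrMr//; lra.
  - have : rnorm (z - w) <= s * delta / (16 * 16 * (1 + G)).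
      by apply/ltW; apply: lt_le_trans zw _; rewrite ge_min lexx orbT.
    rewrite ler_pdivlMr ?mulr_gt0// => h.
    have -> : 4 * (4 / s) * (1 + G) * rnorm (z - w) =
      rnorm (z - w) * (16 * 16 * (1 + G)) / (16 * s) by field; rewrite gt_eqF.
    by rewrite ler_pdivrMr ?mulr_gt0//; lra.
  - have s'0 : 0 < s' by rewrite lt_min !divr_gt0 ?mulr_gt0 ?subr_gt0.
    split; first by rewrite s'0 ge_min lexx.
    exists rho, B; split=> //; [by rewrite le_max lexx|by rewrite le_max lexx orbT|].
    have : s' <= delta * (1 - rho) / (16 * 20 * (1 + B)) by rewrite ge_min lexx orbT.
    rewrite ler_pdivlMr ?mulr_gt0// => h.
    have -> : 4 * (5 * (s' / (1 - rho)) * B) = 20 * s' * B / (1 - rho).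
      by field; rewrite subr_eq0 eq_sym lt_eqF.
    by rewrite ler_pdivrMr ?subr_gt0//; nra.
have /choice[F FP] : forall s : R, exists p, 0 < s -> P s p.
  move=> s; have [/step[p ?]|] := pselect (0 < s); first by exists p.
  by exists ((0, 0), 0).
pose s := fix s n := if n is n'.+1 then (F (s n')).2 else 1.
have s_gt0 n : 0 < s n by elim: n => [|n /FP[_ _ _ _ [/andP[]]]] //=.
have sP n : P (s n) (F (s n)) by exact: FP.
have s_half n : s n.+1 <= s n / 2 by have [_ _ _ _ [/andP[]]] := sP n.
pose z n := (F (s n)).1.1; pose w n := (F (s n)).1.2.
exists delta, z, w; split=> // [n|n|eps]; try by have [] := sP n.
pose h := hump_series a s eps.
exists h; first by apply: hump_series_Hinf.
move=> n; have [[z1 w1] u1 u2 d1 [s1 [rho [B [[rho1 B0] zr wr BP sB]]]]] := sP n.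
rewrite -/(z n) -/(w n) in z1 w1 u1 u2 d1 zr wr *.
set d := g (z n) - g (w n) in d1 *.
pose p := hump_head a s eps n; pose p' := hump_head' a s eps n.
have pD : HD p by apply: hump_head_HD.
have hD : HD h by apply: hump_series_HD.
have dp x : rnorm x < 1 -> derive1 p x = p' x.
  move=> x1; apply: is_cderiv_derive1.
  exact: hump_head_cderiv.
have p'P x : rnorm x < 1 -> rnorm (derive1 p x) <= 4 / s n.
  by move=> x1; rewrite dp//; exact: hump_head'_le.
have pz : rnorm (p (z n) - (eps n)%:R) <= 1 / 16.
  by apply: le_trans u1; apply: hump_head_near.
have tail x : rnorm x <= rho -> rnorm (h x - p x) <= 5 * (s n.+1 / (1 - rho)).
  move=> xr; have x1 : rnorm x < 1 by lra.
  apply: (@le_trans _ _ (5 * (s n.+1 / rnorm (polar a x)))); first by apply: hump_tail.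
  rewrite ler_pM2l// ler_wpM2l ?(ltW (s_gt0 _))// lef_pV2 ?posrE; [|exact: polar_gt0|lra].
  exact: polar_ge.
have sn0 := s_gt0 n.
clear dp; clearbody p h.
have zw2 : rnorm (z n - w n) <= 2 by have := rnormB (z n) (w n); lra.
have zw0 := rnorm_ge0 (z n - w n).
have tailD : HD (fun x => -1 * p x + h x).
  move=> x xD; apply: derivableD; last exact: hD.
  by apply: derivableM; [exact: derivable_cst|exact: pD].
(* Head plus tail; the tail h - p is written in the shape required by [T_op_linear]. *)
have TE x : rnorm x < 1 ->
    T_op g h x = T_op g p x + T_op g (fun x => -1 * p x + h x) x.
  by move=> x1; rewrite (T_op_linear (-1) gD pD hD x1); ring.
have L1 : rnorm (T_op g (fun x => -1 * p x + h x) (z n) - T_op g (fun x => -1 * p x + h x) (w n))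
    <= delta / 16.
  apply: le_trans (@T_op_lip _ g _ rho (5 * (s n.+1 / (1 - rho)) * B) _ _ gD tailD rho1 _ zr wr) _.
    move=> x xr; rewrite ler_pM ?rnorm_ge0//; last exact: BP.
    by rewrite mulN1r addrC; exact: tail.
  set K := 5 * (s n.+1 / (1 - rho)) * B.
  have K0 : 0 <= K.
    rewrite /K !mulr_ge0// ?(ltW (s_gt0 _))// invr_ge0; lra.
  have : 4 * K <= delta / 16 by [].
  nra.
have L2 : rnorm (T_op g p (z n) - T_op g p (w n) - p (z n) * d) <=
    4 * (G * (4 / s n)) * rnorm (z n - w n).
  apply: (@T_op_near_const g p (z n) (w n) G (4 / s n) rho gD pD rho1 zr wr) => x xr.
    by apply: GP; exact: le_lt_trans rho1.
  by apply: p'P; exact: le_lt_trans rho1.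
rewrite (TE _ z1) (TE _ w1).
move: (T_op g p (z n)) (T_op g p (w n)) L1 L2 => A1 A2.
move: (T_op g _ (z n)) (T_op g _ (w n)) => B1 B2 L1 L2.
have -> : A1 + B1 - (A2 + B2) - (eps n)%:R * d =
    (B1 - B2) + (A1 - A2 - p (z n) * d) + (p (z n) - (eps n)%:R) * d.
  by move: (p (z n)) => ?; ring.
have t1 := rnormD ((B1 - B2) + (A1 - A2 - p (z n) * d)) ((p (z n) - (eps n)%:R) * d).
have t2 := rnormD (B1 - B2) (A1 - A2 - p (z n) * d).
rewrite [X in _ <= _ + X]rnormM in t1.
have d0 := rnorm_ge0 d.
have t4 : rnorm (p (z n) - (eps n)%:R) * rnorm d <= 1 / 16 * rnorm d by rewrite ler_wpM2r.
have t6 : 0 <= 4 / s n * rnorm (z n - w n) by rewrite mulr_ge0 ?rnorm_ge0// divr_ge0// ltW.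
move: u2 L2 t6; move: (4 / s n) => q u2 L2 t6; lra.
Qed.

End GlidingHump.

(** * Hahn-Banach and Mazur *)

Section HahnBanach.
Variables (R : realType) (V : lmodType (Cplx R)).
Local Notation C := (Cplx R).
Local Notation rC := (@real_to_Cplx R).
(* A subspace [D], because the continuous dual is a subset of [X -> C] and not a type. *)
Variable D : set V.
Hypotheses (D0 : D 0) (DD : forall x y, D x -> D y -> D (x + y))
  (DZ : forall (c : C) x, D x -> D (c *: x)).
Implicit Types (p q F N : V -> R) (x y : V).

Lemma subspaceN x : D x -> D (- x).
Proof. by move=> Dx; rewrite -scaleN1r; exact: DZ. Qed.

Definition sublinear p := (forall x y, D x -> D y -> p (x + y) <= p x + p y) /\
  (forall (t : R) x, 0 < t -> D x -> p (rC t *: x) <= t * p x).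

Lemma sublinear0 p : sublinear p -> p 0 = 0.
Proof.
move=> [pD pZ]; have := pD 0 0 D0 D0; rewrite addr0.
have := pZ 2^-1 0 ltac:(rewrite invr_gt0; lra) D0; rewrite scaler0; lra.
Qed.

Lemma sublinear_ge p x : sublinear p -> D x -> - p (- x) <= p x.
Proof.
move=> ps Dx; have := ps.1 x (- x) Dx (subspaceN Dx); rewrite subrr (sublinear0 ps); lra.
Qed.

Lemma inf_le_mem (A : set R) (m a : R) : (forall b, A b -> m <= b) -> A a -> inf A <= a.
Proof. by move=> mA Aa; apply: ge_inf => //; exists m. Qed.

Lemma inf_approx (A : set R) (m e : R) : (forall b, A b -> m <= b) -> (exists a, A a) ->
  0 < e -> exists2 a, A a & a < inf A + e.
Proof. by move=> mA A0 e0; apply: inf_adherent => //; split=> //; exists m. Qed.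

(** The value 0 outside [D] makes functions that agree on [D] equal, which gives the antisymmetry
    that [Zorn] requires. *)
Record sublinear_below p := SublinearBelow {
  sb_fun :> V -> R;
  sb_sub : sublinear sb_fun;
  sb_le : forall x, D x -> sb_fun x <= p x;
  sb_out : forall x, ~ D x -> sb_fun x = 0 }.

Lemma sublinear_belowE p (q r : sublinear_below p) : (q : V -> R) = r -> q = r.
Proof.
case: q r => [q a b c] [r a' b' c'] /= E; subst r.
by rewrite (Prop_irrelevance a a') (Prop_irrelevance b b') (Prop_irrelevance c c').
Qed.

Lemma sublinear_cut p q : sublinear q -> (forall x, D x -> q x <= p x) ->
  exists r : sublinear_below p, forall x, D x -> r x = q x.
Proof.
move=> [qD qZ] qp; pose r x := if `[<D x>] then q x else 0.
have rE x : D x -> r x = q x by move=> Dx; rewrite /r asboolT.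
have rs : sublinear r.
  split=> [x y Dx Dy|t x t0 Dx]; rewrite !rE//; [exact: qD|exact: DD|exact: qZ|exact: DZ].
have rp x : D x -> r x <= p x by move=> Dx; rewrite rE//; exact: qp.
have r0 x : ~ D x -> r x = 0 by move=> Dx; rewrite /r asboolF.
by exists (SublinearBelow rs rp r0).
Qed.

(** A chain is bounded by its pointwise infimum, which is finite because every member is at least
    -p(-x). *)
Lemma minimal_sublinear p : sublinear p -> exists q : sublinear_below p,
  forall r, sublinear r -> (forall x, D x -> r x <= q x) -> forall x, D x -> r x = q x.
Proof.
move=> ps.
have [||||q qmin] := @Zorn (sublinear_below p)
  (fun q r : sublinear_below p => `[<forall x, D x -> r x <= q x>]).
- by move=> q; apply/asboolP.
- move=> q r s /asboolP rq /asboolP qs; apply/asboolP => x Dx.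
  exact: le_trans (qs x Dx) (rq x Dx).
- move=> q r /asboolP rq /asboolP qr; apply: sublinear_belowE; apply/funext => x.
  have [Dx|nDx] := pselect (D x); first by apply/eqP; rewrite eq_le qr// rq.
  by rewrite !sb_out.
- move=> A Atot.
  have [[a0 Aa0]|A0] := pselect (exists a, A a); last first.
    have [r rE] := sublinear_cut ps (fun x _ => lexx (p x)).
    by exists r => s As; exfalso; apply: A0; exists s.
  pose S x := [set (s : sublinear_below p) x | s in A].
  have Slb x : D x -> forall b, S x b -> - p (- x) <= b.
    move=> Dx _ [s _ <-]; apply: le_trans (sublinear_ge (sb_sub s) Dx).
    by rewrite lerN2; apply: sb_le; exact: subspaceN.
  have S0 x : exists a, S x a by exists (a0 x), a0.
  pose q x := inf (S x).
  have qle x s : D x -> A s -> q x <= s x.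
    by move=> Dx As; apply: (inf_le_mem (Slb x Dx)); exists s.
  have qs : sublinear q.
    split=> [x y Dx Dy|t x t0 Dx].
      apply/ler_addgt0Pl => e e0; have e2 : 0 < e / 2 by rewrite divr_gt0.
      have [_ [s1 As1 <-] h1] := inf_approx (Slb x Dx) (S0 x) e2.
      have [_ [s2 As2 <-] h2] := inf_approx (Slb y Dy) (S0 y) e2.
      (* Totality of the chain: the smaller of [s1] and [s2] serves both points. *)
      have [s [As sx sy]] : exists s, [/\ A s, s x <= s1 x & s y <= s2 y].
        have [/asboolP h|/asboolP h] := Atot _ _ As1 As2; [exists s2|exists s1].
          by split=> //; exact: h.
        by split=> //; exact: h.
      have := qle _ s (DD Dx Dy) As; have := (sb_sub s).1 x y Dx Dy; lra.
    rewrite mulrC -ler_pdivrMr//; apply: lb_le_inf; first exact: S0.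
    move=> _ [s As <-]; rewrite ler_pdivrMr// mulrC.
    apply: le_trans (qle _ s (DZ _ Dx) As) _; exact: (sb_sub s).2.
  have [r rE] := sublinear_cut qs (fun x Dx => le_trans (qle x a0 Dx Aa0) (sb_le a0 Dx)).
  by exists r => s As; apply/asboolP => x Dx; rewrite rE//; exact: qle.
exists q => r rs rq x Dx.
have [r' r'E] := sublinear_cut rs (fun x Dx => le_trans (rq x Dx) (sb_le q Dx)).
have -> : q = r' :> (V -> R).
  by rewrite (qmin r')//; apply/asboolP => y Dy; rewrite r'E//; exact: rq.
by rewrite r'E.
Qed.

Definition real_linear F := (forall x y, D x -> D y -> F (x + y) = F x + F y) /\
  (forall (t : R) x, D x -> F (rC t *: x) = t * F x).

(* If [q] is minimal, then [inf_(t >= 0) (q (x + t y) - t q y)] is sublinear and below [q],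
   hence equal to [q], and [t = 1] gives additivity. *)
Lemma hahn_banach p : sublinear p ->
  exists2 F, real_linear F & forall x, D x -> F x <= p x.
Proof.
move=> /minimal_sublinear[q qmin]; exists q; last exact: sb_le.
have qs := sb_sub q.
have add x y : D x -> D y -> q (x + y) = q x + q y.
  move=> Dx Dy; apply/eqP; rewrite eq_le qs.1//=.
  pose S x := [set q (x + rC t *: y) - t * q y | t in [set t : R | 0 <= t]].
  have Slb z : D z -> forall b, S z b -> - q (- z) <= b.
    move=> Dz _ [t /= t0 <-].
    have [->|t_neq0] := eqVneq t 0.
      by rewrite rC0 scale0r addr0 mul0r subr0; exact: sublinear_ge.
    have {t_neq0}t0 : 0 < t by rewrite lt_neqAle eq_sym t_neq0.
    have Dty : D (rC t *: y) by exact: DZ.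
    have h1 := qs.1 (z + rC t *: y) (- z) (DD Dz Dty) (subspaceN Dz).
    rewrite addrAC subrr add0r in h1.
    have tV : 0 < t^-1 by rewrite invr_gt0.
    have := qs.2 t^-1 _ tV Dty; rewrite scalerA -rCM mulVf ?gt_eqF// rC1 scale1r.
    by rewrite mulrC ler_pdivlMr// mulrC; lra.
  have S0 z : exists a, S z a by exists (q (z + rC 0 *: y) - 0 * q y), 0 => //=.
  pose r z := inf (S z).
  have rle z t : D z -> 0 <= t -> r z <= q (z + rC t *: y) - t * q y.
    by move=> Dz t0; apply: (inf_le_mem (Slb z Dz)); exists t.
  have rs : sublinear r.
    split=> [z1 z2 Dz1 Dz2|t z t0 Dz].
      apply/ler_addgt0Pl => e e0; have e2 : 0 < e / 2 by rewrite divr_gt0.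
      have [_ [t1 /= t10 <-] h1] := inf_approx (Slb z1 Dz1) (S0 z1) e2.
      have [_ [t2 /= t20 <-] h2] := inf_approx (Slb z2 Dz2) (S0 z2) e2.
      have h3 := rle _ (t1 + t2) (DD Dz1 Dz2) (addr_ge0 t10 t20).
      have := qs.1 (z1 + rC t1 *: y) (z2 + rC t2 *: y) (DD Dz1 (DZ _ Dy)) (DD Dz2 (DZ _ Dy)).
      rewrite addrACA -scalerDl -rCD; lra.
    rewrite mulrC -ler_pdivrMr//; apply: lb_le_inf; first exact: S0.
    move=> _ [s /= s0 <-]; rewrite ler_pdivrMr// mulrC.
    apply: le_trans (rle _ (t * s) (DZ _ Dz) (mulr_ge0 (ltW t0) s0)) _.
    have := qs.2 t _ t0 (DD Dz (DZ (rC s) Dy)); rewrite scalerDr scalerA -rCM; lra.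
  have rq z : D z -> r z <= q z.
    by move=> Dz; have := rle z 0 Dz (lexx 0); rewrite rC0 scale0r addr0 mul0r subr0.
  have := rle x 1 Dx ler01; rewrite (qmin r rs rq x Dx) rC1 scale1r; lra.
have opp x : D x -> q (- x) = - q x.
  by move=> Dx; have := add x (- x) Dx (subspaceN Dx); rewrite subrr (sublinear0 qs); lra.
have pos t x : 0 < t -> D x -> q (rC t *: x) = t * q x.
  move=> t0 Dx; apply/eqP; rewrite eq_le qs.2//=.
  have tV : 0 < t^-1 by rewrite invr_gt0.
  have := qs.2 t^-1 _ tV (DZ (rC t) Dx); rewrite scalerA -rCM mulVf ?gt_eqF// rC1 scale1r.
  by rewrite mulrC ler_pdivlMr// mulrC.
split=> // t x Dx; have [t0|t0|->] := ltgtP t 0; last 2 first.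
- exact: pos.
- by rewrite rC0 scale0r mul0r (sublinear0 qs).
have -> : t = - - t by rewrite opprK.
by rewrite rCN scaleNr opp ?pos ?oppr_gt0 ?mulNr//; exact: DZ.
Qed.

(** Nonnegative combinations carried together with their total weight: the homogeneous form of
    convex combinations, stable under sums and scaling without renormalization. *)
Inductive cone (u : nat -> V) (I : set nat) : R -> V -> Prop :=
| cone0 : cone u I 0 0
| coneS T k n t : cone u I T k -> I n -> 0 <= t -> cone u I (T + t) (k + rC t *: u n).

Lemma cone_ge0 u I T k : cone u I T k -> 0 <= T.
Proof. by elim=> // {}T {}k n t _ T0 _ t0; rewrite addr_ge0. Qed.

Lemma cone_D u I T k : (forall n, D (u n)) -> cone u I T k -> D k.
Proof. by move=> uD; elim=> // {}T {}k n t _ Dk _ _; apply: DD => //; exact: DZ. Qed.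

Lemma coneD u I T k T' k' : cone u I T k -> cone u I T' k' -> cone u I (T + T') (k + k').
Proof.
by move=> ck; elim=> [|{}T' {}k' n t _ IH In t0]; rewrite ?addr0// !addrA; exact: coneS.
Qed.

Lemma coneZ u I T k (s : R) : 0 <= s -> cone u I T k -> cone u I (s * T) (rC s *: k).
Proof.
move=> s0; elim=> [|{}T {}k n t _ IH In t0]; first by rewrite mulr0 scaler0; exact: cone0.
by rewrite mulrDr scalerDr scalerA -rCM; apply: coneS => //; exact: mulr_ge0.
Qed.

Lemma cone_sub u I J T k : I `<=` J -> cone u I T k -> cone u J T k.
Proof.
by move=> IJ; elim=> [|{}T {}k n t _ IH In t0]; [exact: cone0|apply: coneS => //; exact: IJ].
Qed.

Lemma cone_finite u I T k : cone u I T k ->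
  exists m : nat, cone u (I `&` [set n | (n < m)%N]) T k.
Proof.
elim=> [|{}T {}k n t _ [m IH] In t0]; first by exists 0%N; exact: cone0.
exists (maxn m n.+1); apply: coneS => //.
  by apply: cone_sub IH => i [Ii /= im]; split=> //=; apply: leq_trans im _; exact: leq_maxl.
by split=> //=; exact: leq_maxr.
Qed.

Variable N : V -> R.
Hypotheses (N_ge0 : forall x, D x -> 0 <= N x)
  (N_D : forall x y, D x -> D y -> N (x + y) <= N x + N y)
  (N_Z : forall (c : C) x, D x -> N (c *: x) <= rnorm c * N x).

Lemma seminormN x : D x -> N (- x) <= N x.
Proof.
by move=> Dx; rewrite -scaleN1r; apply: le_trans (N_Z _ Dx) _; rewrite rnormN rnorm1 mul1r.
Qed.

(* Dividing [cone u I T k] by [T] gives a convex combination of the [u n]; the functional is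
   obtained from the sublinear [p v := inf (N (v + k) - d T)] over the cone. *)
Lemma mazur (u : nat -> V) (I : set nat) (d : R) : (forall n, D (u n)) ->
  (forall F, real_linear F -> (forall x, D x -> F x <= N x) -> exists2 n, I n & F (u n) < d) ->
  exists T k, cone u I T k /\ N k < d * T.
Proof.
move=> uD H; apply: contrapT => nex.
have Nk T k : cone u I T k -> d * T <= N k.
  by move=> ck; rewrite leNgt; apply/negP => h; apply: nex; exists T, k.
pose S v := [set b | exists T k, cone u I T k /\ b = N (v + k) - d * T].
have Slb v : D v -> forall b, S v b -> - N v <= b.
  move=> Dv _ [T [k [ck ->]]]; have Dk := cone_D uD ck.
  have := N_D (DD Dv Dk) (subspaceN Dv); rewrite addrAC subrr add0r.
  by have := Nk _ _ ck; have := seminormN Dv; lra.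
have S0 v : exists a, S v a by exists (N (v + 0) - d * 0), 0, 0; split=> //; exact: cone0.
pose p v := inf (S v).
have ple v T k : D v -> cone u I T k -> p v <= N (v + k) - d * T.
  by move=> Dv ck; apply: (inf_le_mem (Slb v Dv)); exists T, k.
have ps : sublinear p.
  split=> [z1 z2 Dz1 Dz2|t z t0 Dz].
    apply/ler_addgt0Pl => e e0; have e2 : 0 < e / 2 by rewrite divr_gt0.
    have [_ [T1 [k1 [c1 ->]]] h1] := inf_approx (Slb z1 Dz1) (S0 z1) e2.
    have [_ [T2 [k2 [c2 ->]]] h2] := inf_approx (Slb z2 Dz2) (S0 z2) e2.
    have h3 := ple _ _ _ (DD Dz1 Dz2) (coneD c1 c2).
    have := N_D (DD Dz1 (cone_D uD c1)) (DD Dz2 (cone_D uD c2)).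
    rewrite addrACA; lra.
  rewrite mulrC -ler_pdivrMr//; apply: lb_le_inf; first exact: S0.
  move=> _ [T [k [ck ->]]]; rewrite ler_pdivrMr// mulrC.
  apply: le_trans (ple _ _ _ (DZ _ Dz) (coneZ (ltW t0) ck)) _.
  have := N_Z (rC t) (DD Dz (cone_D uD ck)).
  rewrite scalerDr rnorm_real gtr0_norm//; lra.
have [F Fl Fp] := hahn_banach ps.
have FN x : D x -> F x <= N x.
  move=> Dx; apply: le_trans (Fp x Dx) _; have := ple x 0 0 Dx (cone0 _ _).
  by rewrite addr0 mulr0 subr0.
have [n In Fn] := H F Fl FN.
(* Testing [p] at - u n against the cone element u n of weight 1 gives F (- u n) <= N 0 - d, hence F
   (u n) >= d. *)
have := Fp _ (subspaceN (uD n)); have := ple _ _ _ (subspaceN (uD n)) (coneS (cone0 u I) In ler01).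
have -> : N (- u n + (0 + rC 1 *: u n)) = N 0 by rewrite rC1 scale1r add0r addNr.
have N0 : N 0 <= 0.
  by have := N_Z 0 D0; rewrite scale0r rnorm0 mul0r.
have -> : F (- u n) = - F (u n).
  by have := Fl.2 (-1) _ (uD n); rewrite rCN rC1 scaleN1r mulN1r.
rewrite add0r mulr1; lra.
Qed.

(** The complex-linear functional with real part [F], needed because the dual and the bidual are
    complex. *)
Definition complexify F (v : V) : C := rC (F v) - 'i%C * rC (F (('i%C : C) *: v)).

Lemma complexify_Re F v : complex.Re (complexify F v) = F v.
Proof. by rewrite /complexify cReD cReN cReM /= mul0r mulr0 subr0 oppr0 addr0. Qed.

Lemma i_sqr : ('i%C : C) * 'i%C = -1.
Proof. exact: sqr_i. Qed.

Lemma complexify_linear F : real_linear F -> forall (c : C) x y, D x -> D y ->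
  complexify F (c *: x + y) = c * complexify F x + complexify F y.
Proof.
move=> [FD FZ] c x y Dx Dy.
have FC (b : C) v : D v -> F (b *: v) = complex.Re b * F v + complex.Im b * F (('i%C : C) *: v).
  move=> Dv; rewrite {1}(complex_split b) scalerDl FD ?FZ//; try exact: DZ.
  by rewrite (mulrC ('i%C : C)) -scalerA FZ//; exact: DZ.
rewrite /complexify scalerDr !FD; try by do ?[exact: DZ|apply: DZ].
rewrite scalerA (FC c x Dx) (FC ('i%C * c) x Dx) cReM cImM.
have -> : complex.Re ('i%C : C) = 0 by [].
have -> : complex.Im ('i%C : C) = 1 by [].
rewrite !mul0r !mul1r sub0r add0r [X in _ = X * _ + _](complex_split c).
move: (complex.Re c) (complex.Im c) (F x) (F (_ *: x)) (F y) (F (_ *: y)).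
move=> a b f1 f2 f3 f4; rewrite !(rCD, rCM, rCB, rCN).
have := i_sqr; move: ('i%C : C) => j jj.
have E : j * j * rC b * rC f2 = - (rC b * rC f2) by rewrite jj; ring.
apply/eqP; rewrite -subr_eq0; apply/eqP.
transitivity (rC b * rC f2 + j * j * rC b * rC f2); [ring|by rewrite E subrr].
Qed.

Lemma complexify_le F : real_linear F -> (forall x, D x -> F x <= N x) ->
  forall x, D x -> rnorm (complexify F x) <= 2 * N x.
Proof.
move=> [FD FZ] FN.
have aF x : D x -> `|F x| <= N x.
  move=> Dx; rewrite ler_norml FN// andbT.
  have := FN _ (subspaceN Dx); have := FZ (-1) x Dx; rewrite rCN rC1 scaleN1r mulN1r => ->.
  by have := seminormN Dx; lra.
move=> x Dx; apply: le_trans (rnormB _ _) _; rewrite rnormM rnormi mul1r !rnorm_real.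
have := aF x Dx; have := aF _ (DZ 'i%C Dx); have := N_Z 'i%C Dx; rewrite rnormi mul1r; lra.
Qed.

End HahnBanach.

(** * Duality and reflexivity *)

Section Duality.
Variables (R : realType) (X : normedModType (Cplx R)).
Local Notation C := (Cplx R).
Local Notation rC := (@real_to_Cplx R).
Implicit Types (phi psi : X -> C) (x y : X).

Lemma scalar0 phi : scalar phi -> phi 0 = 0.
Proof.
move=> ps; have := ps 1 0 0; rewrite scale1r addr0.
by move=> /eqP; rewrite -subr_eq mul1r subrr eq_sym => /eqP.
Qed.

Lemma scalarZ phi (c : C) x : scalar phi -> phi (c *: x) = c * phi x.
Proof. by move=> ps; have := ps c x 0; rewrite addr0 (scalar0 ps) addr0. Qed.

Lemma scalarB phi x y : scalar phi -> phi (x - y) = phi x - phi y.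
Proof.
move=> ps; have := ps (-1) y x; rewrite scaleN1r (addrC (- y)) => ->.
by rewrite [_ * phi y]mulN1r addrC.
Qed.

Lemma bounded_dual phi (K : R) : scalar phi -> (forall x, rnorm (phi x) <= K * rnorm x) ->
  continuous_dual phi.
Proof.
move=> ps phiK; split=> // x; apply/(@cvgrPdist_le _ C) => _ /Cplx_gt0[e e0 ->].
have K0 : 0 < 1 + `|K| by rewrite ltr_pwDl.
apply/nbhs_ballP; exists (rC (e / (1 + `|K|))) => /=.
  by rewrite -rC0 real_to_Cplx_lt divr_gt0.
move=> y; rewrite -ball_normE /= !rnormE real_to_Cplx_lt real_to_Cplx_le ltr_pdivlMr// => xy.
rewrite -scalarB//; apply: le_trans (phiK _) _.
have := rnorm_ge0 (x - y); have := ler_norm K; nra.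
Qed.

Lemma dual_bounded phi : continuous_dual phi ->
  exists2 K : R, 0 <= K & forall x, rnorm (phi x) <= K * rnorm x.
Proof.
move=> [ps pc]; have p0 := scalar0 ps.
have := pc 0 => /(@cvgrPdist_le _ C) /(_ 1 ltr01).
rewrite p0 => /nbhs_ballP[_ /= /Cplx_gt0[d d0 ->] dP].
exists (2 / d) => [|x]; first by rewrite divr_ge0 ?ltW.
have [->|x0] := eqVneq x 0; first by rewrite p0 !rnorm0 mulr0.
have nx : 0 < rnorm x by rewrite rnorm_gt0.
pose c := d / 2 / rnorm x.
have c0 : 0 < c by rewrite !divr_gt0.
have := dP (rC c *: x); rewrite -ball_normE /= !sub0r !normrN !rnormE real_to_Cplx_lt.
rewrite rnormZ rnorm_real gtr0_norm// => H.
have cx : c * rnorm x < d by rewrite /c divfK ?gt_eqF//; lra.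
have := H cx; rewrite -rC1 real_to_Cplx_le scalarZ// rnormM rnorm_real gtr0_norm// => h.
have -> : 2 / d * rnorm x = c^-1.
  by rewrite /c; field; rewrite !gt_eqF.
by rewrite -[leRHS]mul1r ler_pdivlMr// mulrC.
Qed.

Lemma dual_norm_ub phi : continuous_dual phi ->
  has_ubound [set rnorm (phi x) | x in [set x | rnorm x <= 1]].
Proof.
move=> /dual_bounded[K K0 KP]; exists K => _ [x /= x1 <-].
by apply: le_trans (KP x) _; rewrite ler_piMr.
Qed.

Lemma dual_norm_bound phi (K : R) : (forall x, rnorm x <= 1 -> rnorm (phi x) <= K) ->
  dual_norm phi <= K.
Proof.
move=> H; apply: ge_sup; last by move=> _ [x /= x1 <-]; exact: H.
by exists (rnorm (phi 0)), 0 => //=; rewrite rnorm0.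
Qed.

Lemma dual_norm_ge0 phi : continuous_dual phi -> 0 <= dual_norm phi.
Proof.
move=> pc; apply: le_trans (rnorm_ge0 (phi 0)) _.
by apply: ub_le_sup; [exact: dual_norm_ub|exists 0 => //=; rewrite rnorm0].
Qed.

Lemma dual_norm_le phi x : continuous_dual phi -> rnorm (phi x) <= dual_norm phi * rnorm x.
Proof.
move=> pc; have [->|x0] := eqVneq x 0.
  by rewrite (scalar0 pc.1) !rnorm0 mulr0.
have nx : 0 < rnorm x by rewrite rnorm_gt0.
have cx : 0 < (rnorm x)^-1 by rewrite invr_gt0.
rewrite -ler_pdivrMr// mulrC.
have -> : (rnorm x)^-1 * rnorm (phi x) = rnorm (phi (rC (rnorm x)^-1 *: x)).
  by rewrite (scalarZ _ _ pc.1) rnormM rnorm_real gtr0_norm.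
apply: ub_le_sup; first exact: dual_norm_ub.
exists (rC (rnorm x)^-1 *: x) => //=.
by rewrite rnormZ rnorm_real gtr0_norm// mulVf ?gt_eqF.
Qed.

(** In a reflexive space this yields a weak limit of any bounded sequence along the ultrafilter. *)
Lemma bidual_ulim (x : nat -> X) (K : R) : (forall n, rnorm (x n) <= K) ->
  bidual (fun phi => ulim (fun n => phi (x n))).
Proof.
move=> xK; have bd phi : continuous_dual phi -> forall n, rnorm (phi (x n)) <= K * dual_norm phi.
  move=> pc n; apply: le_trans (dual_norm_le _ pc) _.
  by rewrite mulrC ler_wpM2r ?dual_norm_ge0.
have bs phi : continuous_dual phi -> bounded_seq (fun n => phi (x n)).
  by move=> pc; exists (K * dual_norm phi); exact: bd.
split=> [a phi psi pc qc|]; first exact: (ulim_linear a (bs _ pc) (bs _ qc)).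
exists K => phi pc; rewrite -[ulim _]subr0; apply: (ulim_le (N := 0%N)); first exact: bs.
by move=> n _; rewrite subr0; exact: bd.
Qed.

(** Otherwise [mazur] yields a real functional that is at least d on all y n - x, and its
    complexification contradicts weak convergence to x. *)
Lemma weak_limit_hull (y : nat -> X) (x : X) (d : R) : 0 < d ->
  (forall phi, continuous_dual phi ->
     bounded_seq (fun n => phi (y n)) /\ ulim (fun n => phi (y n)) = phi x) ->
  exists T k, cone (fun n => y n - x) setT T k /\ rnorm k < d * T.
Proof.
move=> d0 wl.
have ND (v w : X) : setT v -> setT w -> rnorm (v + w) <= rnorm v + rnorm w.
  by move=> _ _; exact: rnormD.
have NZ (c : C) (v : X) : setT v -> rnorm (c *: v) <= rnorm c * rnorm v.
  by move=> _; rewrite rnormZ.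
apply: (mazur (D := setT) _ _ _ ND NZ) => // F Fl FN.
apply: contrapT => H.
have Fd n : d <= F (y n - x) by rewrite leNgt; apply/negP => h; apply: H; exists n.
have phiD : continuous_dual (complexify F).
  apply: (@bounded_dual _ 2).
    by move=> c v w; apply: (complexify_linear (D := setT)).
  by move=> v; apply: (complexify_le (D := setT) _ NZ).
have [bs ul] := wl _ phiD.
have := @ulim_Re_ge _ _ (d + F x) 0 bs; rewrite ul complexify_Re => H1.
suff : d + F x <= F x by lra.
apply: H1 => n _; rewrite complexify_Re; have := Fd n.
have := Fl.1 (y n - x) x I I; rewrite subrK; lra.
Qed.

Let W : lmodType C := (X -> (C : lmodType C)).
Let Wdual : set W := @continuous_dual R X.

Lemma dual_zero : Wdual 0.
Proof.
apply: (@bounded_dual _ 0) => [c x y|x]; first by rewrite /= mulr0 addr0.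
by rewrite rnorm0 mul0r.
Qed.

Lemma dual_add (phi psi : W) : Wdual phi -> Wdual psi -> Wdual (phi + psi).
Proof.
move=> pc qc; have [K K0 KP] := dual_bounded pc; have [L L0 LP] := dual_bounded qc.
apply: (@bounded_dual _ (K + L)) => [c x y|x].
  change (phi (c *: x + y) + psi (c *: x + y) = c * (phi x + psi x) + (phi y + psi y)).
  by rewrite (pc.1 c x y) (qc.1 c x y) mulrDr addrACA.
by apply: le_trans (rnormD (phi x) (psi x)) _; rewrite mulrDl lerD.
Qed.

Lemma dual_scale (c : C) (phi : W) : Wdual phi -> Wdual (c *: phi).
Proof.
move=> pc; have [K K0 KP] := dual_bounded pc.
apply: (@bounded_dual _ (rnorm c * K)) => [b x y|x].
  change (c * phi (b *: x + y) = b * (c * phi x) + c * phi y).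
  by rewrite (pc.1 b x y) mulrDr mulrCA.
change (rnorm (c * phi x) <= rnorm c * K * rnorm x).
by rewrite rnormM -mulrA ler_wpM2l ?rnorm_ge0.
Qed.

Lemma dual_normD (phi psi : W) : Wdual phi -> Wdual psi ->
  dual_norm (phi + psi) <= dual_norm phi + dual_norm psi.
Proof.
move=> pc qc; apply: dual_norm_bound => x x1.
apply: le_trans (rnormD (phi x) (psi x)) _.
have := dual_norm_le x pc; have := dual_norm_le x qc.
by have := dual_norm_ge0 pc; have := dual_norm_ge0 qc; nra.
Qed.

Lemma dual_normZ (c : C) (phi : W) : Wdual phi -> dual_norm (c *: phi) <= rnorm c * dual_norm phi.
Proof.
move=> pc; apply: dual_norm_bound => x x1.
change (rnorm (c * phi x) <= rnorm c * dual_norm phi); rewrite rnormM ler_wpM2l ?rnorm_ge0//.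
have := dual_norm_le x pc; have := dual_norm_ge0 pc; nra.
Qed.

Section ReflexiveMazur.
Hypothesis X_reflexive : reflexive_space X.
Variables (lam : nat -> X -> C) (K : R).
Hypotheses (lam_scalar : forall n, scalar (lam n))
  (lam_bound : forall n x, rnorm (lam n x) <= K * rnorm x).

Definition lam_lim (x : X) : C := ulim (fun n => lam n x).

Lemma lam_bounded_seq x : bounded_seq (fun n => lam n x).
Proof. by exists (K * rnorm x). Qed.

Lemma lam_dual n : continuous_dual (lam n).
Proof. exact: bounded_dual (lam_scalar n) (lam_bound n). Qed.

Lemma lam_lim_dual : continuous_dual lam_lim.
Proof.
apply: (@bounded_dual _ K) => [c x y|x].
  rewrite [RHS]/= /lam_lim -(ulim_linear c (lam_bounded_seq x) (lam_bounded_seq y)).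
  by congr ulim; apply/funext => n; exact: (lam_scalar n c x y).
rewrite -[lam_lim x]subr0; apply: (ulim_le (N := 0%N)); first exact: lam_bounded_seq.
by move=> n _; rewrite subr0.
Qed.

Let U (n : nat) : W := (lam n : W) - (lam_lim : W).

(** The pointwise limit [lam_lim] is only a weak-star limit. By reflexivity a separating functional
    on the dual is evaluation at some x, and the values of lam n at this x have ultralimit
    [lam_lim x], so no separation is possible. *)
Lemma lam_lim_hull (N : nat) (d : R) : 0 < d ->
  exists T k, cone U [set n | (N <= n)%N] T k /\ dual_norm k < d * T.
Proof.
move=> d0.
have UD n : Wdual (U n).
  apply: dual_add; first exact: lam_dual.
  by rewrite -scaleN1r; apply: dual_scale; exact: lam_lim_dual.
apply: (mazur dual_zero dual_add dual_scale dual_normD dual_normZ UD) => F Fl FN.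
apply: contrapT => H.
have Fd n : (N <= n)%N -> d <= F (U n).
  by move=> Nn; rewrite leNgt; apply/negP => h; apply: H; exists n.
have bi : @bidual R X (complexify F).
  split=> [c phi psi pc qc|]; first exact: (complexify_linear dual_scale Fl c pc qc).
  exists 2 => phi pc.
  exact: (complexify_le dual_scale dual_normZ Fl FN pc).
have [x xP] := X_reflexive bi.
have Re_x n : (N <= n)%N -> d + complex.Re (lam_lim x) <= complex.Re (lam n x).
  move=> /Fd; rewrite -(complexify_Re F (U n)) (xP _ (UD n)).
  have -> : U n x = lam n x - lam_lim x by [].
  by rewrite cReD cReN; lra.
have := ulim_Re_ge (lam_bounded_seq x) Re_x; rewrite -/(lam_lim x); lra.
Qed.

Lemma cone_eval (I : set nat) (T : R) (k : W) x : cone U I T k ->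
  (forall n, I n -> 3 / 4 <= complex.Re (lam n x)) ->
  (3 / 4 - complex.Re (lam_lim x)) * T <= complex.Re (k x).
Proof.
move=> ck H; elim: ck => [|{}T {}k n t _ IH In t0]; first by rewrite mulr0.
change ((3 / 4 - complex.Re (lam_lim x)) * (T + t) <=
  complex.Re (k x + rC t * (lam n x - lam_lim x))).
rewrite cReD cRe_rCM cReD cReN; have := H n In; nra.
Qed.

Lemma cone_eval_le (I : set nat) (T : R) (k : W) x : cone U I T k ->
  (forall n, I n -> complex.Re (lam n x) <= 1 / 4) ->
  complex.Re (k x) <= (1 / 4 - complex.Re (lam_lim x)) * T.
Proof.
move=> ck H; elim: ck => [|{}T {}k n t _ IH In t0]; first by rewrite mulr0.
change (complex.Re (k x + rC t * (lam n x - lam_lim x)) <=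
  (1 / 4 - complex.Re (lam_lim x)) * (T + t)).
rewrite cReD cRe_rCM cReD cReN; have := H n In; nra.
Qed.

(* Convex blocks of the [lam n] converge in norm to [lam_lim], so no vector takes values
   near 1 on the even blocks and near 0 on the odd ones. *)
Lemma reflexive_no_interpolation :
  ~ (forall eps : nat -> bool, exists x, forall n, rnorm (lam n x - (eps n)%:R) <= 1 / 4).
Proof.
move=> interp.
pose dd (j : nat) : R := j.+1%:R^-1.
have dd0 j : 0 < dd j by rewrite invr_gt0 ltr0n.
have blocks (Nj : nat * nat) : exists m : nat, exists T k,
    cone U [set n | (Nj.1 <= n < m)%N] T k /\ dual_norm k < dd Nj.2 * T.
  have [T [k [ck kT]]] := lam_lim_hull Nj.1 (dd0 Nj.2).
  have [m cm] := cone_finite ck; exists m, T, k; split=> //.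
  have -> // : [set n | (Nj.1 <= n < m)%N] = [set n | (Nj.1 <= n)%N] `&` [set n | (n < m)%N].
  by apply/seteqP; split=> n /=; [move/andP|move=> H; apply/andP].
have [M MP] := choice blocks.
(* Block j consists of the indices from [b j] up to [b j.+1]; the maximum keeps [b] monotone and the
   blocks disjoint. *)
pose b := fix b j := if j is j'.+1 then maxn (b j') (M (b j', j')) else 0%N.
have b_mono i j : (i <= j)%N -> (b i <= b j)%N.
  move=> /subnKC <-; elim: (j - i)%N => [|l IH]; first by rewrite addn0.
  by rewrite addnS; apply: leq_trans IH _; exact: leq_maxl.
pose in_block j n := (b j <= n < b j.+1)%N.
have block_uniq i j n : in_block i n -> in_block j n -> i = j.
  move=> /andP[h1 h2] /andP[h3 h4]; case: (ltngtP i j) => [ij|ji|//].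
    by have := leq_trans (leq_trans h2 (b_mono _ _ ij)) h3; rewrite ltnn.
  by have := leq_trans (leq_trans h4 (b_mono _ _ ji)) h1; rewrite ltnn.
pose eps n := `[< exists2 j, ~~ odd j & in_block j n >].
have [x xP] := interp eps.
have block j : exists T k, cone U (in_block j) T k /\ dual_norm k < dd j * T.
  have [T [k [ck kT]]] := MP (b j, j); exists T, k; split=> //.
  apply: cone_sub ck => n /andP[n1 n2]; apply/andP; split=> //.
  by apply: leq_trans n2 _; rewrite leq_max leqnn orbT.
have Re_eps n : complex.Re (lam n x) <= (eps n)%:R + 1 / 4 /\
    (eps n)%:R - 1 / 4 <= complex.Re (lam n x).
  have := le_trans (normRe_le _) (xP n); rewrite cReD cReN.
  have -> : complex.Re ((eps n)%:R : C) = (eps n)%:R by case: (eps n).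
  by rewrite ler_norml => /andP[h1 h2]; lra.
have kx (k : W) T j I : cone U I T k -> dual_norm k < dd j * T ->
    0 < T /\ `|complex.Re (k x)| <= dd j * T * rnorm x.
  move=> ck kT.
  have UD n : Wdual (U n).
    apply: dual_add; first exact: lam_dual.
    by rewrite -scaleN1r; apply: dual_scale; exact: lam_lim_dual.
  have kc : continuous_dual k := cone_D dual_zero dual_add dual_scale UD ck.
  split.
    have := cone_ge0 ck; rewrite le_eqVlt => /predU1P[T0|//].
    by have := dual_norm_ge0 kc; move: kT; rewrite -T0 mulr0; lra.
  apply: le_trans (normRe_le _) _; apply: le_trans (dual_norm_le x kc) _.
  by rewrite ler_wpM2r ?rnorm_ge0// ltW.
have up j : ~~ odd j -> 3 / 4 - complex.Re (lam_lim x) <= dd j * rnorm x.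
  move=> ej; have [T [k [ck kT]]] := block j; have [T0 kxT] := kx k T j _ ck kT.
  have H : forall n, in_block j n -> 3 / 4 <= complex.Re (lam n x).
    move=> n nj; have [_] := Re_eps n; have -> : eps n by apply/asboolP; exists j.
    by rewrite /=; lra.
  have h := cone_eval ck H; have h' := ler_norm (complex.Re (k x)).
  by rewrite -(ler_pM2r T0); lra.
have down j : odd j -> complex.Re (lam_lim x) - 1 / 4 <= dd j * rnorm x.
  move=> oj; have [T [k [ck kT]]] := block j; have [T0 kxT] := kx k T j _ ck kT.
  have H : forall n, in_block j n -> complex.Re (lam n x) <= 1 / 4.
    move=> n nj; have [+ _] := Re_eps n.
    have -> : eps n = false.
      by apply/asboolP => -[i ei ni]; move: ei; rewrite (block_uniq _ _ _ ni nj) oj.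
    by rewrite /=; lra.
  have h := cone_eval_le ck H; have h' : - `|complex.Re (k x)| <= complex.Re (k x).
    by rewrite lerNl -normrN ler_norm.
  by rewrite -(ler_pM2r T0); lra.
have x0 := rnorm_ge0 x.
pose n := Num.bound (4 * rnorm x).
have n4 : 4 * rnorm x < n%:R by apply: archi_boundP; rewrite mulr_ge0.
have small j : (n <= j)%N -> dd j * rnorm x < 1 / 4.
  move=> nj; rewrite mulrC ltr_pdivrMr ?ltr0n//.
  have : n%:R <= j.+1%:R :> R by rewrite ler_nat leqW.
  lra.
(* With tolerance below 1/4, the even block forces the real part of [lam_lim x] above 1/2 and the
   odd block forces it below 1/2. *)
have := up n.*2; have := down n.*2.+1; rewrite /= odd_double => /(_ isT) h1 /(_ isT) h2.
have := small n.*2; have := small n.*2.+1.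
have nn : (n <= n.*2)%N by rewrite -addnn leq_addr.
by rewrite nn (leqW nn) => /(_ isT) h3 /(_ isT) h4; lra.
Qed.

End ReflexiveMazur.
End Duality.

(** * Symbols of Volterra operators *)

Section Dilations.
Variable R : realType.
Local Notation C := (Cplx R).
Local Notation rC := (@real_to_Cplx R).

Lemma HD_dilation (f : C -> C) (r : R) : HD f -> 0 < r < 1 -> HD (dilation r f) /\
  bounded_disc (dilation r f) /\ bounded_disc (derive1 (dilation r f)).
Proof.
move=> fD /andP[r0 r1].
have rz z : rnorm z < 1 -> rnorm (rC r * z) <= r.
  by move=> z1; rewrite rnormM rnorm_real ger0_norm ?(ltW r0)// ler_piMr// ltW.
have dD z : rnorm z < 1 -> is_cderiv (dilation r f) z (rC r * derive1 f (rC r * z)).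
  move=> z1; have := HD_cderiv fD (le_lt_trans (rz z z1) r1) => fz e e0.
  have [d d0 dP] := fz e e0; exists d => // k kd.
  have nk : rnorm (rC r * k) <= rnorm k.
    by rewrite rnormM rnorm_real ger0_norm ?(ltW r0)// ler_piMl ?rnorm_ge0// ltW.
  have := dP _ (le_lt_trans nk kd); rewrite -mulrDr => h.
  have -> : k * (rC r * derive1 f (rC r * z)) = rC r * k * derive1 f (rC r * z).
    by move: (derive1 f _) => ?; ring.
  by apply: le_trans h _; rewrite ler_wpM2l// ltW.
have r01 : 0 <= r < 1 by rewrite (ltW r0).
split; first by move=> z; rewrite disc_rnorm => z1; exact: is_cderiv_derivable (dD z z1).
split.
  by have [M M0 MP] := HD_bounded fD r01; exists M => // z z1; exact/MP/rz.
have [M M0 MP] := HD_bounded (HD_derive1 fD) r01; exists M => // z z1.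
rewrite (is_cderiv_derive1 (dD z z1)) rnormM rnorm_real ger0_norm ?(ltW r0)//.
apply: (@le_trans _ _ (1 * M)); last by rewrite mul1r.
by apply: ler_pM; [exact: ltW|exact: rnorm_ge0|exact: ltW|exact/MP/rz].
Qed.

(** A dilation is bounded together with its derivative, so [T_op_near_const] compares the increment
    with p z (g z - g w) on the whole disc. *)
Lemma T_op_dilation_uc (g f : C -> C) (r : R) : HD g -> uc_disc g -> HD f -> 0 < r < 1 ->
  uc_disc (T_op g (dilation r f)).
Proof.
move=> gD gu fD r01; have [pD [[P P0 PP] [Q Q0 QP]]] := HD_dilation fD r01.
have [G G0 GP] := uc_bounded gD gu.
move: (dilation r f) pD PP QP => p pD PP QP e e0.
have P1 : 0 < 1 + P by lra.
have K1 : 0 < 1 + 4 * (G * Q) by have := mulr_ge0 G0 Q0; lra.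
have e1 : 0 < e / 2 / (1 + P) by rewrite !divr_gt0.
have [d d0 dP] := gu _ e1.
exists (Num.min d (e / 2 / (1 + 4 * (G * Q)))); first by rewrite lt_min d0 !divr_gt0.
move=> z w z1 w1; rewrite lt_min ltr_pdivlMr// => /andP[zwd zwe].
pose rho := Num.max (rnorm z) (rnorm w).
have rho1 : rho < 1 by rewrite gt_max z1.
have zr : rnorm z <= rho by rewrite le_max lexx.
have wr : rnorm w <= rho by rewrite le_max lexx orbT.
have L := @T_op_near_const R g p z w G Q rho gD pD rho1 zr wr
  (fun x xr => GP x (le_lt_trans xr rho1)) (fun x xr => QP x (le_lt_trans xr rho1)).
have := rnorm_le_sub (T_op g p z - T_op g p w) (p z * (g z - g w)); rewrite rnormM.
have : rnorm (p z) * rnorm (g z - g w) <= e / 2.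
  apply: (@le_trans _ _ ((1 + P) * (e / 2 / (1 + P)))).
    apply: ler_pM; [exact: rnorm_ge0|exact: rnorm_ge0| |exact: dP].
    by have := PP z z1; lra.
  by rewrite mulrC divfK// gt_eqF.
have := rnorm_ge0 (z - w); lra.
Qed.

Lemma disc_algebra_Hinf (f : C -> C) : disc_algebra f -> Hinf f.
Proof.
move=> fA; have [M _ MP] := disc_algebra_bounded fA; split; first by case: fA.
by exists M => z; rewrite disc_rnorm; exact: MP.
Qed.

End Dilations.

Section Volterra.
Variables (R : realType) (X : normedModType (Cplx R)) (iota : X -> Cplx R -> Cplx R).
Local Notation C := (Cplx R).
Local Notation rC := (@real_to_Cplx R).
Hypotheses (HX : subspace_of_HD iota) (HinfX : @Hinf R `<=` functions_of iota).

Lemma T_iota_linear g (a : C) (x y : X) (z : C) : HD g -> rnorm z < 1 ->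
  T_op g (iota (a *: x + y)) z = a * T_op g (iota x) z + T_op g (iota y) z.
Proof.
move=> gD z1; rewrite (eq_T_op g (iota_linear HX a x y) z1).
exact: (T_op_linear a gD (@iota_HD _ _ _ HX x) (@iota_HD _ _ _ HX y) z1).
Qed.

Lemma T_iotaB g (x y : X) (z : C) : HD g -> rnorm z < 1 ->
  T_op g (iota (x - y)) z = T_op g (iota x) z - T_op g (iota y) z.
Proof.
move=> gD z1; have := T_iota_linear (-1) y x gD z1.
by rewrite scaleN1r addrC mulN1r addrC => ->; rewrite addrC.
Qed.

(** Membership of the image in [Hinf] is what makes the supremum in [sup_norm] an actual upper
    bound. *)
Lemma TXY_Hinf_bound g : TXY iota (@Hinf R) g -> HD g /\ exists2 M : R, 0 <= M &
  forall x z, rnorm z < 1 -> rnorm (T_op g (iota x) z) <= M * rnorm x.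
Proof.
move=> [gD [gH [M MP]]]; split=> //; exists `|M| => // x z z1.
have [_ [B BP]] := gH x.
apply: (@le_trans _ _ (M * rnorm x)); last by rewrite ler_wpM2r ?rnorm_ge0// ler_norm.
apply: le_trans (MP x); apply: ub_le_sup; last by exists z => //; rewrite disc_rnorm.
by exists B => _ [w wD <-]; exact: BP.
Qed.

Lemma TXY_Hinf_bounded g : TXY iota (@Hinf R) g -> bounded_disc g.
Proof.
move=> /TXY_Hinf_bound[gD [M M0 MP]].
have oneD : HD (fun=> 1 : C) by move=> z _; exact: derivable_cst.
have [|x xE] := HinfX (_ : Hinf (fun=> 1 : C)).
  by split=> //; exists 1 => z _; rewrite rnorm1.
have d1 z : rnorm z < 1 -> derive1 (fun=> 1 : C) z = 0.
  move=> _; apply: is_cderiv_derive1 => e e0; exists 1 => // k _.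
  by rewrite subrr mulr0 subrr rnorm0 mulr_ge0 ?rnorm_ge0// ltW.
exists (M * rnorm x + rnorm (g 0)) => [|z z1]; first by rewrite addr_ge0 ?mulr_ge0 ?rnorm_ge0.
have := MP x z z1; rewrite (eq_T_op g xE z1).
have := T_op_parts gD oneD z1.
have -> : T_op (fun=> 1 : C) g z = 0.
  rewrite T_opE (_ : cint _ 0 1 = cint (fun=> 0) 0 1); first by rewrite cint_cst ?ltr01// mulr0.
  by apply: eq_cint => t t01; rewrite d1 ?mulr0 ?mul0r//; apply: le_lt_trans z1; exact: rnorm_ray.
rewrite addr0 !mul1r => -> h.
by have := rnormD (g z - g 0) (g 0); rewrite subrK; lra.
Qed.

Lemma separable_uc g : separable_space X -> TXY iota (@Hinf R) g -> uc_disc g.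
Proof.
move=> [S [cS dS]] gT; have [gD [M M0 MP]] := TXY_Hinf_bound gT.
apply: contrapT => nuc.
have [delta [z [w [delta0 zw1 dP hump]]]] := gliding_hump gD (TXY_Hinf_bounded gT) nuc.
have /countable_injP[idx idx_inj] := cS.
(* An enumeration of [S], inverse to [idx]; indices that are not attained give 0. *)
pose F n : X := xget 0 [set s | S s /\ idx s = n].
have FE s : S s -> F (idx s) = s.
  move=> Ss; rewrite /F; case: xgetP => [s' _ [Ss' E]|/(_ s) []//].
  by apply: idx_inj; rewrite ?inE.
pose lam n (x : X) := T_op g (iota x) (z n) - T_op g (iota x) (w n).
pose d n := g (z n) - g (w n).
(* The diagonal choice: [lam n x] is steered towards d n when [lam n (F n)] is small and towards 0
   otherwise, so the two differ by at least |d n| / 4. *)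
pose eps n := rnorm (lam n (F n)) < rnorm (d n) / 2.
have [h hH hP] := hump eps; have [x xE] := HinfX hH.
have M1 : 0 < 1 + M by lra.
(* An s within [eta] of x changes [lam n] by at most 2 M eta <= delta / 8, less than |d n| / 4. *)
pose eta := delta / (16 * (1 + M)).
have eta0 : 0 < eta by rewrite divr_gt0// mulr_gt0.
have [s [xs Ss]] : ball x (rC eta) `&` S !=set0.
  apply: dS; last exact: ball_open.
  by exists x; apply: ballxx; rewrite -rC0 real_to_Cplx_lt.
have {}xs : rnorm (x - s) < eta.
  by move: xs; rewrite -ball_normE /= rnormE real_to_Cplx_lt.
pose n := idx s; have [z1 w1] := zw1 n.
have lamx : rnorm (lam n x - (eps n)%:R * d n) <= rnorm (d n) / 4.
  by have := hP n; rewrite /lam (eq_T_op g xE z1) (eq_T_op g xE w1).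
have lams : rnorm (lam n x - lam n s) <= delta / 8.
  have -> : lam n x - lam n s =
      T_op g (iota (x - s)) (z n) - T_op g (iota (x - s)) (w n).
    by rewrite !T_iotaB// /lam; ring.
  have := rnormB (T_op g (iota (x - s)) (z n)) (T_op g (iota (x - s)) (w n)).
  have := MP (x - s) _ z1; have := MP (x - s) _ w1.
  have : M * rnorm (x - s) <= delta / 16.
    apply: (@le_trans _ _ ((1 + M) * eta)).
      by apply: ler_pM => //; [exact: rnorm_ge0|lra|exact: ltW].
    by rewrite /eta le_eqVlt; apply/orP; left; apply/eqP; field; rewrite gt_eqF.
  lra.
have := dP n; rewrite -/(d n) => dn.
have epsn : eps n = (rnorm (lam n s) < rnorm (d n) / 2) by rewrite /eps FE.
have [lt|ge] := ltP (rnorm (lam n s)) (rnorm (d n) / 2).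
  rewrite epsn lt mul1r in lamx.
  have := rnorm_le_sub (d n) (lam n x); rewrite (rnormBC (d n)).
  have := rnorm_le_sub (lam n x) (lam n s); lra.
rewrite epsn ltNge ge mul0r subr0 in lamx.
by have := rnorm_le_sub (lam n s) (lam n x); rewrite (rnormBC (lam n s)); lra.
Qed.

Lemma reflexive_uc g : reflexive_space X -> TXY iota (@Hinf R) g -> uc_disc g.
Proof.
move=> Xr gT; have [gD [M M0 MP]] := TXY_Hinf_bound gT.
apply: contrapT => nuc.
have [delta [z [w [delta0 zw1 dP hump]]]] := gliding_hump gD (TXY_Hinf_bounded gT) nuc.
pose d n := g (z n) - g (w n).
have d0 n : 0 < rnorm (d n) by apply: lt_le_trans delta0 (dP n).
have dn0 n : d n != 0 by rewrite -rnorm_gt0.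
(* Division by d n turns the relative error of [gliding_hump] into the absolute error 1/4; |d n| >=
   delta keeps these functionals uniformly bounded. *)
pose lam n (x : X) := (d n)^-1 * (T_op g (iota x) (z n) - T_op g (iota x) (w n)).
have lamS n : scalar (lam n).
  move=> a x y; have [z1 w1] := zw1 n.
  rewrite /lam !T_iota_linear// [RHS]/=.
  move: (T_op g _ _) (T_op g _ _) (T_op g _ _) (T_op g _ _) => A1 A2 A3 A4.
  by ring.
apply: (@reflexive_no_interpolation _ _ Xr lam (2 * M / delta) lamS).
- move=> n x; have [z1 w1] := zw1 n; rewrite /lam rnormM rnormV mulrC ler_pdivrMr//.
  have := rnormB (T_op g (iota x) (z n)) (T_op g (iota x) (w n)).
  have := MP x _ z1; have := MP x _ w1.
  have : 2 * M * rnorm x <= 2 * M / delta * rnorm x * rnorm (d n).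
    have -> : 2 * M / delta * rnorm x * rnorm (d n) = 2 * M * rnorm x * (rnorm (d n) / delta).
      by field; rewrite gt_eqF.
    rewrite ler_peMr ?mulr_ge0 ?rnorm_ge0//.
    by rewrite ler_pdivlMr// mul1r; exact: dP.
  lra.
- move=> eps; have [h hH hP] := hump eps; have [x xE] := HinfX hH.
  exists x => n; have [z1 w1] := zw1 n.
  have -> : lam n x - (eps n)%:R =
      (d n)^-1 * (T_op g h (z n) - T_op g h (w n) - (eps n)%:R * d n).
    rewrite /lam (eq_T_op g xE z1) (eq_T_op g xE w1).
    by rewrite [RHS]mulrBr [X in _ = _ - X]mulrCA mulVf// mulr1.
  by rewrite rnormM rnormV mulrC ler_pdivrMr// mul1r (mulrC 4^-1); exact: hP.
Qed.

(** Adding T x back to k undoes the subtractions of x and leaves a finite combination of the y n. *)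
Lemma uc_disc_cone g (y : nat -> X) (x : X) T k : HD g ->
  (forall n, uc_disc (T_op g (iota (y n)))) -> cone (fun n => y n - x) setT T k ->
  uc_disc (T_op g (iota (k + rC T *: x))).
Proof.
move=> gD yu; elim=> [|{}T {}k n t _ IH _ t0].
  have T0 z : rnorm z < 1 -> T_op g (iota (0 + rC 0 *: x)) z = 0.
    by move=> z1; rewrite rC0 scale0r addr0 -(subrr x) T_iotaB// subrr.
  by move=> e e0; exists 1 => // z w z1 w1 _; rewrite !T0// subrr rnorm0 ltW.
have -> : k + rC t *: (y n - x) + rC (T + t) *: x = rC t *: y n + (k + rC T *: x).
  by rewrite rCD scalerDl scalerBr (addrC (rC T *: x)) addrA -(addrA k) subrK (addrC k) -addrA.
move=> e e0; have e2 : 0 < e / 2 by rewrite divr_gt0.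
have t1 : 0 < 1 + t by lra.
have e3 : 0 < e / 2 / (1 + t) by rewrite divr_gt0.
have [d1 d10 d1P] := IH _ e2; have [d2 d20 d2P] := yu n _ e3.
exists (Num.min d1 d2); first by rewrite lt_min d10.
move=> z w z1 w1; rewrite lt_min => /andP[zw1 zw2].
rewrite !T_iota_linear//.
have h1 := d1P z w z1 w1 zw1; have h2 := d2P z w z1 w1 zw2.
move: (T_op g (iota (y n)) z) (T_op g (iota (y n)) w) h2 => A1 A2 h2.
move: (T_op g _ z) (T_op g _ w) h1 => B1 B2 h1.
have -> : rC t * A1 + B1 - (rC t * A2 + B2) = rC t * (A1 - A2) + (B1 - B2) by ring.
apply: le_trans (rnormD _ _) _; rewrite rnormM rnorm_real ger0_norm//.
have : t * rnorm (A1 - A2) <= e / 2.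
  move: h2; rewrite ler_pdivlMr// => h2; have := rnorm_ge0 (A1 - A2); lra.
lra.
Qed.

Lemma reflexive_admissible_uc g x : reflexive_space X -> admissible iota ->
  TXY iota (@Hinf R) g -> uc_disc (T_op g (iota x)).
Proof.
move=> Xr [_ [K KP] Xev] gT; have gu := reflexive_uc Xr gT.
have [gD [M M0 MP]] := TXY_Hinf_bound gT.
have /choice[y yP] := fun n => KP x (@dilation_radius R n) (dilation_radius01 R n).
have xD := @iota_HD _ _ _ HX x.
have yB n : rnorm (y n) <= K * rnorm x by have [] := yP n.
have yu n : uc_disc (T_op g (iota (y n))).
  have u := T_op_dilation_uc gD gu xD (dilation_radius01 R n).
  move=> e /u[d d0 dP]; exists d => // z w z1 w1 zw.
  by rewrite (eq_T_op g (yP n).1 z1) (eq_T_op g (yP n).1 w1); exact: dP.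
have [x' x'P] := Xr _ (bidual_ulim yB).
have wl phi : continuous_dual phi -> bounded_seq (fun n => phi (y n)) /\
    ulim (fun n => phi (y n)) = phi x.
  move=> pc; split.
    exists (dual_norm phi * (K * rnorm x)) => n.
    apply: le_trans (dual_norm_le _ pc) _.
    by rewrite ler_wpM2l// dual_norm_ge0.
  (* The weak limit is identified with x by point evaluations: at z both equal the limit of x(r_n
     z). *)
  rewrite x'P//; congr phi; apply: (iota_inj HX) => z zD.
  rewrite -(x'P _ (Xev z zD)); rewrite disc_rnorm in zD.
  apply: ulim_cvg => e e0.
  have [d d0 dP] := (ccontP _ z).1 (HD_cont xD zD) (e / 2) (divr_gt0 e0 (ltr0Sn _ 1)).
  have [N NP] := dilation_radius_near1 d0; exists N => n /NP nd.
  rewrite (yP n).1 ?disc_rnorm// /dilation.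
  apply: (@le_lt_trans _ _ (e / 2)); last lra.
  apply: dP; have /andP[r0 r1] := dilation_radius01 R n.
  have -> : rC (dilation_radius R n) * z - z = - (rC (1 - dilation_radius R n) * z).
    by rewrite (rCB 1 (dilation_radius R n)) rC1; ring.
  rewrite rnormN rnormM rnorm_real ger0_norm; last lra.
  have := rnorm_ge0 z; nra.
move=> e e0; have e4 : 0 < e / 4 by rewrite divr_gt0.
have M1 : 0 < 1 + M by lra.
have e5 : 0 < e / 4 / (1 + M) by rewrite divr_gt0.
(* Then M |k| <= (e / 4) T at both points; with oscillation (e / 2) T for the image of k + T x, the
   image of T x oscillates by at most e T, and T is divided out. *)
have [T [k [ck kT]]] := weak_limit_hull e5 wl.
have T0 : 0 < T.
  have := cone_ge0 ck; rewrite le_eqVlt => /predU1P[T0|//].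
  by have := rnorm_ge0 k; move: kT; rewrite -T0 mulr0; lra.
have eT : 0 < e / 2 * T by rewrite mulr_gt0// divr_gt0.
have [d d0 dP] := uc_disc_cone gD yu ck eT.
exists d => // z w z1 w1 zw; have h := dP z w z1 w1 zw.
have E v : rnorm v < 1 -> T_op g (iota (k + rC T *: x)) v =
    rC T * T_op g (iota x) v + T_op g (iota k) v.
  by move=> v1; rewrite addrC T_iota_linear.
rewrite !E// in h; have kz := MP k z z1; have kw := MP k w w1.
have kM : M * rnorm k <= e / 4 * T.
  move: kT; rewrite mulrAC ltr_pdivlMr// => kT; have := rnorm_ge0 k; lra.
move: (T_op g (iota x) z) (T_op g (iota x) w) h => A1 A2 h.
move: (T_op g _ z) (T_op g _ w) h kz kw => B1 B2 h kz kw.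
have := rnorm_le_sub (rC T * (A1 - A2)) (rC T * A1 + B1 - (rC T * A2 + B2)).
have -> : rC T * (A1 - A2) - (rC T * A1 + B1 - (rC T * A2 + B2)) = B2 - B1 by ring.
rewrite rnormM rnorm_real gtr0_norm// => h1; have h2 := rnormB B2 B1.
by rewrite -(ler_pM2l T0); lra.
Qed.

End Volterra.

Theorem corollary3p8 (R : realType) (X : completeNormedModType (Cplx R))
    (iota : X -> Cplx R -> Cplx R) (HX : subspace_of_HD iota)
    (HinfX : @Hinf R `<=` functions_of iota) :
  (separable_space X -> TXY iota (@Hinf R) `<=` @disc_algebra R) /\
  (reflexive_space X -> admissible iota ->
     TXY iota (@Hinf R) = TXY iota (@disc_algebra R)).
Proof.
split=> [Xs g gT|Xr Xa].
  by have [gD _] := gT; apply: uc_disc_algebra => //; exact: separable_uc gT.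
(* Both targets carry [sup_norm], so the operator bound is transferred unchanged and only membership
   of the images is at stake. *)
apply/seteqP; split=> g gT; have [gD [gY gM]] := gT; split; try exact: gD.
  split=> [x|]; last exact: gM.
  by apply: uc_disc_algebra; [case: (gY x)|exact: reflexive_admissible_uc gT].
split=> [x|]; [exact/disc_algebra_Hinf/gY|exact: gM].
Qed.
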